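(* Let $R$ be a commutative artin ring and $A$ an $R$-algebra which is finitely generated as an $R$-module. Let $(\mathcal{X}, \mathcal{Y})$ be a torsion theory for $\mathsf{mod}\,A$ such that $\mathcal{X}$ contains an $\operatorname{Ext}$-projective module $X$ which generates $\mathcal{X}$, $\mathcal{Y}$ contains an $\operatorname{Ext}$-injective module $Y$ which cogenerates $\mathcal{Y}$, and $\mathcal{X}$ is stable under $DA \otimes_{A} -$. Let $M^{\bullet}_{X}$ be a minimal projective presentation of $X$ and $N^{\bullet}_{Y}$ a minimal injective presentation of $Y$. Then $$P^{\bullet} = M^{\bullet}_{X} \oplus \operatorname{Hom}^{\bullet}_{A}(DA, N^{\bullet}_{Y})[1]$$ is a tilting complex such that $\mathcal{X} = \mathcal{X}_{c}(P^{\bullet})$ and $\mathcal{Y} = \mathcal{Y}_{c}(P^{\bullet})$.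
   Context: $\mathsf{Mod}\,A$ is the category of left $A$-modules, $\mathsf{mod}\,A$ its full subcategory of finitely generated modules, and $\mathsf{D}(\mathsf{Mod}\,A)$ the (unbounded) derived category; modules are regarded as complexes concentrated in degree $0$. $D = \operatorname{Hom}_{R}(-, I)$, where $I$ is an injective envelope of the $R$-module $R/\operatorname{rad}(R)$; $DA$ is an $A$-$A$-bimodule. $M^{\bullet}_{X}$ is viewed as a complex $M^{-1} \to M^{0}$ of finitely generated projective modules in degrees $-1, 0$ (with $\operatorname{H}^0 = X$), and $N^{\bullet}_{Y}$ as a complex $N^{0} \to N^{1}$ of finitely generated injective modules in degrees $0, 1$ (with $\operatorname{H}^0 = Y$); so $P^{\bullet}$ is a complex of finitely generated projective modules concentrated in degrees $-1$ and $0$. For such $P^{\bullet}$: $\mathcal{X}_{c}(P^{\bullet}) = \{Z \in \mathsf{mod}\,A : \operatorname{Hom}_{\mathsf{D}(\mathsf{Mod}\,A)}(P^{\bullet}, Z[1]) = 0\}$ and $\mathcal{Y}_{c}(P^{\bullet}) = \{Z \in \mathsf{mod}\,A : \operatorname{Hom}_{\mathsf{D}(\mathsf{Mod}\,A)}(P^{\bullet}, Z) = 0\}$. For a full subcategory $\mathcal{C}$ closed under extensions in an abelian category $\mathcal{A}$, $Z \in \mathcal{C}$ is $\operatorname{Ext}$-projective (resp. $\operatorname{Ext}$-injective) if $\operatorname{Ext}^{1}_{\mathcal{A}}(Z, \mathcal{C}) = 0$ (resp. $\operatorname{Ext}^{1}_{\mathcal{A}}(\mathcal{C}, Z) = 0$).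 A module $X$ generates $\mathcal{X}$ if every module in $\mathcal{X}$ is a factor of a direct sum of copies of $X$; $Y$ cogenerates $\mathcal{Y}$ if every module in $\mathcal{Y}$ embeds in a direct product of copies of $Y$. A pair $(\mathcal{X}, \mathcal{Y})$ of full subcategories of an abelian category $\mathcal{A}$ is a torsion theory for $\mathcal{A}$ if: (i) $\mathcal{X} \cap \mathcal{Y} = \{0\}$; (ii) $\mathcal{X}$ is closed under factor objects; (iii) $\mathcal{Y}$ is closed under subobjects; (iv) for any $Z \in \mathcal{A}$ there is an exact sequence $0 \to Z' \to Z \to Z'' \to 0$ in $\mathcal{A}$ with $Z' \in \mathcal{X}$ and $Z'' \in \mathcal{Y}$. A tilting complex for $A$ (in the sense of Rickard) is a bounded complex $T^{\bullet}$ of finitely generated projective $A$-modules such that $\operatorname{Hom}_{\mathsf{D}(\mathsf{Mod}\,A)}(T^{\bullet}, T^{\bullet}[i]) = 0$ for all $i \neq 0$ and the direct summands of finite direct sums of copies of $T^{\bullet}$ generate $\mathsf{K}^{\mathrm{b}}(\mathsf{proj}\,A)$ (the homotopy category of bounded complexes of finitely generated projective modules) as a triangulated category. *)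

(* Defs.v *)
From HB Require Import structures.
From mathcomp Require Import all_boot all_order all_algebra.
From mathcomp Require Import boolp classical_sets.

Set Implicit Arguments.
Unset Strict Implicit.
Unset Printing Implicit Defensive.

Import GRing.Theory.
Local Open Scope classical_set_scope.
Local Open Scope ring_scope.

(* Left modules over a ring S are the library's lmodType S.  A full subcategory
   of modules is a predicate on lmodType S. *)

(** ** Modules *)

Section Modules.
Variable S : pzRingType.
Implicit Types (M N P Q U V W Z : lmodType S).

Definition is_zero M : Prop := forall x : M, x = 0.

Definition submodule M (K : set M) : Prop :=
  [/\ K 0, (forall x y, K x -> K y -> K (x + y)) &
      forall (a : S) x, K x -> K (a *: x)].

Definition kernel M N (f : {linear M -> N}) : set M := [set x | f x = 0].

Definition surj M N (f : {linear M -> N}) : Prop := forall y, exists x, f x = y.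

Definition finitely_generated M : Prop :=
  exists n (g : 'I_n -> M), forall x,
    exists c : 'I_n -> S, x = \sum_(i < n) c i *: g i.

Definition artinian M : Prop := forall F : nat -> set M,
  (forall n, submodule (F n)) -> (forall n, F n.+1 `<=` F n) ->
  exists n, forall m, (n <= m)%N -> F m = F n.

Definition projective P : Prop :=
  forall U V (p : {linear U -> V}) (f : {linear P -> V}), surj p ->
    exists g : {linear P -> U}, forall x, p (g x) = f x.

Definition injective_module Q : Prop :=
  forall U V (i : {linear U -> V}) (f : {linear U -> Q}), injective i ->
    exists g : {linear V -> Q}, forall x, g (i x) = f x.

Definition superfluous P (K : set P) : Prop :=
  forall L : set P, submodule L ->
    (forall x, exists k l, [/\ K k, L l & x = k + l]) -> forall x, L x.

Definition essential Q (K : set Q) : Prop :=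
  forall L : set Q, submodule L ->
    (forall x, K x -> L x -> x = 0) -> forall x, L x -> x = 0.

(* f : P -> M corestricts to a projective cover P -> K of the submodule K. *)
Definition projective_cover P M (f : {linear P -> M}) (K : set M) : Prop :=
  [/\ projective P, range f = K & superfluous (kernel f)].

(* f : M -> Q factors through an injective envelope M/K -> Q of the quotient
   of M by the submodule K; K = 0 gives the injective envelopes of M. *)
Definition injective_envelope M Q (f : {linear M -> Q}) (K : set M) : Prop :=
  [/\ injective_module Q, kernel f = K & essential (range f)].

Definition short_exact U V W (i : {linear U -> V}) (p : {linear V -> W}) : Prop :=
  [/\ injective i, range i = kernel p & surj p].

(* Yoneda Ext^1(Z, C) = 0, computed in the category of finitely generated
   modules: every extension of Z by C is equivalent to the trivial one. *)
Definition Ext1_zero (Z C : lmodType S) : Prop :=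
  forall (E : lmodType S) (i : {linear C -> E}) (p : {linear E -> Z}),
    finitely_generated E -> short_exact i p ->
    exists phi : {linear (C * Z)%type -> E},
      [/\ bijective phi, (forall c, phi (c, 0) = i c) &
          forall u, p (phi u) = u.2].

Definition coproduct (J : Type) (M : J -> lmodType S) (T : lmodType S)
    (inc : forall j, {linear M j -> T}) : Prop :=
  forall (W : lmodType S) (f : forall j, {linear M j -> W}),
    exists g : {linear T -> W}, (forall j x, g (inc j x) = f j x) /\
      forall g' : {linear T -> W}, (forall j x, g' (inc j x) = f j x) ->
        g' =1 g.

Definition product (J : Type) (M : J -> lmodType S) (T : lmodType S)
    (pr : forall j, {linear T -> M j}) : Prop :=
  forall (W : lmodType S) (f : forall j, {linear W -> M j}),
    exists g : {linear W -> T}, (forall j x, pr j (g x) = f j x) /\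
      forall g' : {linear W -> T}, (forall j x, pr j (g' x) = f j x) ->
        g' =1 g.

Definition generates (X : lmodType S) (XX : lmodType S -> Prop) : Prop :=
  forall Z, XX Z -> exists (J : Type) (T : lmodType S) (inc : J -> {linear X -> T})
    (p : {linear T -> Z}), coproduct inc /\ surj p.

Definition cogenerates (Y : lmodType S) (YY : lmodType S -> Prop) : Prop :=
  forall Z, YY Z -> exists (J : Type) (T : lmodType S) (pr : J -> {linear T -> Y})
    (i : {linear Z -> T}), product pr /\ injective i.

Definition Ext_projective (X : lmodType S) (XX : lmodType S -> Prop) : Prop :=
  forall Z, XX Z -> Ext1_zero X Z.

Definition Ext_injective (Y : lmodType S) (YY : lmodType S -> Prop) : Prop :=
  forall Z, YY Z -> Ext1_zero Z Y.

(* Torsion theory (XX, YY) for the category of finitely generated modules. *)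
Definition torsion_theory (XX YY : lmodType S -> Prop) : Prop :=
  [/\ (forall Z, XX Z -> finitely_generated Z) /\
        (forall Z, YY Z -> finitely_generated Z),
      (forall Z, XX Z /\ YY Z <-> is_zero Z),
      (forall (Z Z' : lmodType S) (p : {linear Z -> Z'}), surj p -> XX Z -> XX Z'),
      (forall (Z Z' : lmodType S) (i : {linear Z' -> Z}), finitely_generated Z' ->
        injective i -> YY Z -> YY Z') &
      forall Z, finitely_generated Z ->
        exists (Z' Z'' : lmodType S) (i : {linear Z' -> Z}) (p : {linear Z -> Z''}),
          [/\ short_exact i p, XX Z' & YY Z'']].

End Modules.

(* Jacobson radical of a commutative ring: the intersection of its maximal
   ideals, ideals being submodules of the regular module. *)
Definition maximal_ideal (R : comPzRingType) (m : set R^o) : Prop :=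
  [/\ submodule m, ~ m 1 &
      forall J : set R^o, submodule J -> m `<=` J -> ~ J 1 -> J = m].

Definition jacobson_radical (R : comPzRingType) : set R^o :=
  [set x | forall m : set R^o, maximal_ideal m -> m x].

(** ** Bimodules, Hom and tensor product *)

(* An S-A-bimodule: a left S-module with a commuting right A-action. *)
Record bimodule (S A : pzRingType) := Bimodule {
  bimodule_sort :> lmodType S;
  ract : bimodule_sort -> A -> bimodule_sort;
  ract_linear : forall a, linear (ract ^~ a);
  ractDr : forall b a a', ract b (a + a') = ract b a + ract b a';
  ract1 : forall b, ract b 1 = b;
  ractM : forall b a a', ract b (a * a') = ract (ract b a) a' }.

Lemma linear_ext (S : pzRingType) (U V : lmodType S) (f g : {linear U -> V}) :
  f =1 g -> f = g.
Proof.
case: f g => [f [[fD] [fZ]]] [g [[gD] [gZ]]] /= /funext fg.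
rewrite {}fg in fD fZ *.
by rewrite (Prop_irrelevance fD gD) (Prop_irrelevance fZ gZ).
Qed.

Definition mklinear (S : pzRingType) (U V : lmodType S) (f : U -> V)
    (lf : linear f) : {linear U -> V} :=
  HB.pack f (GRing.isLinear.Build S U V _ f lf).

(* Hom_S(B, N), a left A-module via (a g)(b) = g(b a). *)
Definition hom_mod (S A : pzRingType) (B : bimodule S A) (N : lmodType S) :=
  {linear B -> N}.

Section HomMod.
Variables (S A : pzRingType) (B : bimodule S A) (N : lmodType S).
Local Notation H := (hom_mod B N).

HB.instance Definition _ := gen_eqMixin H.
HB.instance Definition _ := gen_choiceMixin H.

Fact hom0_linear : linear (fun _ : B => 0 : N).
Proof. by move=> s x y; rewrite scaler0 addr0. Qed.

Fact homD_linear (f g : H) : linear (fun b => f b + g b).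
Proof. by move=> s x y; rewrite !linearP scalerDr addrACA. Qed.

Fact homN_linear (f : H) : linear (fun b => - f b).
Proof. by move=> s x y; rewrite linearP opprD scalerN. Qed.

Fact homZ_linear (a : A) (f : H) : linear (fun b => f (ract b a)).
Proof. by move=> s x y; rewrite ract_linear linearP. Qed.

Definition hom0 : H := mklinear hom0_linear.
Definition homD (f g : H) : H := mklinear (homD_linear f g).
Definition homN (f : H) : H := mklinear (homN_linear f).
Definition homZ (a : A) (f : H) : H := mklinear (homZ_linear a f).

Fact homDA : associative homD.
Proof. by move=> f g h; apply: linear_ext => b /=; rewrite addrA. Qed.
Fact homDC : commutative homD.
Proof. by move=> f g; apply: linear_ext => b /=; rewrite addrC. Qed.
Fact hom0D : left_id hom0 homD.
Proof. by move=> f; apply: linear_ext => b /=; rewrite add0r. Qed.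
Fact homND : left_inverse hom0 homN homD.
Proof. by move=> f; apply: linear_ext => b /=; rewrite addNr. Qed.

HB.instance Definition _ := GRing.isZmodule.Build H homDA homDC hom0D homND.

Fact homZA a a' (f : H) : homZ a (homZ a' f) = homZ (a * a') f.
Proof. by apply: linear_ext => b /=; rewrite ractM. Qed.
Fact hom1Z : left_id 1 homZ.
Proof. by move=> f; apply: linear_ext => b /=; rewrite ract1. Qed.
Fact homZDr : right_distributive homZ +%R.
Proof. by move=> a f g; apply: linear_ext. Qed.
Fact homZDl (f : H) : {morph homZ^~ f : a a' / a + a'}.
Proof. by move=> a a'; apply: linear_ext => b /=; rewrite ractDr linearD. Qed.

HB.instance Definition _ :=
  GRing.Zmodule_isLmodule.Build A H homZA hom1Z homZDr homZDl.

End HomMod.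

Section Dual.
Variables (R : comPzRingType) (A : algType R) (I : lmodType R).

Fact regular_ract_linear (a : A) : linear (fun x : A => x * a).
Proof. by move=> k x y; rewrite mulrDl scalerAl. Qed.

(* A as an R-A-bimodule. *)
Definition regular_bimodule : bimodule R A :=
  @Bimodule R A A (fun x a => x * a) regular_ract_linear
    (fun b a a' => mulrDr b a a') (fun b => mulr1 b)
    (fun b a a' => mulrA b a a').

Fact dual_ract_subproof (f : hom_mod regular_bimodule I) (a : A) :
  linear (fun x : regular_bimodule => f (a * x)).
Proof. by move=> k x y; rewrite mulrDr -scalerAr linearP. Qed.

Definition dual_ract (f : hom_mod regular_bimodule I) (a : A) :
    hom_mod regular_bimodule I := mklinear (dual_ract_subproof f a).

Fact dual_ract_linear a : linear (dual_ract ^~ a).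
Proof.
by move=> k f g; apply: linear_ext => x /=; rewrite mulrA.
Qed.
Fact dual_ractDr f a a' : dual_ract f (a + a') = dual_ract f a + dual_ract f a'.
Proof. by apply: linear_ext => x /=; rewrite mulrDl linearD. Qed.
Fact dual_ract1 f : dual_ract f 1 = f.
Proof. by apply: linear_ext => x /=; rewrite mul1r. Qed.
Fact dual_ractM f a a' : dual_ract f (a * a') = dual_ract (dual_ract f a) a'.
Proof. by apply: linear_ext => x /=; rewrite mulrA. Qed.

(* Hom_R(A, I) as an A-A-bimodule: (a f)(x) = f(x a) and (f a)(x) = f(a x). *)
Definition dual_bimodule : bimodule A A :=
  Bimodule dual_ract_linear dual_ractDr dual_ract1 dual_ractM.

End Dual.

Definition balanced (S A : pzRingType) (B : bimodule S A) (Z : lmodType A)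
    (G : zmodType) (t : B -> Z -> G) : Prop :=
  [/\ (forall b b' z, t (b + b') z = t b z + t b' z),
      (forall b z z', t b (z + z') = t b z + t b z') &
      forall b a z, t (ract b a) z = t b (a *: z)].

(* The left S-module T, with (b, z) |-> t b z, is the tensor product of B and Z
   over A. *)
Definition tensor_product (S A : pzRingType) (B : bimodule S A) (Z : lmodType A)
    (T : lmodType S) (t : B -> Z -> T) : Prop :=
  [/\ balanced t,
      (forall (s : S) b z, t (s *: b) z = s *: t b z) &
      forall (G : zmodType) (u : B -> Z -> G), balanced u ->
        exists g : {additive T -> G}, (forall b z, g (t b z) = u b z) /\
          forall g' : {additive T -> G}, (forall b z, g' (t b z) = u b z) ->
            g' =1 g].

Definition stable_under_tensor (A : pzRingType) (B : bimodule A A)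
    (XX : lmodType A -> Prop) : Prop :=
  forall (Z T : lmodType A) (t : B -> Z -> T),
    tensor_product t -> XX Z -> XX T.

(** ** Cochain complexes *)

(* The differential is given as a family d^{i,j} : C^i -> C^j which vanishes
   unless j = i + 1; this avoids casts along equalities of degrees. *)
Record complex (A : pzRingType) := Complex {
  cobj :> int -> lmodType A;
  diff : forall i j, {linear cobj i -> cobj j};
  diff_shape : forall i j, j != i + 1 -> forall x, diff i j x = 0;
  diff_diff : forall i j k x, diff j k (diff i j x) = 0 }.
Arguments diff {A} c i j.

Section Complexes.
Variable A : pzRingType.
Implicit Types C E : complex A.

Record chain_map C E := ChainMap {
  cmap :> forall i, {linear C i -> E i};
  cmap_diff : forall i j x, cmap j (diff C i j x) = diff E i j (cmap i x) }.

Fact id_linear (U : lmodType A) : linear (fun x : U => x).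
Proof. by []. Qed.
Fact zero_linear (U V : lmodType A) : linear (fun _ : U => 0 : V).
Proof. by move=> a x y; rewrite scaler0 addr0. Qed.
Fact comp_linear (U V W : lmodType A) (g : {linear V -> W})
  (f : {linear U -> V}) : linear (fun x => g (f x)).
Proof. by move=> a x y; rewrite !linearP. Qed.

Definition id_map C : chain_map C C :=
  @ChainMap C C (fun i => mklinear (@id_linear (C i))) (fun i j x => erefl).

Definition zero_map C E : chain_map C E.
Proof.
exists (fun i => mklinear (@zero_linear (C i) (E i))).
by move=> i j x /=; rewrite linear0.
Defined.

Definition comp_map C1 C2 C3 (g : chain_map C2 C3) (f : chain_map C1 C2) :
  chain_map C1 C3.
Proof.
exists (fun i => mklinear (comp_linear (g i) (f i))).
by move=> i j x /=; rewrite !cmap_diff.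
Defined.

Definition homotopic C E (f g : chain_map C E) : Prop :=
  exists h : forall i j, {linear C i -> E j}, forall i x,
    f i x - g i x =
      diff E (i - 1) i (h i (i - 1) x) + h (i + 1) i (diff C i (i + 1) x).

Definition homotopy_equivalent C E : Prop :=
  exists (f : chain_map C E) (g : chain_map E C),
    homotopic (comp_map g f) (id_map C) /\ homotopic (comp_map f g) (id_map E).

Definition cocycle C i : set (C i) := [set x | diff C i (i + 1) x = 0].
Definition coboundary C i : set (C i) := range (diff C (i - 1) i).

(* The induced maps H^i(C) -> H^i(E) are injective and surjective. *)
Definition quasi_iso C E (f : chain_map C E) : Prop :=
  forall i,
    (forall x : C i, cocycle x -> coboundary (f i x) -> coboundary x) /\
    (forall y : E i, cocycle y -> exists2 x : C i, cocycle x &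
       coboundary (y - f i x)).

(* Morphisms C -> E of the derived category are equivalence classes of roofs
   C <- apex -> E whose left leg is a quasi-isomorphism. *)
Record roof C E := Roof {
  apex : complex A;
  denom : chain_map apex C;
  numer : chain_map apex E;
  denom_quasi_iso : quasi_iso denom }.

Definition roof_equiv C E (r r' : roof C E) : Prop :=
  exists (T : complex A) (t : chain_map T (apex r)) (t' : chain_map T (apex r')),
    [/\ quasi_iso (comp_map (denom r) t),
        homotopic (comp_map (denom r) t) (comp_map (denom r') t') &
        homotopic (comp_map (numer r) t) (comp_map (numer r') t')].

Fact id_quasi_iso C : quasi_iso (id_map C).
Proof.
move=> i; split=> [x _ //|y y0]; exists y => //=.
by rewrite subrr; exists 0 => //; rewrite linear0.
Qed.

Definition zero_roof C E : roof C E := Roof (zero_map C E) (id_quasi_iso C).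

Definition derived_Hom_zero C E : Prop :=
  forall r : roof C E, roof_equiv r (zero_roof C E).

(* C[n]^i = C^(i+n), with differential (-1)^n d. *)
Fact shift_linear C (n : int) i j :
  linear (fun x : C (i + n) =>
    if odd `|n|%N then - diff C (i + n) (j + n) x else diff C (i + n) (j + n) x).
Proof. by case: odd => a x y; rewrite linearP // opprD scalerN. Qed.

Definition shift C (n : int) : complex A.
Proof.
exists (fun i => C (i + n)) (fun i j => mklinear (@shift_linear C n i j)).
- move=> i j nij x /=; rewrite diff_shape ?oppr0 ?if_same //.
  by rewrite addrAC (inj_eq (addIr n)).
- move=> i j k x /=; case: (odd _); rewrite ?diff_diff //.
  by rewrite (linearN (diff C _ _)) diff_diff !oppr0.
Defined.

(* The module Z as a complex concentrated in degree 0. *)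
Definition stalk (Z : lmodType A) : complex A.
Proof.
exists (fun i => if i == 0 then Z else 'rV[A]_0 : lmodType A)
  (fun i j => mklinear (@zero_linear _ _)).
- by [].
- by [].
Defined.

Fact direct_sum_linear C E i j :
  linear (fun x : (C i * E i)%type => (diff C i j x.1, diff E i j x.2)).
Proof. by move=> a x y; rewrite !linearP. Qed.

Definition direct_sum C E : complex A.
Proof.
exists (fun i => (C i * E i)%type : lmodType A)
  (fun i j => mklinear (@direct_sum_linear C E i j)).
- by move=> i j nij x /=; rewrite !diff_shape.
- by move=> i j k x /=; rewrite !diff_diff.
Defined.

Definition copies (n : nat) C : complex A :=
  iter n (direct_sum C) (stalk ('rV[A]_0 : lmodType A)).

(* The component f^i : C^i -> E^i of a chain map, as a map C^i -> E^j which is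
   0 unless i = j. *)
Definition degree_map C E (f : chain_map C E) i j : C i -> E j :=
  match @eqP _ i j with
  | ReflectT e => fun x => ecast k (E k) e (f i x)
  | ReflectF _ => fun _ => 0
  end.
Arguments degree_map {C E} f i j.

Lemma degree_mapE C E (f : chain_map C E) i x : degree_map f i i x = f i x.
Proof. by rewrite /degree_map; case: eqP => // e; rewrite eq_axiomK. Qed.

Lemma degree_map0 C E (f : chain_map C E) i j x :
  i != j -> degree_map f i j x = 0.
Proof. by rewrite /degree_map; case: eqP. Qed.

Fact degree_map_linear C E (f : chain_map C E) i j :
  linear (degree_map f i j).
Proof.
move=> a x y; have [e|nij] := eqVneq i j; last first.
  by rewrite !degree_map0 // scaler0 addr0.
by case: j / e; rewrite !degree_mapE linearP.
Qed.

Lemma degree_mapN C E (f : chain_map C E) i j x :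
  degree_map f i j (- x) = - degree_map f i j x.
Proof. exact: (linearN (mklinear (@degree_map_linear C E f i j))). Qed.

(* cone(f)^i = C^(i+1) (+) E^i, with d(x, y) = (- d x, f x + d y). *)
Fact cone_linear C E (f : chain_map C E) (i j : int) :
  linear (fun x : (C (i + 1)%R * E i)%type =>
    (- diff C (i + 1) (j + 1) x.1, degree_map f (i + 1) j x.1 + diff E i j x.2)).
Proof.
move=> a x y; congr pair => /=.
  by rewrite (linearP (diff C _ _)) opprD scalerN.
by rewrite degree_map_linear (linearP (diff E _ _)) scalerDr addrACA.
Qed.

Definition cone C E (f : chain_map C E) : complex A.
Proof.
exists (fun i => (C (i + 1)%R * E i)%type : lmodType A)
  (fun i j => mklinear (@cone_linear C E f i j)).
- move=> i j nij x /=; rewrite !diff_shape ?(inj_eq (addIr 1)) //.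
  by rewrite degree_map0 1?eq_sym // oppr0 addr0.
- move=> i j k x /=; rewrite linearN diff_diff !oppr0; congr pair.
  rewrite degree_mapN.
  rewrite (linearD (diff E j k)) diff_diff addr0 addrC; apply/eqP.
  rewrite subr_eq0; apply/eqP.
  have [e|nk] := eqVneq (j + 1) k; last first.
    by rewrite [RHS]degree_map0 // diff_shape // eq_sym.
  case: k / e; rewrite [RHS]degree_mapE.
  have [e|nj] := eqVneq (i + 1) j; last first.
    rewrite degree_map0 // linear0 diff_shape ?linear0 //.
    by rewrite (inj_eq (addIr 1)) eq_sym.
  by case: j / e; rewrite degree_mapE cmap_diff.
Defined.

Definition bounded C : Prop :=
  exists n : nat, forall i : int, (n < `|i|)%N -> is_zero (C i).

(* Bounded complexes of finitely generated projective modules: the objects of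
   K^b(proj A). *)
Definition perfect C : Prop :=
  bounded C /\ forall i, finitely_generated (C i) /\ projective (C i).

(* Full triangulated subcategories (closed under isomorphism) of K^b(proj A). *)
Definition triangulated (TT : complex A -> Prop) : Prop :=
  [/\ (forall C, TT C -> perfect C),
      (forall C E, perfect E -> homotopy_equivalent C E -> TT C -> TT E),
      (forall C n, TT C -> TT (shift C n)) &
      forall C E (f : chain_map C E), TT C -> TT E -> TT (cone f)].

(* E is a direct summand, in K^b(proj A), of a finite direct sum of copies of
   T. *)
Definition in_add T E : Prop :=
  perfect E /\ exists n E', perfect E' /\
    homotopy_equivalent (direct_sum E E') (copies n T).

Definition tilting_complex T : Prop :=
  [/\ perfect T,
      (forall i : int, i != 0 -> derived_Hom_zero T (shift T i)) &
      forall TT : complex A -> Prop, triangulated TT ->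
        (forall E, in_add T E -> TT E) -> forall E, perfect E -> TT E].

Definition Xc (P : complex A) (Z : lmodType A) : Prop :=
  finitely_generated Z /\ derived_Hom_zero P (shift (stalk Z) 1).

Definition Yc (P : complex A) (Z : lmodType A) : Prop :=
  finitely_generated Z /\ derived_Hom_zero P (stalk Z).

(* M, concentrated in degrees -1 and 0, is a minimal projective presentation of
   X: M^0 is a projective cover of X and M^-1 one of the kernel of M^0 -> X. *)
Definition minimal_projective_presentation (M : complex A) (X : lmodType A) :
    Prop :=
  [/\ (forall i : int, i != -1 -> i != 0 -> is_zero (M i)),
      (forall i, finitely_generated (M i)) &
      exists p : {linear M 0 -> X}, projective_cover p setT /\
        projective_cover (diff M (-1) 0) (kernel p)].

(* N, concentrated in degrees 0 and 1, is a minimal injective presentation of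
   Y: N^0 is an injective envelope of Y and N^1 one of the cokernel of
   Y -> N^0. *)
Definition minimal_injective_presentation (N : complex A) (Y : lmodType A) :
    Prop :=
  [/\ (forall i : int, i != 0 -> i != 1 -> is_zero (N i)),
      (forall i, finitely_generated (N i)) &
      exists q : {linear Y -> N 0}, injective_envelope q [set 0] /\
        injective_envelope (diff N 0 1) (range q)].

End Complexes.

(* The complex Hom_S(B, N), for B a bimodule placed in degree 0. *)
Section HomComplex.
Variables (S A : pzRingType) (B : bimodule S A) (N : complex S).

Definition hom_post (U V : lmodType S) (d : {linear U -> V})
    (g : hom_mod B U) : hom_mod B V := mklinear (comp_linear d g).

Fact hom_post_linear (U V : lmodType S) (d : {linear U -> V}) :
  linear (hom_post d).
Proof. by move=> a f g; apply: linear_ext => b /=; rewrite linearD. Qed.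

Definition hom_complex : complex A.
Proof.
exists (fun i => hom_mod B (N i) : lmodType A)
  (fun i j => mklinear (hom_post_linear (diff N i j))).
- by move=> i j nij g; apply: linear_ext => b /=; rewrite diff_shape.
- by move=> i j k g; apply: linear_ext => b /=; rewrite diff_diff.
Defined.

End HomComplex.

(* Main.v *)
Require Import Defs.
From HB Require Import structures.
From mathcomp Require Import all_boot all_order all_algebra.
From mathcomp Require Import boolp classical_sets.
From mathcomp Require Import zify.

(** Write P^-1 -> P^0 for a complex of finitely generated projectives.  Then
    Hom(P, Z) = 0 says that maps P^0 -> Z killing the boundaries vanish, and
    Hom(P, Z[1]) = 0 that all maps P^-1 -> Z factor through P^0.  Minimality of
    the presentations turns Ext-projectivity of X into a factorization through
    M^0 of every map M^-1 -> Z with Z in XX, and Ext-injectivity of Y into a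
    factorization through N^0 of every map Z -> N^1 with Z in YY.  A pairing
    Hom(Hom(DA, N), Z) x Hom(Z, N) -> I, nondegenerate because End(DA) = A by
    Matlis reflexivity over R, transfers the latter to maps out of the complex
    Hom(DA, N); this gives XX = Xc P and YY = Yc P.

    Now H^0(P) lies in XX, whence Hom(P, P[1]) = 0; stability under DA (x) -
    shows that maps from XX to the cycles in P^-1 vanish, whence
    Hom(P, P[-1]) = 0.  For E finitely generated projective, let C be the cocone
    of an approximation P^n -> E[1].  Then Hom(P, C[1]) = 0, so H^0(C) is in XX
    and is generated by H^0(P); hence an approximation P^m -> C is onto on H^0,
    and its kernel L satisfies Hom(C, L[1]) = 0.  So C is in add P, and E is
    obtained from C and P^n by a cone. *)

Set Implicit Arguments.
Unset Strict Implicit.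
Unset Printing Implicit Defensive.

Import Order.TTheory GRing.Theory Num.Theory.
Local Open Scope classical_set_scope.
Local Open Scope ring_scope.

(** * Submodules and quotient modules *)

(** The duality at work is that Hom(Z, N) is the I-dual of Hom(Hom(DA, N), Z) for N finitely
    generated injective. It is carried by explicit sums over coordinates of N in DA^n, because only
    exactness statements are extracted from it. Its ring-theoretic input starts from the descending
    chain condition on R: the part of I killed by a maximal ideal is simple and I is a cogenerator,
    which forces R to have finite length; Matlis reflexivity then follows by induction on length.

    Stability under DA (x) - controls the cycles of P^-1 in two ways. On the summand Hom(DA, N), a
    map from Z into the cycles is by adjunction a map DA (x) Z -> Y. On the summand M^-1, it is dual
    to the maps M^-1 -> DA (x) Z modulo those that factor through M^0. Both vanish once DA (x) Z is
    in XX.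

    The obstacle in the generation step is that an approximation of C is onto only on H^0, not in
    each degree. A contractible summand repairs this, so that kernel and splitting can be handled as
    honest complexes of projectives rather than through triangles. *)

Record submod_of (S : pzRingType) (V : lmodType S) (K : set V)
    (hK : submodule K) := Submod { submod_val : V; submod_valP : K submod_val }.

Section SubmodOf.
Variables (S : pzRingType) (V : lmodType S) (K : set V) (hK : submodule K).
Local Notation U := (submod_of hK).

HB.instance Definition _ := gen_eqMixin U.
HB.instance Definition _ := gen_choiceMixin U.

Fact submod_val_inj : injective (@submod_val S V K hK).
Proof.
move=> [x Kx] [y Ky] /= xy; rewrite {}xy in Kx *.
by rewrite (Prop_irrelevance Kx Ky).
Qed.

Fact submod0_subproof : K 0. Proof. by have [] := hK. Qed.
Fact submodD_subproof (x y : U) : K (submod_val x + submod_val y).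
Proof. by have [_ h _] := hK; apply: h; apply: submod_valP. Qed.
Fact submodZ_subproof a (x : U) : K (a *: submod_val x).
Proof. by have [_ _ h] := hK; apply: h; apply: submod_valP. Qed.
Fact submodN_subproof (x : U) : K (- submod_val x).
Proof. by rewrite -scaleN1r; apply: submodZ_subproof. Qed.

Definition submod0 : U := Submod hK submod0_subproof.
Definition submodD x y : U := Submod hK (submodD_subproof x y).
Definition submodN x : U := Submod hK (submodN_subproof x).
Definition submodZ a x : U := Submod hK (submodZ_subproof a x).

Fact submodDA : associative submodD.
Proof. by move=> x y z; apply: submod_val_inj => /=; rewrite addrA. Qed.
Fact submodDC : commutative submodD.
Proof. by move=> x y; apply: submod_val_inj => /=; rewrite addrC. Qed.
Fact submod0D : left_id submod0 submodD.
Proof. by move=> x; apply: submod_val_inj => /=; rewrite add0r. Qed.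
Fact submodND : left_inverse submod0 submodN submodD.
Proof. by move=> x; apply: submod_val_inj => /=; rewrite addNr. Qed.

HB.instance Definition _ :=
  GRing.isZmodule.Build U submodDA submodDC submod0D submodND.

Fact submodZA a b x : submodZ a (submodZ b x) = submodZ (a * b) x.
Proof. by apply: submod_val_inj => /=; rewrite scalerA. Qed.
Fact submod1Z : left_id 1 submodZ.
Proof. by move=> x; apply: submod_val_inj => /=; rewrite scale1r. Qed.
Fact submodZDr : right_distributive submodZ +%R.
Proof. by move=> a x y; apply: submod_val_inj => /=; rewrite scalerDr. Qed.
Fact submodZDl x : {morph submodZ^~ x : a b / a + b}.
Proof. by move=> a b; apply: submod_val_inj => /=; rewrite scalerDl. Qed.

HB.instance Definition _ :=
  GRing.Zmodule_isLmodule.Build S U submodZA submod1Z submodZDr submodZDl.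

Fact submod_val_linear : linear (@submod_val S V K hK).
Proof. by []. Qed.

End SubmodOf.

Lemma submodule_type (S : pzRingType) (V : lmodType S) (K : set V) :
  submodule K ->
  exists (U : lmodType S) (i : {linear U -> V}), injective i /\ range i = K.
Proof.
move=> hK; exists (submod_of hK : lmodType S),
  (mklinear (@submod_val_linear _ _ _ hK)).
split; first exact: submod_val_inj.
apply/seteqP; split=> [_ [x _ <-]|x Kx]; first exact: submod_valP.
by exists (Submod hK Kx).
Qed.

(* The coset x + K is represented by the element chosen from it, which does not
   depend on x. *)
Definition coset_repr (S : pzRingType) (V : lmodType S) (K : set V) (x : V) :=
  xget (0 : V) [set y | K (y - x)].

Record quot_mod (S : pzRingType) (V : lmodType S) (K : set V)
    (hK : submodule K) :=
  QuotMod { quot_val : V; quot_valP : coset_repr K quot_val = quot_val }.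

Section QuotMod.
Variables (S : pzRingType) (V : lmodType S) (K : set V) (hK : submodule K).
Local Notation Q := (quot_mod hK).
Local Notation c := (coset_repr K).

HB.instance Definition _ := gen_eqMixin Q.
HB.instance Definition _ := gen_choiceMixin Q.

Let K0 : K 0. Proof. by case: hK. Qed.
Let KD x y : K x -> K y -> K (x + y). Proof. by case: hK => _ h _; apply: h. Qed.
Let KZ a x : K x -> K (a *: x). Proof. by case: hK => _ _; apply. Qed.
Let KN x : K x -> K (- x). Proof. by rewrite -scaleN1r; apply: KZ. Qed.

Fact coset_reprP x : K (c x - x).
Proof.
by apply: (@xgetPex _ (0 : V) [set y | K (y - x)]); exists x; rewrite /= subrr.
Qed.

Fact coset_repr_eq x y : K (x - y) -> c x = c y.
Proof.
move=> Kxy; congr xget; apply/seteqP; split=> z /= Kz.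
  by have := KD Kz Kxy; rewrite addrA subrK.
by have := KD Kz (KN Kxy); rewrite opprB addrA subrK.
Qed.

Fact coset_repr_id x : c (c x) = c x.
Proof. exact/coset_repr_eq/coset_reprP. Qed.

Fact coset_reprDl x y : c (c x + y) = c (x + y).
Proof.
apply: coset_repr_eq; rewrite opprD addrACA subrr addr0; exact: coset_reprP.
Qed.

Fact coset_reprDr x y : c (x + c y) = c (x + y).
Proof. by rewrite addrC coset_reprDl addrC. Qed.

Fact coset_reprZ a x : c (a *: c x) = c (a *: x).
Proof. by apply: coset_repr_eq; rewrite -scalerBr; apply/KZ/coset_reprP. Qed.

Definition quot_pi x : Q := QuotMod hK (coset_repr_id x).

Fact quot_val_inj : injective (@quot_val S V K hK).
Proof.
move=> [x Kx] [y Ky] /= xy; rewrite {}xy in Kx *.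
by rewrite (Prop_irrelevance Kx Ky).
Qed.

Definition quotD (x y : Q) := quot_pi (quot_val x + quot_val y).
Definition quotN (x : Q) := quot_pi (- quot_val x).
Definition quotZ a (x : Q) := quot_pi (a *: quot_val x).

Fact quotDA : associative quotD.
Proof.
move=> x y z; apply: quot_val_inj => /=.
by rewrite coset_reprDl coset_reprDr addrA.
Qed.
Fact quotDC : commutative quotD.
Proof. by move=> x y; apply: quot_val_inj => /=; rewrite addrC. Qed.
Fact quot0D : left_id (quot_pi 0) quotD.
Proof.
by move=> x; apply: quot_val_inj; rewrite /= coset_reprDl add0r quot_valP.
Qed.
Fact quotND : left_inverse (quot_pi 0) quotN quotD.
Proof.
by move=> x; apply: quot_val_inj; rewrite /= coset_reprDl addNr.
Qed.

HB.instance Definition _ :=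
  GRing.isZmodule.Build Q quotDA quotDC quot0D quotND.

Fact quotZA a b x : quotZ a (quotZ b x) = quotZ (a * b) x.
Proof. by apply: quot_val_inj => /=; rewrite coset_reprZ scalerA. Qed.
Fact quot1Z : left_id 1 quotZ.
Proof. by move=> x; apply: quot_val_inj; rewrite /= scale1r quot_valP. Qed.
Fact quotZDr : right_distributive quotZ +%R.
Proof.
move=> a x y; apply: quot_val_inj => /=.
by rewrite coset_reprZ coset_reprDl coset_reprDr scalerDr.
Qed.
Fact quotZDl x : {morph quotZ^~ x : a b / a + b}.
Proof.
move=> a b; apply: quot_val_inj => /=.
by rewrite coset_reprDl coset_reprDr scalerDl.
Qed.

HB.instance Definition _ :=
  GRing.Zmodule_isLmodule.Build S Q quotZA quot1Z quotZDr quotZDl.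

Fact quot_pi_linear : linear quot_pi.
Proof.
move=> a x y; apply: quot_val_inj => /=.
by rewrite coset_reprDr coset_reprDl -coset_reprDl coset_reprZ coset_reprDl.
Qed.

Fact quot_pi_eq0 x : quot_pi x = 0 <-> K x.
Proof.
split=> [/(congr1 (@quot_val _ _ _ _)) /= xE|Kx].
  have := KD (coset_reprP 0) (KN (coset_reprP x)); rewrite xE subr0 opprB.
  by rewrite addrC subrK.
by apply: quot_val_inj => /=; apply: coset_repr_eq; rewrite subr0.
Qed.

End QuotMod.

Lemma quotient_type (S : pzRingType) (V : lmodType S) (K : set V) :
  submodule K ->
  exists (Q : lmodType S) (p : {linear V -> Q}), surj p /\ kernel p = K.
Proof.
move=> hK; exists (quot_mod hK : lmodType S), (mklinear (@quot_pi_linear _ _ _ hK)).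
split=> [y|].
  by exists (quot_val y); apply: quot_val_inj; rewrite /= quot_valP.
by apply/seteqP; split=> x /= h; apply/(quot_pi_eq0 hK).
Qed.

(** * Factorization of linear maps *)

Section Factor.
Variable S : pzRingType.
Implicit Types U V W P Q : lmodType S.

Lemma fst_linear U V : linear (fun x : (U * V)%type => x.1). Proof. by []. Qed.
Lemma snd_linear U V : linear (fun x : (U * V)%type => x.2). Proof. by []. Qed.
Lemma inl_linear U V : linear (fun x : U => (x, 0) : (U * V)%type).
Proof. by move=> a x y; congr pair; rewrite /= scaler0 addr0. Qed.
Lemma inr_linear U V : linear (fun x : V => (0, x) : (U * V)%type).
Proof. by move=> a x y; congr pair; rewrite /= scaler0 addr0. Qed.
Lemma pair_linear U V W (f : {linear U -> V})
    (g : {linear U -> W}) :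
  linear (fun x => (f x, g x) : (V * W)%type).
Proof. by move=> a x y; rewrite !linearP. Qed.
Lemma add_linear U V (f g : {linear U -> V}) : linear (fun x => f x + g x).
Proof. by move=> a x y; rewrite !linearP scalerDr addrACA. Qed.
Lemma opp_linear U V (f : {linear U -> V}) : linear (fun x => - f x).
Proof. by move=> a x y; rewrite linearP opprD scalerN. Qed.
Lemma sub_linear U V (f g : {linear U -> V}) : linear (fun x => f x - g x).
Proof. exact: (add_linear f (mklinear (opp_linear g))). Qed.
Lemma copair_linear U V W (f : {linear U -> W}) (g : {linear V -> W}) :
  linear (fun x : (U * V)%type => f x.1 + g x.2).
Proof. by move=> a x y; rewrite !linearP scalerDr addrACA. Qed.

Lemma pair_split U V W (f : {linear (U * V)%type -> W}) x y :
  f (x, y) = f (x, 0) + f (0, y).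
Proof. by rewrite -linearD; congr (f _); congr pair; rewrite ?addr0 ?add0r. Qed.

Lemma submodule_kernel U V (f : {linear U -> V}) : submodule (kernel f).
Proof.
rewrite /kernel; split=> [|x y /= fx fy|a x /= fx] /=; first by rewrite linear0.
- by rewrite linearD fx fy addr0.
- by rewrite linearZ /= fx scaler0.
Qed.

Lemma submodule_image U V (f : {linear U -> V}) (K : set U) :
  submodule K -> submodule (f @` K).
Proof.
case=> K0 KD KZ; split=> [|_ _ [x Kx <-] [y Ky <-]|a _ [x Kx <-]].
- by exists 0 => //; rewrite linear0.
- by exists (x + y); [apply: KD|rewrite linearD].
- by exists (a *: x); [apply: KZ|rewrite linearZ].
Qed.

Lemma submodule_setT U : submodule [set: U]. Proof. by []. Qed.

Lemma submodule_set0 U : submodule [set (0 : U)].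
Proof.
by split=> [//|x y /= -> ->|a x /= ->]; rewrite ?addr0 ?scaler0.
Qed.

Lemma submodule_range U V (f : {linear U -> V}) : submodule (range f).
Proof. exact/submodule_image/submodule_setT. Qed.

Lemma submodule_preimage U V (f : {linear U -> V}) (K : set V) :
  submodule K -> submodule (f @^-1` K).
Proof.
case=> K0 KD KZ; split=> [|x y Kx Ky|a x Kx] /=; first by rewrite linear0.
- by rewrite linearD; apply: KD.
- by rewrite linearZ; apply: KZ.
Qed.

Lemma submoduleI U (K L : set U) :
  submodule K -> submodule L -> submodule (K `&` L).
Proof.
case=> K0 KD KZ [L0 LD LZ]; split=> [//|x y [Kx Lx] [Ky Ly]|a x [Kx Lx]].
- by split; [apply: KD|apply: LD].
- by split; [apply: KZ|apply: LZ].
Qed.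

Lemma submoduleN U (K : set U) x : submodule K -> K x -> K (- x).
Proof. by case=> _ _ KZ Kx; rewrite -scaleN1r; apply: KZ. Qed.

Lemma submoduleB U (K : set U) x y : submodule K -> K x -> K y -> K (x - y).
Proof.
by move=> hK Kx Ky; have [_ KD _] := hK; apply: KD => //; apply: submoduleN.
Qed.

Lemma kernelB U V (f : {linear U -> V}) x y : f x = f y <-> kernel f (x - y).
Proof.
rewrite /kernel /= linearB; split=> [->|/eqP]; first exact: subrr.
by rewrite subr_eq0 => /eqP.
Qed.

Lemma kernel0_inj U V (f : {linear U -> V}) :
  (forall x, f x = 0 -> x = 0) -> injective f.
Proof.
move=> h x y fxy; apply/eqP; rewrite -subr_eq0; apply/eqP/h.
by rewrite linearB fxy subrr.
Qed.

Lemma factor_surj U V W (p : {linear U -> V}) (g : {linear U -> W}) :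
  surj p -> kernel p `<=` kernel g ->
  exists h : {linear V -> W}, forall x, h (p x) = g x.
Proof.
move=> /choice[s ps] kpg.
have sE x : g (s (p x)) = g x by apply/kernelB/kpg/kernelB.
have hl : linear (g \o s).
  move=> a x y; rewrite /= -linearP; apply/kernelB/kpg/kernelB.
  by rewrite linearP !ps.
by exists (mklinear hl).
Qed.

Lemma factor_inj U V W (i : {linear U -> V}) (g : {linear W -> V}) :
  injective i -> range g `<=` range i ->
  exists h : {linear W -> U}, forall x, i (h x) = g x.
Proof.
move=> ii gi.
have /choice[s sE] (x : W) : exists u, i u = g x.
  by have [|u _ <-] := gi (g x); [exists x|exists u].
have sl : linear s by move=> a x y; apply: ii; rewrite linearP !sE linearP.
by exists (mklinear sl).
Qed.

Lemma projective_lift P U V (f : {linear P -> V}) (g : {linear U -> V}) :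
  projective P -> range f `<=` range g ->
  exists h : {linear P -> U}, forall x, g (h x) = f x.
Proof.
move=> hP fg; have [W [i [ii iE]]] := submodule_type (submodule_range g).
have [|g' g'E] := factor_inj (g := g) ii; first by rewrite iE.
have [|f' f'E] := factor_inj (g := f) ii; first by rewrite iE.
have [|h hE] := hP _ _ g' f'.
  move=> y; have [u _ uE] : range g (i y) by rewrite -iE; exists y.
  by exists u; apply: ii; rewrite g'E.
by exists h => x; rewrite -g'E hE f'E.
Qed.

Lemma injective_extend Q U V (i : {linear U -> V}) (f : {linear U -> Q}) :
  injective_module Q -> kernel i `<=` kernel f ->
  exists g : {linear V -> Q}, forall x, g (i x) = f x.
Proof.
move=> hQ kif; have [W [p [sp pE]]] := quotient_type (submodule_kernel i).
have [|i' i'E] := factor_surj (g := i) sp; first by rewrite pE.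
have [|f' f'E] := factor_surj (g := f) sp; first by rewrite pE.
have [|g gE] := hQ _ _ i' f'.
  apply: kernel0_inj => y; have [x <-] := sp y; rewrite i'E => ix.
  by have : kernel p x by rewrite pE.
by exists g => x; rewrite -i'E gE f'E.
Qed.

Lemma fg_surj U V (p : {linear U -> V}) :
  surj p -> finitely_generated U -> finitely_generated V.
Proof.
move=> sp [n [g gE]]; exists n, (p \o g) => y; have [x <-] := sp y.
have [c ->] := gE x; exists c; rewrite linear_sum.
by apply: eq_bigr => i _; rewrite linearZ.
Qed.

Lemma fg_extension U V W (i : {linear U -> V}) (p : {linear V -> W}) :
  short_exact i p -> finitely_generated U -> finitely_generated W ->
  finitely_generated V.
Proof.
move=> [_ ip sp] [m [g gE]] [n [h hE]].
have /choice[h' h'E] (j : 'I_n) := sp (h j).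
exists (m + n)%N, (fun k => match split k with inl a => i (g a) | inr b => h' b
  end).
move=> x; have [c cE] := hE (p x).
have : kernel p (x - \sum_(j < n) c j *: h' j).
  rewrite /kernel /= linearB cE linear_sum; apply/eqP; rewrite subr_eq0.
  by apply/eqP/eq_bigr => j _; rewrite linearZ /= h'E.
rewrite -ip => -[u _ uE]; have [b bE] := gE u.
exists (fun k => match split k with inl a => b a | inr a => c a end).
rewrite big_split_ord /=.
rewrite (eq_bigr (fun j => b j *: i (g j))); last first.
  by move=> j _; rewrite (unsplitK (inl j)).
rewrite [X in _ + X](eq_bigr (fun j => c j *: h' j)); last first.
  by move=> j _; rewrite (unsplitK (inr j)).
apply/eqP; rewrite -subr_eq -uE bE linear_sum.
by apply/eqP/eq_bigr => j _; rewrite linearZ.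
Qed.

Lemma fg_pair U V : finitely_generated U -> finitely_generated V ->
  finitely_generated (U * V)%type.
Proof.
apply: (@fg_extension _ _ _ (mklinear (@inl_linear U V))
  (mklinear (@snd_linear U V))).
split.
- by move=> x y [].
- apply/seteqP; split=> [_ [x _ <-] //|[x y] /= yE].
  by exists x => //=; congr pair; rewrite -yE.
- by move=> y; exists (0, y).
Qed.

Lemma fg_zero U : is_zero U -> finitely_generated U.
Proof. by move=> U0; exists 0%N, (fun=> 0) => x; exists (fun=> 0);
  rewrite big_ord0. Qed.

Lemma projective_pair U V :
  projective U -> projective V -> projective (U * V)%type.
Proof.
move=> prU prV W W' p f sp.
have [g gE] := prU _ _ p (mklinear (comp_linear f (mklinear (@inl_linear U V)))) sp.
have [h hE] := prV _ _ p (mklinear (comp_linear f (mklinear (@inr_linear U V)))) sp.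
exists (mklinear (copair_linear g h)) => -[x y] /=.
by rewrite linearD gE hE [RHS]pair_split.
Qed.

Lemma projective_zero U : is_zero U -> projective U.
Proof.
move=> U0 V W p f sp; exists (mklinear (@zero_linear _ U V)) => x /=.
by rewrite (U0 x) !linear0.
Qed.

End Factor.

Local Notation lid U := (mklinear (@id_linear _ U)).
Local Notation lzero U V := (mklinear (@zero_linear _ U V)).
Local Notation lcomp g f := (mklinear (comp_linear g f)).
Local Notation lfst U V := (mklinear (@fst_linear _ U V)).
Local Notation lsnd U V := (mklinear (@snd_linear _ U V)).
Local Notation linl U V := (mklinear (@inl_linear _ U V)).
Local Notation linr U V := (mklinear (@inr_linear _ U V)).
Local Notation lpair f g := (mklinear (pair_linear f g)).
Local Notation lcopair f g := (mklinear (copair_linear f g)).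
Local Notation ladd f g := (mklinear (add_linear f g)).
Local Notation lsub f g := (mklinear (sub_linear f g)).
Local Notation lopp f := (mklinear (opp_linear f)).

(** * Commutative artinian rings *)

(** Without a minimal member, iterating a choice of strictly smaller members would give a descending
    chain that never becomes stationary. *)
Lemma minimal_submodule (S : pzRingType) (V : lmodType S) (P : set V -> Prop)
    (K0 : set V) :
  artinian V -> submodule K0 -> P K0 ->
  exists K, [/\ submodule K, P K &
    forall L, submodule L -> P L -> L `<=` K -> L = K].
Proof.
move=> hV sK0 PK0; apply: contrapT => noK.
pose T := {K : set V | submodule K /\ P K}.
have /choice[f fE] (K : T) : exists L : T, sval L `<=` sval K /\ sval L <> sval K.
  case: K => K [sK PK] /=; apply: contrapT => noL; apply: noK.
  exists K; split=> // L sL PL LK; apply: contrapT => nLK; apply: noL.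
  by exists (exist _ L (conj sL PL)).
pose F n := sval (iter n f (exist _ K0 (conj sK0 PK0))).
have [||n nE] := hV F.
- by move=> n; rewrite /F; case: (iter _ _ _) => K [].
- by move=> n; have [] := fE (iter n f (exist _ K0 (conj sK0 PK0))).
have [_] := fE (iter n f (exist _ K0 (conj sK0 PK0))).
by apply; apply: (nE n.+1).
Qed.

Section Ideals.
Variable R : comPzRingType.
Implicit Types (m : set R^o).

Lemma maximal_ideal_inv m (c : R) : maximal_ideal m -> ~ m c ->
  exists s : R, m (1 - s * c).
Proof.
case=> sm m1 mmax mc; apply: contrapT => no.
pose J : set R^o := [set x | exists s : R, m (x - s * c)].
have [m0 mD mZ] := sm.
have JE : J = m.
  apply: mmax => [|x mx|[s ms]]; last by apply: no; exists s.
    split=> [|x y [s ms] [t mt]|a x [s ms]].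
    - by exists 0; rewrite mul0r subr0.
    - by exists (s + t); rewrite mulrDl opprD addrACA; apply: mD.
    - by exists (a * s); rewrite -mulrA -[a *: x]/(a * x) -mulrBr; apply: mZ.
  by exists 0; rewrite mul0r subr0.
by apply: mc; rewrite -JE; exists 1; rewrite mul1r subrr.
Qed.

Lemma maximal_ideal_prime m (a b : R) :
  maximal_ideal m -> m (a * b) -> ~ m a -> m b.
Proof.
move=> mm mab /(maximal_ideal_inv mm)[s ms]; have [[_ mD mZ] _ _] := mm.
have -> : b = b * (1 - s * a) + s * (a * b).
  by rewrite mulrBr mulr1 mulrA [b * _]mulrC subrK.
by apply: mD; apply: mZ.
Qed.

End Ideals.

(** * The injective envelope of R/rad R as an injective cogenerator *)

Section Artin.
Variables (R : comPzRingType) (I : lmodType R) (e : {linear R^o -> I}).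
Hypothesis hR : artinian R^o.
Hypothesis hI : injective_envelope e (@jacobson_radical R).
Implicit Types (m : set R^o) (U V W : lmodType R).

(** This replaces the Chinese remainder theorem. Let J be minimal among the ideals not contained in
    m. Since m is prime, J meets every other maximal ideal m' in an ideal that is still not
    contained in m, so J lies in m' by minimality; any element of J outside m will do. *)
Lemma maximal_ideal_separate m : maximal_ideal m ->
  exists c : R, ~ m c /\ forall m', maximal_ideal m' -> m' <> m -> m' c.
Proof.
move=> mm; have [sm m1 mmax] := mm.
have [J [sJ Jm Jmin]] := @minimal_submodule _ R^o (fun J => ~ J `<=` m) setT
  hR (@submodule_setT _ _) (fun h => m1 (h 1 Logic.I)).
have /existsNP[c /not_implyP[Jc mc]] := Jm.
exists c; split=> // m' mm' m'm; have [sm' m'1 m'max] := mm'.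
suff JE : J `&` m' = J by move: Jc; rewrite -JE => -[].
apply: Jmin; [exact: submoduleI|move=> Jm'm|exact: subIsetl].
apply: m'm; apply/esym/m'max => // a m'a; apply: contrapT => ma.
apply: mc; apply: (maximal_ideal_prime mm (a := a)) => //; apply: Jm'm.
have [_ _ JZ] := sJ; have [_ _ m'Z] := sm'.
by split; [apply: JZ|rewrite mulrC; apply: m'Z].
Qed.

Definition torsion_elt m (y : I) := forall r : R, m r -> r *: y = 0.

Lemma envelope_eq0 (x : R) : e x = 0 <-> jacobson_radical x.
Proof. by have [_ <- _] := hI. Qed.

Lemma envelopeM (a x : R) : e (a * x) = a *: e x.
Proof. by rewrite -[a * x]/(a *: (x : R^o)) linearZ. Qed.

(** Multiplication by the separating element c embeds R/m into R/rad R, hence into I. Conversely, if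
    m kills y <> 0, then R y is simple and meets the range of e by essentiality, so y = e(z) for
    some z. As c is invertible modulo m, y is also e of a multiple of c. *)
Lemma envelope_socle m : maximal_ideal m ->
  exists c : R, [/\ forall r : R, m r <-> e (r * c) = 0 &
    forall y, torsion_elt m y -> exists t : R, y = t *: e c].
Proof.
move=> mm; have [sm m1 mmax] := mm; have [m0 mD mZ] := sm.
have [c [mc m'c]] := maximal_ideal_separate mm.
exists c; split=> [r|y ty].
  rewrite envelope_eq0; split=> [mr m' mm'|/(_ m mm) mrc].
    have [->|/eqP m'm] := pselect (m' = m).
      by rewrite mulrC; apply: mZ.
    have [[_ _ m'Z] _ _] := mm'; apply: m'Z; apply: m'c => //; exact/eqP.
  by apply: (maximal_ideal_prime mm (a := c)) => //; rewrite mulrC.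
have [-> | y0] := pselect (y = 0); first by exists 0; rewrite scale0r.
have [_ _ ess] := hI.
have [x [[t _ tx] [s sx] x0]] : exists x, [/\ range e x,
    exists s : R, x = s *: y & x <> 0].
  apply: contrapT => no; apply: y0.
  apply: (ess [set x | exists s : R, x = s *: y]); last by exists 1;
    rewrite scale1r.
    split=> [|_ _ [a ->] [b ->]|a _ [b ->]].
    - by exists 0; rewrite scale0r.
    - by exists (a + b); rewrite scalerDl.
    - by exists (a * b); rewrite scalerA.
  by move=> x rx sx; apply: contrapT => x0; apply: no; exists x.
have ms : ~ m s by move=> /ty sy; apply: x0; rewrite sx.
have [u /ty] := maximal_ideal_inv mm ms.
rewrite scalerBl scale1r => /subr0_eq; rewrite -scalerA -sx -tx -envelopeM => yE.
have [s' ms'] := maximal_ideal_inv mm mc.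
have : e ((1 - s' * c) * (u * t)) = 0 by rewrite envelopeM -yE ty.
rewrite mulrBl mul1r linearB /= -yE => /subr0_eq ->.
by exists (s' * (u * t)); rewrite -envelopeM mulrAC.
Qed.

Lemma torsion_elt_simple m y y' : maximal_ideal m ->
  torsion_elt m y -> torsion_elt m y' -> y <> 0 -> exists s : R, y' = s *: y.
Proof.
move=> mm ty ty' y0; have [c [mE socE]] := envelope_socle mm.
have [t yE] := socE _ ty; have [t' ->] := socE _ ty'.
have [u mu] : exists u : R, m (1 - u * t).
  by apply: maximal_ideal_inv => // /mE; rewrite envelopeM -yE.
exists (t' * u); rewrite yE !scalerA -mulrA -!envelopeM.
have /mE : m (t' * (1 - u * t)) by have [[_ _ mZ] _ _] := mm; apply: mZ.
by rewrite mulrBr mulr1 mulrBl linearB /= => /subr0_eq.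
Qed.

(** By minimality K is simple modulo the ideal P and is generated there by x: if r x is outside P,
    then x = s r x for some s, so that 1 - s r annihilates x modulo P. *)
Lemma maximal_ideal_ann_of_minimal (P : R -> Prop) (K : set R^o) (x : R) :
  submodule [set r : R^o | P r] ->
  submodule K -> K x -> ~ P x ->
  (forall L, submodule L -> ~ L `<=` [set r : R^o | P r] -> L `<=` K -> L = K) ->
  maximal_ideal [set r : R^o | P (r * x)].
Proof.
move=> [P0 PD PZ] sK Kx Px Kmin; have [_ _ KZ] := sK; split.
- split=> [|a b /= Pa Pb|a b /= Pb]; first by rewrite /= mul0r.
  + by rewrite mulrDl; apply: PD.
  + by rewrite -mulrA; apply: PZ.
- by rewrite /= mul1r.
move=> J sJ mJ J1; apply/seteqP; split=> // r Jr /=; apply: contrapT => Prx.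
have [J0 JD JZ] := sJ.
pose L : set R^o := [set y | exists s : R, y = s * (r * x)].
have LE : L = K.
  apply: Kmin.
  - split=> [|_ _ [a ->] [b ->]|a _ [b ->]].
    + by exists 0; rewrite mul0r.
    + by exists (a + b); rewrite mulrDl.
    + by exists (a * b); rewrite -[RHS]mulrA.
  - by move=> LP; apply/Prx/LP; exists 1; rewrite mul1r.
  - by move=> _ [s ->]; rewrite mulrA; apply: KZ.
have [s sE] : L x by rewrite LE.
apply: J1; have -> : (1 : R) = (1 - s * r) + s * r by rewrite subrK.
apply: JD; last by apply: JZ.
by apply: mJ; rewrite /= mulrBl mul1r -mulrA -sE subrr.
Qed.

(** The cyclic submodule of H/B generated by f contains a simple one, generated by some x f with a
    maximal annihilator m. The copy of R/m in I given by [envelope_socle] receives it, and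
    injectivity of I extends the map to H/B. *)
Lemma envelope_cogenerates (H : lmodType R) (B : set H) (f : H) :
  submodule B -> ~ B f ->
  exists l : {linear H -> I}, (forall b, B b -> l b = 0) /\ l f <> 0.
Proof.
move=> sB Bf; have [B0 BD BZ] := sB.
have rl : linear (fun r : R^o => r *: f : H) by move=> a x y;
  rewrite scalerDl scalerA.
have sP : submodule [set r : R^o | B (r *: f)].
  exact: (submodule_preimage (mklinear rl) sB).
have [K [sK KB Kmin]] := @minimal_submodule _ R^o
  (fun J => ~ J `<=` [set r : R^o | B (r *: f)]) setT hR (@submodule_setT _ _)
  (fun h => Bf (eq_ind _ B (h 1 Logic.I) _ (scale1r f))).
have /existsNP[x /not_implyP[Kx /= Bxf]] := KB.
have mm := maximal_ideal_ann_of_minimal sP sK Kx Bxf Kmin.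
have [c [mE _]] := envelope_socle mm.
have il : linear (fun r : R^o => e (r * c)).
  by move=> a u v; rewrite mulrDl linearD /= -[a *: u]/(a * u) -mulrA envelopeM.
have [Q [p [sp pE]]] := quotient_type sB.
have pl : linear (fun r : R^o => p ((r * x) *: f)).
  by move=> a u v; rewrite mulrDl scalerDl -[a *: u]/(a * u) -mulrA -scalerA
    linearP.
have [hIinj _ _] := hI.
have [|l lE] := injective_extend (i := mklinear pl) (f := mklinear il) hIinj.
  move=> r /= pr; apply/mE => /=.
  by have : kernel p ((r * x) *: f) by []; rewrite pE.
exists (lcomp l p); split=> [b Bb|] /=.
  have : kernel p b by rewrite pE.
  by rewrite /kernel /= => ->; rewrite linear0.
move=> lf0; have := lE 1; rewrite /= !mul1r !linearZ /= lf0 scaler0.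
move=> /esym/eqP; apply/negP/eqP => ec0.
have [_ m1 _] := mm; apply: m1; apply/mE; rewrite mul1r; exact: ec0.
Qed.

Lemma envelope_separates V (x : V) : x <> 0 ->
  exists l : {linear V -> I}, l x <> 0.
Proof.
move=> x0; have [l [_ lx]] := envelope_cogenerates (@submodule_set0 _ V) x0.
by exists l.
Qed.

(** * Modules of finite length *)

Definition simple_module V := (exists x : V, x <> 0) /\
  forall x y : V, x <> 0 -> exists r : R, y = r *: x.

(** Stated as its own induction principle: V lies in every class that contains the zero and simple
    modules and is closed under extensions. *)
Definition finite_length V := forall C : lmodType R -> Prop,
  (forall Z, is_zero Z -> C Z) -> (forall Z, simple_module Z -> C Z) ->
  (forall (Z1 Z2 Z3 : lmodType R) (i : {linear Z1 -> Z2}) (p : {linear Z2 -> Z3}),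
    short_exact i p -> C Z1 -> C Z3 -> C Z2) -> C V.

Lemma finite_length_zero V : is_zero V -> finite_length V.
Proof. by move=> V0 C C0 _ _; apply: C0. Qed.

Lemma finite_length_simple V : simple_module V -> finite_length V.
Proof. by move=> sV C _ Cs _; apply: Cs. Qed.

Lemma finite_length_extension U V W (i : {linear U -> V}) (p : {linear V -> W}) :
  short_exact i p -> finite_length U -> finite_length W -> finite_length V.
Proof.
move=> ip fU fW C C0 Cs Ce; apply: (Ce _ _ _ _ _ ip); first exact: fU.
exact: fW.
Qed.

Lemma finite_length_iso V W (p : {linear V -> W}) :
  injective p -> surj p -> finite_length W -> finite_length V.
Proof.
move=> ip sp; pose Z : lmodType R := 'rV[R]_0.
apply: (@finite_length_extension Z _ _ (lzero Z V) p).
  split=> //; first by move=> x y _; rewrite [x]thinmx0 [y]thinmx0.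
  apply/seteqP; split=> [_ [x _ <-]|x] /=; first by rewrite /kernel /= linear0.
  by rewrite /kernel /= -(linear0 p) => /ip ->; exists 0.
by apply: finite_length_zero => x; rewrite [x]thinmx0.
Qed.

Lemma simple_surj V W (p : {linear V -> W}) : surj p -> simple_module V ->
  is_zero W \/ simple_module W.
Proof.
move=> sp [_ gen]; have [W0|] := pselect (is_zero W); first by left.
move=> /existsNP[y0 y0N]; right; split; first by exists y0.
move=> x y x0; have [x' xE] := sp x; have [y' <-] := sp y.
have [|r ->] := gen x' y'; first by move=> x'0; apply: x0; rewrite -xE x'0 linear0.
by exists r; rewrite linearZ /= xE.
Qed.

Lemma finite_length_surj V W (p : {linear V -> W}) :
  surj p -> finite_length V -> finite_length W.
Proof.
move=> + fV; move: W p.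
apply: (fV (fun V => forall W (p : {linear V -> W}), surj p -> finite_length W)).
- move=> Z Z0 W p sp; apply: finite_length_zero => y.
  by have [x <-] := sp y; rewrite (Z0 x) linear0.
- move=> Z sZ W p /simple_surj/(_ sZ)[]; first exact: finite_length_zero.
  exact: finite_length_simple.
move=> Z1 Z2 Z3 i q [_ iq sq] C1 C3 W p sp.
pose pi := lcomp p i.
have [A [j [ij jE]]] := submodule_type (submodule_range pi).
have [B [r [sr rE]]] := quotient_type (submodule_range pi).
apply: (@finite_length_extension A W B j r); first by rewrite -jE in rE.
  have [|h hE] := factor_inj (g := pi) ij; first by rewrite jE.
  apply: (C1 _ h) => a; have : range pi (j a) by rewrite -jE; exists a.
  by case=> z _ zE; exists z; apply: ij; rewrite hE.
have [|h hE] := factor_surj (g := lcomp r p) sq.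
  move=> x; rewrite -iq => -[z _ <-] /=.
  by have : kernel r (p (i z)) by rewrite rE; exists z.
apply: (C3 _ h) => b; have [w <-] := sr b; have [x <-] := sp w.
by exists (q x); rewrite hE.
Qed.

(* A minimal ideal K with R/K of finite length is zero: otherwise some x in R
   has xK <> 0 and annihilator of xK a maximal ideal, so that K has a quotient
   embedded in the socle of I, which is simple. *)
Lemma finite_length_ring : finite_length R^o.
Proof.
pose FL (K : set R^o) := exists (Q : lmodType R) (p : {linear R^o -> Q}),
  [/\ surj p, kernel p = K & finite_length Q].
have FLT : FL setT.
  have [Q [p [sp pE]]] := quotient_type (@submodule_setT _ R^o).
  exists Q, p; split=> //; apply: finite_length_zero => y; have [x <-] := sp y.
  by have : kernel p x by rewrite pE.
have [K [sK [Q [q [sq qE fQ]]] Kmin]] :=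
  minimal_submodule hR (@submodule_setT _ _) FLT.
have [K0|] := pselect (forall x, K x -> x = 0).
  apply: (finite_length_iso _ sq fQ); apply: kernel0_inj => x qx.
  by apply: K0; rewrite -qE.
move=> /existsNP[k /not_implyP[Kk k0]]; exfalso.
have [_ KD KZ] := sK.
pose P (r : R^o) := forall y, K y -> r * y = 0.
have sP : submodule [set r : R^o | P r].
  split=> [y _|a b Pa Pb y Ky|a b Pb y Ky]; first by rewrite mul0r.
  - by rewrite mulrDl Pa // Pb // addr0.
  - by rewrite -[a *: b]/(a * b) -mulrA Pb // mulr0.
have nP : ~ [set: R^o] `<=` [set r : R^o | P r].
  by move=> /(_ 1 Logic.I k Kk); rewrite mul1r.
have [L [sL LP Lmin]] := @minimal_submodule _ R^o
  (fun J => ~ J `<=` [set r : R^o | P r]) setT hR (@submodule_setT _ _) nP.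
have /existsNP[x /not_implyP[Lx Px]] := LP.
have mm := maximal_ideal_ann_of_minimal sP sL Lx Px Lmin.
set m := [set r : R^o | P (r * x)] in mm.
have /existsNP[k1 /not_implyP[Kk1 xk1]] := Px.
have xl : linear (fun y : R^o => x * y : R^o).
  by move=> a u v; rewrite mulrDr -[a *: u]/(a * u) mulrCA.
have [l [lB lk1]] := envelope_cogenerates
  (submodule_kernel (mklinear xl)) (f := k1) xk1.
have lT y : K y -> torsion_elt m (l y).
  move=> Ky r mr; rewrite -linearZ; apply: lB; rewrite /kernel /=.
  by rewrite -[r *: y]/(r * y) mulrCA mulrA mr.
pose L' := K `&` kernel l.
have sL' : submodule L' by exact: submoduleI (submodule_kernel l).
suff L'K : L' = K by apply: lk1; move: Kk1; rewrite -L'K => -[].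
apply: Kmin => //; last exact: subIsetl.
have [V [p [sp pE]]] := quotient_type sL'.
exists V, p; split=> //.
have [|h hE] := factor_surj (g := q) sp; first by rewrite pE qE; exact: subIsetl.
have sh : surj h by move=> y; have [z <-] := sq y; exists (p z).
have [U [j [ij jE]]] := submodule_type (submodule_kernel h).
apply: (@finite_length_extension U V Q j h) => //.
have repU u : exists2 y, K y & p y = j u.
  have [y yE] := sp (j u); exists y => //; rewrite -qE /kernel /= -hE yE.
  by have : kernel h (j u) by rewrite -jE; exists u.
apply: finite_length_simple; split.
  have : kernel h (p k1) by rewrite /kernel /= hE; move: Kk1; rewrite -qE.
  rewrite -jE => -[u _ uE]; exists u => u0.
  have : kernel p k1 by rewrite /kernel /= -uE u0 linear0.
  by rewrite pE => -[].
move=> u v u0; have [y Ky yE] := repU u; have [z Kz zE] := repU v.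
have ly0 : l y <> 0.
  move=> ly0; apply: u0; apply: ij; rewrite linear0 -yE.
  by have : kernel p y by rewrite pE.
have [s sE] := torsion_elt_simple mm (lT _ Ky) (lT _ Kz) ly0.
exists s; apply: ij; rewrite linearZ /= -zE -yE -linearZ; apply/kernelB.
rewrite pE; split; last by rewrite /kernel /= linearB linearZ /= sE subrr.
by apply: submoduleB => //; apply: KZ.
Qed.

Lemma finite_length_fg V : finitely_generated V -> finite_length V.
Proof.
case=> n [g]; elim: n V g => [|n IH] V g gE.
  by apply: finite_length_zero => x; have [c ->] := gE x; rewrite big_ord0.
have gl : linear (fun r : R^o => r *: g ord0 : V).
  by move=> a x y; rewrite scalerDl scalerA.
have [U [i [ii iE]]] := submodule_type (submodule_range (mklinear gl)).
have [W [p [sp pE]]] := quotient_type (submodule_range (mklinear gl)).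
apply: (@finite_length_extension U V W i p); first by rewrite -iE in pE.
  have [|h hE] := factor_inj (g := mklinear gl) ii; first by rewrite iE.
  apply: (finite_length_surj (p := h) _ finite_length_ring) => u.
  have : range (mklinear gl) (i u) by rewrite -iE; exists u.
  by case=> r _ rE; exists r; apply: ii; rewrite hE.
apply: (IH _ (fun j => p (g (lift ord0 j)))) => w; have [x <-] := sp w.
have [c ->] := gE x; exists (fun j => c (lift ord0 j)).
rewrite big_ord_recl linearD /= linear_sum.
have -> : p (c ord0 *: g ord0) = 0.
  by have : kernel p (c ord0 *: g ord0) by rewrite pE; exists (c ord0).
by rewrite add0r; apply: eq_bigr => j _; rewrite linearZ.
Qed.

Lemma finite_length_noetherian V : finite_length V ->
  forall U (i : {linear U -> V}), injective i -> finitely_generated U.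
Proof.
move=> /(_ (fun V => forall U (i : {linear U -> V}), injective i ->
  finitely_generated U)); apply.
- move=> Z Z0 U i ii; apply: fg_zero => x; apply: ii.
  by rewrite [LHS]Z0 [RHS]Z0.
- move=> Z [_ gen] U i ii; have [U0|] := pselect (is_zero U); first exact: fg_zero.
  move=> /existsNP[x x0]; exists 1%N, (fun=> x) => y.
  have [|r rE] := gen (i x) (i y).
    by move=> ix; apply: x0; apply: ii; rewrite linear0.
  by exists (fun=> r); rewrite big_ord1; apply: ii; rewrite linearZ.
move=> Z1 Z2 Z3 i p [ii ip sp] C1 C3 U j ij.
pose pj := lcomp p j.
have [A [a [ia aE]]] := submodule_type (submodule_kernel pj).
have [B [b [ib bE]]] := submodule_type (submodule_range pj).
have [|h hE] := factor_inj (g := pj) ib; first by rewrite bE.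
apply: (@fg_extension _ A U B a h).
- split=> //.
    rewrite aE; apply/seteqP; split=> u; rewrite /kernel /= => uE.
      by apply: ib; rewrite hE linear0.
    by rewrite -[p _]hE uE linear0.
  move=> y; have : range pj (b y) by rewrite -bE; exists y.
  by case=> u _ uE; exists u; apply: ib; rewrite hE.
- have [|k kE] := factor_inj (g := lcomp j a) ii.
    move=> _ [x _ <-]; rewrite ip /kernel /=.
    by have : kernel pj (a x) by rewrite -aE; exists x.
  apply: (C1 _ k) => x y xy; apply: ia; apply: ij.
  by have := kE x; rewrite xy kE.
- exact: (C3 _ b).
Qed.

Lemma finite_length_cogenerated V : finite_length V ->
  exists n (b : 'I_n -> {linear V -> I}), forall x, (forall k, b k x = 0) -> x = 0.
Proof.
move=> /(_ (fun V => exists n (b : 'I_n -> {linear V -> I}),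
  forall x, (forall k, b k x = 0) -> x = 0)); apply.
- by move=> Z Z0; exists 0%N, (fun=> lzero Z I) => x _; apply: Z0.
- move=> Z [[x x0] gen]; have [l lx] := envelope_separates x0.
  exists 1%N, (fun=> l) => y ly; apply: contrapT => y0.
  by have [r xE] := gen y x y0; apply: lx; rewrite xE linearZ /= (ly ord0) scaler0.
move=> Z1 Z2 Z3 i p [ii ip sp] [n1 [b1 b1E]] [n3 [b3 b3E]].
have [hIinj _ _] := hI.
have /choice[b1' b1'E] (k : 'I_n1) : exists g : {linear Z2 -> I},
    forall x, g (i x) = b1 k x.
  apply: injective_extend => // x; rewrite /kernel /= -(linear0 i) => /ii ->.
  exact: linear0.
exists (n1 + n3)%N, (fun k => match split k with inl a => b1' a
  | inr c => lcomp (b3 c) p end) => x bx.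
have : kernel p x.
  apply: b3E => k; have := bx (rshift n1 k).
  by rewrite (unsplitK (inr k)).
rewrite -ip => -[y _ yE]; rewrite -yE [y]b1E ?linear0 // => k.
by have := bx (lshift n3 k); rewrite (unsplitK (inl k)) -yE b1'E.
Qed.

(** The elements of the double dual of V. Linearity is expressed pointwise, so that no module
    structure on the dual is involved. *)
Definition functional V (L : {linear V -> I} -> I) :=
  (forall f g h : {linear V -> I}, (forall x, h x = f x + g x) ->
    L h = L f + L g) /\
  (forall (a : R) (f h : {linear V -> I}), (forall x, h x = a *: f x) ->
    L h = a *: L f).

Lemma functional0 V (L : {linear V -> I} -> I) (f : {linear V -> I}) :
  functional L -> (forall x, f x = 0) -> L f = 0.
Proof.
by move=> [_ LZ] f0; rewrite (LZ 0 f f) ?scale0r // => x; rewrite f0 scaler0.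
Qed.

Lemma functional_eq V (L : {linear V -> I} -> I) (f g : {linear V -> I}) : f =1 g
  -> L f = L g.
Proof. by move=> fg; congr L; apply: linear_ext. Qed.

Lemma scale_linear V (r : R) (f : {linear V -> I}) : linear (fun x => r *: f x).
Proof. by move=> a x y; rewrite linearP scalerDr !scalerA mulrC. Qed.

Lemma functionalB V (L : {linear V -> I} -> I) (f g h : {linear V -> I}) :
  functional L -> (forall x, h x = f x - g x) -> L h = L f - L g.
Proof.
by move=> [LD _] hE; rewrite (LD h g f) ?addrK // => x; rewrite hE subrK.
Qed.

(** Surjectivity of the map from V to its double dual. For V simple, all values of functionals at x,
    and the value of L, lie in one simple submodule of I, so they are multiples of a single nonzero
    one. For an extension, L on functionals of the quotient is evaluation at some w. After
    subtracting the evaluation at a lift v of w, L depends only on restrictions to the submodule,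
    where induction applies. *)
Lemma finite_length_reflexive V (L : {linear V -> I} -> I) :
  finite_length V -> functional L -> exists v, forall b, L b = b v.
Proof.
have [hIinj _ _] := hI.
move=> fV; move: L; apply: (fV (fun V => forall L : {linear V -> I} -> I,
  functional L -> exists v, forall b, L b = b v)).
- move=> Z Z0 L fL; exists 0 => b; rewrite linear0; apply: functional0 => // x.
  by rewrite (Z0 x) linear0.
- move=> Z [[x x0] gen] L fL; have [l lx] := envelope_separates x0.
  pose m : set R^o := [set r : R^o | r *: x = 0].
  have rl : linear (fun r : R^o => r *: x : Z).
    by move=> a r s; rewrite scalerDl scalerA.
  have mm : maximal_ideal m.
    split; first exact: (submodule_kernel (mklinear rl)).
      by rewrite /m /= scale1r.
    move=> J [J0 JD JZ] mJ J1; apply/seteqP; split=> // r Jr.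
    apply: contrapT => rx; have [s sE] := gen _ x rx.
    apply: J1; have -> : (1 : R) = (1 - s * r) + s * r by rewrite subrK.
    apply: JD; last exact: JZ.
    by apply: mJ; rewrite /m /= scalerBl scale1r -scalerA -sE subrr.
  have tl (b : {linear Z -> I}) : torsion_elt m (b x).
    by move=> r mr; rewrite -linearZ /= mr linear0.
  have [|s sE] := torsion_elt_simple mm (tl l) (y' := L l) _ lx.
    move=> r mr; rewrite -(fL.2 r l (lzero Z I)) => [|y /=].
      exact: functional0.
    by have [t ->] := gen x y x0; rewrite linearZ /= scalerA mulrC -scalerA tl
      ?scaler0.
  exists (s *: x) => b; have [t tE] := torsion_elt_simple mm (tl l) (tl b) lx.
  rewrite (fL.2 t l b) => [|y].
    by rewrite sE [b _]linearZ /= tE !scalerA mulrC.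
  have [u ->] := gen x y x0.
  by rewrite [b _]linearZ [l _]linearZ /= tE !scalerA mulrC.
move=> Z1 Z2 Z3 i p [ii ip sp] C1 C3 L fL; have [LD LZ] := fL.
have [|w wE] := C3 (fun b => L (lcomp b p)).
  split=> [f g h hE|a f h hE]; [apply: LD|apply: LZ] => x /=; exact: hE.
have [v vE] := sp w.
have ext (b : {linear Z1 -> I}) : exists g : {linear Z2 -> I},
    forall x, g (i x) = b x.
  apply: injective_extend => // x; rewrite /kernel /= -(linear0 i) => /ii ->.
  exact: linear0.
have [E EE] := choice ext.
pose D g := L g - g v.
(* The difference of g and g' factors through p as h, and there L is evaluation at w = p v. *)
have DE (g g' : {linear Z2 -> I}) : (forall x, g (i x) = g' (i x)) -> D g = D g'.
  move=> gg'; pose d := lsub g g'.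
  have [|h hE] := factor_surj (g := d) sp.
    by move=> x; rewrite -ip => -[z _ <-]; rewrite /kernel /= gg' subrr.
  have : L d = d v.
    have -> : L d = L (lcomp h p).
      by apply: functional_eq => x /=; rewrite hE.
    by rewrite wE -vE hE.
  rewrite (functionalB (f := g) (g := g') fL) //= => dv.
  by rewrite /D (canRL (subrK _) dv) addrAC [_ - _ - g v]addrAC subrr sub0r addrC.
have [|u uE] := C1 (fun b => D (E b)).
  split=> [f g h hE|a f h hE].
    rewrite (DE _ (ladd (E f) (E g))) => [|x /=].
      by rewrite /D (LD (E f) (E g)) //= opprD addrACA.
    by rewrite !EE hE.
  rewrite (DE _ (mklinear (scale_linear a (E f)))) => [|x /=].
    by rewrite /D (LZ a (E f)) //= scalerBr.
  by rewrite !EE hE.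
exists (v + i u) => b; have := uE (lcomp b i).
rewrite (DE _ b) => [|x]; last by rewrite EE.
by move=> /(canRL (subrK _)) ->; rewrite linearD addrC.
Qed.

End Artin.

(** * Modules over an artin algebra *)

(** A separate name for the carrier, so that its R-structure through [r%:A] does not compete with
    the A-structure. *)
Definition restrict_scalars (R : comPzRingType) (A : algType R)
  (Z : lmodType A) : Type := Z.

Section RestrictScalars.
Variables (R : comPzRingType) (A : algType R) (Z : lmodType A).
Local Notation Z_R := (restrict_scalars Z).

HB.instance Definition _ := GRing.Zmodule.copy Z_R Z.

Definition scale_R (r : R) (z : Z_R) : Z_R := (r%:A : A) *: (z : Z).

Fact scale_RA a b z : scale_R a (scale_R b z) = scale_R (a * b) z.
Proof. by rewrite /scale_R scalerA mulr_algl scalerA. Qed.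
Fact scale_R1 : left_id 1 scale_R.
Proof. by move=> z; rewrite /scale_R !scale1r. Qed.
Fact scale_RDr : right_distributive scale_R +%R.
Proof. by move=> a x y; rewrite /scale_R scalerDr. Qed.
Fact scale_RDl z : {morph scale_R^~ z : a b / a + b}.
Proof. by move=> a b; rewrite /scale_R !scalerDl. Qed.

HB.instance Definition _ :=
  GRing.Zmodule_isLmodule.Build R Z_R scale_RA scale_R1 scale_RDr scale_RDl.

End RestrictScalars.

Arguments restrict_scalars : clear implicits.
Arguments restrict_scalars {R A} Z.

Lemma restrict_linear (R : comPzRingType) (A : algType R) (U V : lmodType A)
  (f : {linear U -> V}) :
  linear (f : restrict_scalars U -> restrict_scalars V).
Proof. by move=> a x y; rewrite -[a *: x]/((a%:A : A) *: (x : U)) linearP. Qed.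

Lemma fg_fin (S : pzRingType) (M : lmodType S) (J : finType) (g : J -> M) :
  (forall x, exists c : J -> S, x = \sum_j c j *: g j) -> finitely_generated M.
Proof.
move=> gE; exists #|J|, (fun k => g (enum_val k)) => x; have [c ->] := gE x.
by exists (fun k => c (enum_val k));
  rewrite (reindex _ (onW_bij _ (enum_val_bij J))).
Qed.

Lemma scale_regular_linear (S : pzRingType) (M : lmodType S) (z : M) :
  linear (fun a : S^o => (a : S) *: z : M).
Proof. by move=> a x y; rewrite scalerDl -scalerA. Qed.

(** * Dual bases of finitely generated projective modules *)

Section FreeModules.
Variable S : pzRingType.
Implicit Types P Z : lmodType S.

Definition dual_basis P n (p : 'I_n -> P) (a : 'I_n -> {linear P -> S^o}) :=
  forall x, x = \sum_k (a k x : S) *: p k.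

Lemma combination_linear P Z n (a : 'I_n -> {linear P -> S^o}) (u : 'I_n -> Z) :
  linear (fun x => \sum_k (a k x : S) *: u k).
Proof.
move=> s x y; rewrite scaler_sumr -big_split; apply: eq_bigr => k _.
by rewrite /= linearP scalerDl -scalerA.
Qed.

Lemma dual_basis_fg P n p (a : 'I_n -> {linear P -> S^o}) :
  dual_basis p a -> finitely_generated P.
Proof. by move=> pa; exists n, p => x; exists (a ^~ x). Qed.

Lemma dual_basis_projective P n p (a : 'I_n -> {linear P -> S^o}) :
  dual_basis p a -> projective P.
Proof.
move=> pa U V q f sq; have [u uE] := choice (fun k => sq (f (p k))).
exists (mklinear (combination_linear a u)) => x /=.
rewrite [in RHS](pa x) !linear_sum; apply: eq_bigr => k _.
by rewrite !linearZ /= uE.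
Qed.

Lemma ffun_combination_linear Z n (u : 'I_n -> Z) :
  linear (fun c : {ffun 'I_n -> S^o} => \sum_k (c k : S) *: u k).
Proof.
move=> s x y; rewrite scaler_sumr -big_split; apply: eq_bigr => k _.
by rewrite /= !ffunE scalerDl -scalerA.
Qed.

Lemma ffun_ev_linear Z n (k : 'I_n) : linear (fun c : {ffun 'I_n -> Z} => c k).
Proof. by move=> s x y; rewrite !ffunE. Qed.

Lemma projective_dual_basis P : finitely_generated P -> projective P ->
  exists n (p : 'I_n -> P) (a : 'I_n -> {linear P -> S^o}), dual_basis p a.
Proof.
move=> [n [p pE]] hP.
have [|g gE] := hP _ _ (mklinear (ffun_combination_linear p)) (lid P).
  by move=> x; have [c ->] := pE x; exists [ffun k => c k];
    apply: eq_bigr => k _; rewrite ffunE.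
exists n, p, (fun k => lcomp (mklinear (@ffun_ev_linear (S^o : lmodType S) n k)) g).
by move=> x; rewrite -[LHS]gE.
Qed.

End FreeModules.

Section ArtinAlgebra.
Variables (R : comPzRingType) (A : algType R).
Hypothesis hR : artinian R^o.
Hypothesis hA : @finitely_generated R A.
Variables (I : lmodType R) (e : {linear R^o -> I}).
Hypothesis hI : injective_envelope e (@jacobson_radical R).
Implicit Types U V Z N : lmodType A.
Local Notation DA := (dual_bimodule A I).
Local Notation res := restrict_scalars.

Lemma fg_restrict Z : finitely_generated Z -> finitely_generated (res Z).
Proof.
move=> [n [g gE]]; have [m [h hE]] := hA.
apply: (@fg_fin _ (res Z) _ (fun ij : 'I_n * 'I_m => h ij.2 *: g ij.1)) => z.
have [c ->] := gE z; have [s sE] := choice (fun i => hE (c i)).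
exists (fun ij => s ij.1 ij.2).
rewrite -(pair_bigA _ (fun i j => s i j *: (h j *: g i : res Z))) /=.
apply: eq_bigr => i _; rewrite {1}sE scaler_suml; apply: eq_bigr => j _.
by rewrite -[RHS]/((s i j)%:A *: (h j *: g i)) scalerA mulr_algl.
Qed.

Lemma fg_unrestrict Z : finitely_generated (res Z) -> finitely_generated Z.
Proof.
by move=> [n [g gE]]; exists n, g => z; have [c ->] := gE z;
  exists (fun k => (c k)%:A).
Qed.

Lemma finite_length_restrict Z : finitely_generated Z -> finite_length (res Z).
Proof. by move=> /fg_restrict; apply: (finite_length_fg hR hI). Qed.

Lemma fg_sub U V (i : {linear U -> V}) :
  injective i -> finitely_generated V -> finitely_generated U.
Proof.
move=> ii /finite_length_restrict fV; apply: fg_unrestrict.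
exact: (finite_length_noetherian fV (i := mklinear (restrict_linear i))).
Qed.

Definition dual_ev (b : DA) (x : A) : I := (b : hom_mod (regular_bimodule A) I) x.

Lemma dual_evD b c x : dual_ev (b + c) x = dual_ev b x + dual_ev c x.
Proof. by []. Qed.

Lemma dual_evZ a b x : dual_ev (a *: b) x = dual_ev b (x * a).
Proof. by []. Qed.

Lemma dual_ev_ract a b x : dual_ev (ract b a) x = dual_ev b (a * x).
Proof. by []. Qed.

Lemma dual_ev_linearr b : linear (dual_ev b : A -> I).
Proof. by move=> r x y; rewrite /dual_ev linearP. Qed.

Lemma dual_evZr b (r : R) x : dual_ev b (r *: x) = r *: dual_ev b x.
Proof. exact: linearZ_LR (mklinear (dual_ev_linearr b)) r x. Qed.

Lemma dual_ev_linear x : linear (dual_ev ^~ x : res DA -> I).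
Proof.
move=> r b c; rewrite -[r *: b + c]/((r%:A : A) *: (b : DA) + c) dual_evD dual_evZ.
by rewrite mulr_algr dual_evZr.
Qed.

Lemma dual_ev_sum (J : finType) (F : J -> DA) x :
  dual_ev (\sum_j F j) x = \sum_j dual_ev (F j) x.
Proof. exact: (linear_sum (mklinear (dual_ev_linear x))). Qed.

Lemma dual_ev_sumr (J : finType) b (F : J -> A) :
  dual_ev b (\sum_j F j) = \sum_j dual_ev b (F j).
Proof. exact: (linear_sum (mklinear (dual_ev_linearr b))). Qed.

Lemma dual_ext b c : dual_ev b =1 dual_ev c -> b = c.
Proof. by move=> bc; apply: linear_ext. Qed.

Lemma dual_mk (l : {linear A -> I}) : exists b : DA, dual_ev b =1 l.
Proof. by exists (l : hom_mod (regular_bimodule A) I). Qed.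

(** The adjunction between Hom over R into I and Hom over A into DA: l corresponds to the map
    sending z to x |-> l(x z). *)
Lemma dual_coextend Z (l : {linear res Z -> I}) :
  exists h : {linear Z -> DA}, forall z x, dual_ev (h z) x = l (x *: z).
Proof.
have ll z : linear (fun x : A => l (x *: z : Z)).
  move=> r x y; rewrite scalerDl -mulr_algl -scalerA.
  exact: (linearP l r (x *: z) (y *: z)).
pose h z : DA := (mklinear (ll z) : hom_mod (regular_bimodule A) I).
have hl : linear (h : Z -> DA).
  move=> a y z; apply: dual_ext => x; rewrite dual_evD dual_evZ /dual_ev /=.
  by rewrite scalerDr scalerA linearD.
by exists (mklinear hl).
Qed.

Lemma dual_separates (x : A) : (forall b : DA, dual_ev b x = 0) -> x = 0.
Proof.
move=> bx; apply: contrapT => /(envelope_separates hR hI)[l lx].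
by apply: lx; have [b <-] := dual_mk l.
Qed.

Lemma ract_inj (a a' : A) : (forall b : DA, ract b a = ract b a') -> a = a'.
Proof.
move=> aa'; apply/eqP; rewrite -subr_eq0; apply/eqP/dual_separates => b.
have := congr1 (dual_ev ^~ 1) (aa' b); rewrite !dual_ev_ract !mulr1 => bE.
by have /= -> := linearB (mklinear (dual_ev_linearr b)) a a'; rewrite bE subrr.
Qed.

(** The assignment b |-> (t b)(1) is a functional on the dual of A, hence evaluation at some a by
    reflexivity; A-linearity of t carries this from 1 to every argument. *)
Lemma dual_endomorphism (t : {linear DA -> DA}) :
  exists a : A, forall b, t b = ract b a.
Proof.
have [||a aE] := @finite_length_reflexive _ _ _ hR hI (A : lmodType R)
  (fun l => dual_ev (t (l : hom_mod (regular_bimodule A) I)) 1).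
- exact: finite_length_fg hR hI _ hA.
- split=> [f g h hE|r f h hE].
    rewrite -dual_evD -linearD; congr (dual_ev (t _) 1).
    by apply: linear_ext => x; rewrite hE.
  have -> : (h : DA) = r%:A *: (f : DA).
    by apply: linear_ext => x; rewrite hE /= mulr_algr linearZ.
  by rewrite linearZ dual_evZ mul1r /dual_ev -linearZ /= -mulr_algr mul1r.
exists a => b; apply: dual_ext => x; rewrite dual_ev_ract.
by rewrite -[x in LHS]mul1r -dual_evZ -linearZ aE.
Qed.

(** Presents N as a direct summand of DA^n; the counterpart of [dual_basis] for injective
    modules. *)
Definition coordinates N n (i : 'I_n -> {linear N -> DA})
    (p : 'I_n -> {linear DA -> N}) :=
  forall x, x = \sum_k p k (i k x).

(** Finitely many R-functionals separate the points of N; coextended to DA they embed N into DA^n,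
    and the embedding splits because N is injective. *)
Lemma dual_coordinates N : finitely_generated N -> injective_module N ->
  exists n (i : 'I_n -> {linear N -> DA}) (p : 'I_n -> {linear DA -> N}),
    coordinates i p.
Proof.
move=> fN injN.
have [n [b bE]] := finite_length_cogenerated hR hI (finite_length_restrict fN).
have [i iE] := choice (fun k => dual_coextend (b k)).
have il : linear (fun x => [ffun k => i k x]).
  by move=> a x y; apply/ffunP => k; rewrite !ffunE linearP.
have [|q qE] := injective_extend (i := mklinear il) (f := lid N) injN.
  move=> x /= /ffunP ix; apply: bE => k.
  by have := iE k x 1; have := ix k; rewrite !ffunE scale1r => -> <-.
have dl (k : 'I_n) : linear (fun b : DA => [ffun j => if j == k then b else 0]).
  move=> a x y; apply/ffunP => j; rewrite !ffunE; case: eqP => // _.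
  by rewrite scaler0 addr0.
exists n, i, (fun k => lcomp q (mklinear (dl k))) => x /=.
rewrite -linear_sum -[LHS]qE; congr (q _); apply/ffunP => k.
rewrite sum_ffunE /= ffunE (bigD1 k) //= ffunE eqxx big1 ?addr0 // => j jk.
by rewrite ffunE eq_sym (negPf jk).
Qed.

End ArtinAlgebra.

(** * The inverse Nakayama functor Hom(DA, -) on injective modules *)

Section InverseNakayama.
Variables (R : comPzRingType) (A : algType R).
Hypothesis hR : artinian R^o.
Hypothesis hA : @finitely_generated R A.
Variables (I : lmodType R) (e : {linear R^o -> I}).
Hypothesis hI : injective_envelope e (@jacobson_radical R).
Implicit Types U V Z N : lmodType A.
Local Notation DA := (dual_bimodule A I).
Local Notation res := restrict_scalars.
Local Notation Nak N := (hom_mod DA N : lmodType A).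

Lemma hom_mod_sum N (J : finType) (F : J -> Nak N) (b : DA) :
  (\sum_j F j : hom_mod DA N) b = \sum_j (F j : hom_mod DA N) b.
Proof.
by apply: (big_morph (fun g : hom_mod DA N => g b) (id1 := 0)).
Qed.

(** For g : DA -> N, the composite of g and [i k] is an endomorphism of DA, hence right
    multiplication by an element of A. Its uniqueness makes it linear in g. *)
Lemma nak_coordinates N n (i : 'I_n -> {linear N -> DA}) :
  exists a : 'I_n -> {linear Nak N -> A^o},
    forall k (g : Nak N) b, i k ((g : hom_mod DA N) b) = ract b (a k g).
Proof.
have /choice[a aE] (k : 'I_n) : exists a : {linear Nak N -> A^o},
    forall (g : Nak N) b, i k ((g : hom_mod DA N) b) = ract b (a g).
  have /choice[a aE] (g : Nak N) : exists a : A,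
      forall b, i k ((g : hom_mod DA N) b) = ract b a.
    by have [a aE] := dual_endomorphism hR hA hI
      (lcomp (i k) (g : hom_mod DA N)); exists a.
  have al : linear (a : Nak N -> A^o).
    move=> s g h; apply: (ract_inj hR hI) => b.
    rewrite -aE ractDr -aE -[s *: (a g : A^o)]/(s * a g) ractM -aE /=.
    by rewrite linearD.
  by exists (mklinear al).
by exists a.
Qed.

(** * The pairing of Hom(Hom(DA, N), Z) with Hom(Z, N) *)

Section Pairing.
Variables (N : lmodType A) (n : nat).
Variables (i : 'I_n -> {linear N -> DA}) (p : 'I_n -> {linear DA -> N}).
Hypothesis ip : coordinates i p.
Variable (a : 'I_n -> {linear Nak N -> A^o}).
Hypothesis aE : forall k (g : Nak N) b, i k ((g : hom_mod DA N) b) = ract b (a k g).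

Lemma nak_dual_basis : dual_basis (p : 'I_n -> Nak N) a.
Proof.
move=> g; apply: linear_ext => b; rewrite hom_mod_sum [LHS]ip.
by apply: eq_bigr => k _; rewrite aE.
Qed.

(** A trace of h after f along the coordinates of N, where [p k] is read as an element of Hom(DA, N)
    and each term is evaluated at 1 to land in I. *)
Definition pairing Z (f : {linear Nak N -> Z}) (h : {linear Z -> N}) : I :=
  \sum_k dual_ev (i k (h (f (p k)))) 1.

Lemma rank_one_linear Z (k : 'I_n) (z : Z) :
  linear (fun g : Nak N => (a k g : A) *: z).
Proof. by move=> s x y; rewrite linearP scalerDl -scalerA. Qed.

(** Pairing with maps of rank one reads off the coordinates of h z at 1; varying z over its
    multiples recovers h. *)
Lemma pairing_rank_one Z (h : {linear Z -> N}) k z :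
  pairing (mklinear (rank_one_linear k z)) h = dual_ev (i k (h z)) 1.
Proof.
rewrite /pairing /= [in RHS](ip (h z)) linear_sum dual_ev_sum.
apply: eq_bigr => l _; rewrite -[i k (p l _)]/(i k ((p l : Nak N) _)) aE.
by rewrite !linearZ dual_evZ dual_ev_ract mul1r mulr1.
Qed.

Lemma pairing_nondegenerate Z (h : {linear Z -> N}) :
  (forall f, pairing f h = 0) -> forall z, h z = 0.
Proof.
move=> fh z; rewrite [LHS]ip big1 // => k _.
suff -> : i k (h z) = 0 by rewrite linear0.
apply: dual_ext => x; rewrite -[x]mul1r -dual_evZ -!linearZ.
by rewrite -pairing_rank_one fh.
Qed.

Lemma pairing_coextend Z (f : {linear Nak N -> Z}) k (l : {linear res Z -> I}) :
  exists h : {linear Z -> N}, pairing f h = l (f (p k)).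
Proof.
have [h hE] := dual_coextend l.
exists (lcomp (p k) h); rewrite /pairing /=.
rewrite [in RHS](nak_dual_basis (p k)).
rewrite (linear_sum f) (linear_sum l); apply: eq_bigr => j _.
rewrite -[i j (p k _)]/(i j ((p k : Nak N) _)) aE dual_ev_ract mulr1 hE.
by rewrite linearZ.
Qed.

Lemma pairing_nondegenerater Z (f : {linear Nak N -> Z}) :
  (forall h, pairing f h = 0) -> forall g, f g = 0.
Proof.
move=> fh g; rewrite (nak_dual_basis g) linear_sum big1 // => k _.
suff fp : f (p k) = 0 by rewrite linearZ /= fp scaler0.
apply: contrapT => /(envelope_separates hR hI (V := res Z))[l].
by apply; have [h <-] := pairing_coextend f k l.
Qed.

Lemma scale_R_ract_linear U (r : R) : linear (fun u : U => (r%:A : A) *: u).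
Proof. by move=> s x y; rewrite scalerDr !scalerA mulr_algl mulr_algr. Qed.

(* Makes Hom(U, Z) a module over R, through hom_mod. *)
Definition central_bimodule U : bimodule A R :=
  @Bimodule A R U (fun u r => (r%:A : A) *: u) (@scale_R_ract_linear U)
    (fun u r s => scale_RDl u r s) (fun u => scale_R1 u)
    (fun u r s => etrans (congr1 (fun t => scale_R t u) (mulrC r s))
       (esym (scale_RA s r u))).

(** Every f is a sum of rank-one maps by the dual basis, so l is determined by its values on them.
    For fixed k, these values form an R-functional of z, and its coextension to DA gives the k-th
    coordinate of h. *)
Lemma pairing_represent Z
    (l : {linear (hom_mod (central_bimodule (Nak N)) Z : lmodType R) -> I}) :
  exists h : {linear Z -> N}, forall f : {linear Nak N -> Z}, pairing f h = l f.
Proof.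
pose H := hom_mod (central_bimodule (Nak N)) Z.
pose F k z : H := mklinear (rank_one_linear k z).
have Fl k : linear (F k : res Z -> H).
  move=> r y z; apply: linear_ext => g /=.
  rewrite scalerDr; congr (_ + _).
  have -> : a k ((r%:A : A) *: (g : Nak N)) = (r%:A : A) * (a k g : A).
    exact: linearZ_LR (a k) _ _.
  by rewrite -[r *: y]/((r%:A : A) *: (y : Z)) !scalerA mulr_algl mulr_algr.
have [h hE] := choice (fun k => dual_coextend (lcomp l (mklinear (Fl k)))).
have hl : linear (fun z => \sum_k p k (h k z)).
  by move=> s x y; rewrite scaler_sumr -big_split; apply: eq_bigr => k _;
    rewrite !linearP.
exists (mklinear hl) => f; rewrite /pairing.
have -> : l f = \sum_k l (F k (f (p k))).
  rewrite -linear_sum; congr (l _); apply: linear_ext => g.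
  rewrite [in LHS](nak_dual_basis g) linear_sum.
  rewrite (big_morph (fun t : H => t g) (id1 := 0) (op1 := +%R)) //.
  by apply: eq_bigr => k _; rewrite linearZ.
transitivity (\sum_k \sum_j dual_ev (i k (p j (h j (f (p k))))) 1).
  by apply: eq_bigr => k _; rewrite /= linear_sum dual_ev_sum.
rewrite exchange_big; apply: eq_bigr => j _ /=.
have FS (u : 'I_n -> Z) : F j (\sum_k u k) = \sum_k F j (u k).
  exact: (linear_sum (mklinear (Fl j))).
rewrite [in RHS](nak_dual_basis (p j)) [f _]linear_sum FS linear_sum;
  apply: eq_bigr => k _.
rewrite -[i k (p j _)]/(i k ((p j : Nak N) _)) aE dual_ev_ract mulr1 hE /=.
by rewrite linearZ.
Qed.

End Pairing.

Section Naturality.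
Variables (N N' : lmodType A) (d : {linear N -> N'}).
Local Notation d_ := (mklinear (@hom_post_linear A A DA N N' d)).

Section Coordinates.
Variables (n n' : nat).
Variables (i : 'I_n -> {linear N -> DA}) (p : 'I_n -> {linear DA -> N}).
Variables (i' : 'I_n' -> {linear N' -> DA}) (p' : 'I_n' -> {linear DA -> N'}).
Hypotheses (ip : coordinates i p) (ip' : coordinates i' p').

(** Both sides expand to one double sum: on the left d after [p k] is expanded in the dual basis of
    Hom(DA, N'), on the right the value of h in the coordinates of N. *)
Lemma pairing_natural Z (f : {linear Nak N' -> Z}) (h : {linear Z -> N}) :
  pairing i p (lcomp f d_) h =
  pairing i' p' f (lcomp d h).
Proof.
have [a aE] := nak_coordinates i'.
transitivity (\sum_k \sum_l dual_ev (i k (h (f (p' l)))) (a l (d_ (p k)))).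
  apply: eq_bigr => k _; rewrite [LHS]/= [hom_post d _](nak_dual_basis ip' aE).
  rewrite [f _]linear_sum [h _]linear_sum [i k _]linear_sum dual_ev_sum.
  by apply: eq_bigr => l _; rewrite !linearZ dual_evZ mul1r.
rewrite exchange_big; apply: eq_bigr => l _ /=.
rewrite [h _ in RHS]ip !linear_sum dual_ev_sum; apply: eq_bigr => k _.
rewrite -[d (p k _)]/((d_ (p k) : hom_mod DA N') _) aE.
by rewrite dual_ev_ract mulr1.
Qed.

End Coordinates.

Hypotheses (fgN : finitely_generated N) (injN : injective_module N).
Hypotheses (fgN' : finitely_generated N') (injN' : injective_module N').

(** By duality, precomposition with Hom(DA, d) is onto exactly when composition with d is injective.
    If f does not factor, some functional kills the maps that do but not f. It is the pairing with
    some h, and by naturality d h pairs to 0 with every map, so d h = 0 and thus h = 0, a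
    contradiction. *)
Lemma nak_factor_injective Z :
  (forall f : {linear Nak N -> Z}, exists g : {linear Nak N' -> Z},
    forall x, f x = g (d_ x)) <->
  (forall h : {linear Z -> N}, (forall z, d (h z) = 0) -> forall z, h z = 0).
Proof.
have [n [i [p ip]]] := dual_coordinates hR hA hI fgN injN.
have [n' [i' [p' ip']]] := dual_coordinates hR hA hI fgN' injN'.
have [a aE] := nak_coordinates i.
split=> [fg h dh|h0 f].
  apply: (pairing_nondegenerate ip aE) => f; have [g gE] := fg f.
  have -> : f = lcomp g d_ by apply: linear_ext.
  rewrite (pairing_natural ip ip') /pairing big1 // => k _ /=.
  by rewrite dh linear0.
apply: contrapT => nf.
pose H := hom_mod (central_bimodule (Nak N)) Z : lmodType R.
pose B : set H := [set t : H | exists g : {linear Nak N' -> Z},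
  forall x, (t : hom_mod (central_bimodule (Nak N)) Z) x = g (d_ x)].
have sB : submodule B.
  split=> [|t u [g gE] [g' g'E]|r t [g gE]].
  - by exists (lzero (Nak N') Z).
  - by exists (ladd g g') => x /=; rewrite gE g'E.
  - exists (lcomp g (mklinear (@scale_R_ract_linear (Nak N') r))).
    by move=> x /=; rewrite gE linearZ.
have [l [lB lf]] := @envelope_cogenerates R I e hR hI H B f sB nf.
have [h hE] := pairing_represent ip aE l.
apply: lf; rewrite -hE.
have hz : forall z, h z = 0.
  apply: h0 => z; have [a' a'E] := nak_coordinates i'.
  apply: (pairing_nondegenerate ip' a'E (h := lcomp d h)) => g.
  by rewrite -(pairing_natural ip ip') hE; apply: lB; exists g.
by rewrite /pairing big1 // => k _; rewrite hz linear0.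
Qed.

(** The other half of the duality: each g is d h for some h, so f pairs with g as f after Hom(DA, d)
    pairs with h, which is 0. *)
Lemma nak_factor_surjective Z :
  (forall g : {linear Z -> N'}, exists h : {linear Z -> N},
    forall z, g z = d (h z)) ->
  forall f : {linear Nak N' -> Z}, (forall x, f (d_ x) = 0) -> forall x, f x = 0.
Proof.
have [n [i [p ip]]] := dual_coordinates hR hA hI fgN injN.
have [n' [i' [p' ip']]] := dual_coordinates hR hA hI fgN' injN'.
have [a aE] := nak_coordinates i'.
move=> gh f fd; apply: (pairing_nondegenerater ip' aE) => g.
have [h hE] := gh g.
have -> : g = lcomp d h by apply: linear_ext.
rewrite -(pairing_natural ip ip') /pairing big1 // => k _ /=.
by rewrite [f _]fd !linear0.
Qed.

End Naturality.

Lemma nak_fg_projective N : finitely_generated N -> injective_module N ->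
  finitely_generated (Nak N) /\ projective (Nak N).
Proof.
move=> fN injN; have [n [i [p ip]]] := dual_coordinates hR hA hI fN injN.
have [a aE] := nak_coordinates i; have pa := nak_dual_basis ip aE.
by split; [apply: dual_basis_fg pa|apply: dual_basis_projective pa].
Qed.

End InverseNakayama.

(** * Tensor products *)

Definition mkadditive (U V : zmodType) (f : U -> V)
    (fB : {morph f : x y / x - y}) : {additive U -> V} :=
  HB.pack f (GRing.isZmodMorphism.Build U V f fB).

Section Tensor.
Variables (S A : pzRingType) (B : bimodule S A) (Z : lmodType A).

Lemma ractDl (b b' : B) a : ract (b + b') a = ract b a + ract b' a.
Proof. exact: (linearD (mklinear (@ract_linear S A B a))). Qed.

Lemma ractZl s (b : B) a : ract (s *: b) a = s *: ract b a.
Proof. exact: (linearZ_LR (mklinear (@ract_linear S A B a))). Qed.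

Section Universal.
Variables (T : lmodType S) (t : B -> Z -> T).
Hypothesis tT : tensor_product t.

Lemma tensor_eq0 (G : zmodType) (g : T -> G) :
  {morph g : x y / x - y} -> (forall b z, g (t b z) = 0) -> forall x, g x = 0.
Proof.
move=> gB gt x; have [_ _ univ] := tT.
have [|g0 [_ g0u]] := univ G (fun _ _ => 0).
  by split=> *; rewrite ?addr0.
have h0B : {morph (fun _ : T => 0 : G) : x y / x - y} by move=> y z; rewrite subr0.
exact: etrans (g0u (mkadditive gB) gt x) (esym (g0u (mkadditive h0B) _ x)).
Qed.

(** The universal property yields only an additive map g. It is S-linear because g(s x) - s g(x) is
    additive in x and vanishes on elementary tensors. *)
Lemma tensor_lift (W : lmodType S) (u : B -> Z -> W) : balanced u ->
  (forall s b z, u (s *: b) z = s *: u b z) ->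
  exists g : {linear T -> W}, forall b z, g (t b z) = u b z.
Proof.
move=> bu uZ; have [_ tZ univ] := tT; have [g [gE _]] := univ W u bu.
have gl : linear g.
  move=> s x y; rewrite raddfD; congr (_ + _); apply/eqP; rewrite -subr_eq0.
  apply/eqP; apply: (@tensor_eq0 W (fun x => g (s *: x) - s *: g x)) => [v w|b z].
    rewrite /= scalerBr !(raddfB g) scalerBr !opprB [LHS]addrACA [RHS]addrACA.
    by congr (_ + _); rewrite addrC.
  by rewrite -tZ !gE uZ subrr.
by exists (mklinear gl).
Qed.

End Universal.

(* With Z = A^n / K, the tensor product is B^n / BK. *)
Lemma tensor_product_exists : finitely_generated Z ->
  exists (T : lmodType S) (t : B -> Z -> T), tensor_product t.
Proof.
move=> [n [g gE]].
pose F : lmodType S := {ffun 'I_n -> B}.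
pose vec (b : B) (c : 'I_n -> A) : F := [ffun k => ract b (c k)].
pose K : set F := [set f | forall L : set F, submodule L ->
  (forall b c, \sum_k c k *: g k = 0 -> L (vec b c)) -> L f].
have sK : submodule K.
  split=> [L [L0 _ _] _ //|x y Kx Ky L sL LE|a x Kx L sL LE].
    by case: (sL) => _ LD _; apply: LD; [apply: Kx|apply: Ky].
  by case: (sL) => _ _ LZ; apply: LZ; apply: Kx.
have [T [p [sp pE]]] := quotient_type sK.
have [c cE] := choice gE.
pose t b z := p (vec b (c z)).
have vecB b (c1 c2 : 'I_n -> A) : vec b c1 - vec b c2 = vec b
  (fun k => c1 k - c2 k).
  apply/ffunP => k; rewrite !ffunE; apply/eqP; rewrite subr_eq -ractDr subrK.
  exact: eqxx.
have tE b z (c' : 'I_n -> A) : z = \sum_k c' k *: g k -> t b z = p (vec b c').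
  move=> zE; apply/kernelB; rewrite pE vecB => L sL; apply.
  rewrite (eq_bigr (fun k => c z k *: g k - c' k *: g k)) => [|k _];
    last exact: scalerBl.
  by rewrite sumrB -cE -zE subrr.
exists T, t; split.
- split=> [b b' z|b z z'|b a z].
  + by rewrite /t -linearD; congr (p _); apply/ffunP => k; rewrite !ffunE ractDl.
  + rewrite (tE b _ (fun k => c z k + c z' k)) => [|].
      by rewrite /t -linearD; congr (p _); apply/ffunP => k; rewrite !ffunE ractDr.
    rewrite {1}[z]cE {1}[z']cE -big_split; apply: eq_bigr => k _.
    by rewrite scalerDl.
  + rewrite (tE b (a *: z) (fun k => a * c z k)) => [|].
      by congr (p _); apply/ffunP => k; rewrite !ffunE ractM.
    by rewrite {1}[z]cE scaler_sumr; apply: eq_bigr => k _; rewrite scalerA.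
- by move=> s b z; rewrite /t -linearZ; congr (p _); apply/ffunP => k;
    rewrite !ffunE ractZl.
move=> G u [uDl uDr uM].
have u0 z : u 0 z = 0 by apply: (addrI (u 0 z)); rewrite -uDl !addr0.
have u0r b : u b 0 = 0 by apply: (addrI (u b 0)); rewrite -uDr !addr0.
have uN b z : u (- b) z = - u b z by apply: (addrI (u b z)); rewrite -uDl !subrr u0.
pose v (f : F) := \sum_k u (f k) (g k).
have vB : {morph v : x y / x - y}.
  by move=> x y; rewrite -sumrB; apply: eq_bigr => k _; rewrite !ffunE uDl uN.
have vD : {morph v : x y / x + y}.
  by move=> y z; rewrite -big_split; apply: eq_bigr => k _; rewrite ffunE uDl.
have v0 : v 0 = 0 by rewrite /v big1 // => k _; rewrite ffunE u0.
have vvec b c' : v (vec b c') = u b (\sum_k c' k *: g k).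
  rewrite (big_morph (u b) (uDr b) (u0r b)).
  by apply: eq_bigr => k _; rewrite ffunE uM.
have vK f : K f -> v f = 0.
  (* As v is merely additive, its zero set need not be a submodule; the largest submodule inside it
     is used to test membership in K. *)
  move=> Kf; have := Kf [set f | forall s, v (s *: f) = 0].
  move=> /(_ _ _ 1); rewrite scale1r; apply.
    split=> [s|x y vx vy s|a x vx s] /=.
    - by rewrite scaler0 v0.
    - by rewrite scalerDr vD vx vy addr0.
    - by rewrite scalerA.
  move=> b c' cE' s; have -> : s *: vec b c' = vec (s *: b) c'.
    by apply/ffunP => k; rewrite !ffunE ractZl.
  by rewrite vvec cE' u0r.
have [r rE] := choice sp.
have vr f : v (r (p f)) = v f.
  by apply/eqP; rewrite -subr_eq0 -vB; apply/eqP/vK; rewrite -pE; apply/kernelB.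
have wB : {morph (fun x => v (r x)) : x y / x - y}.
  by move=> x y; rewrite -vB -[RHS]vr linearB !rE.
exists (mkadditive wB); split=> [b z|g' g'E x] /=; first by rewrite /t vr vvec -cE.
have [f <-] := sp x; rewrite vr.
have -> : f = \sum_k vec (f k) (fun j => (j == k)%:R).
  apply/ffunP => j; rewrite sum_ffunE (bigD1 j) //= ffunE eqxx ract1 big1 ?addr0 //.
  move=> k kj; rewrite ffunE eq_sym (negPf kj).
  by apply: (addrI (ract (f k) 0)); rewrite -ractDr !addr0.
rewrite (big_morph v vD v0).
rewrite !raddf_sum; apply: eq_bigr => k _; rewrite vvec -g'E; congr (g' _).
by apply/esym/tE.
Qed.

End Tensor.

(** * Minimal presentations and extensions *)

Section Presentations.
Variable S : pzRingType.
Implicit Types U V W X Y Z : lmodType S.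

(* By the Ext hypothesis f agrees modulo f(ker d) with a map factoring through
   d; the difference has the same restriction to ker d and takes values in
   f(ker d), so that its kernel supplements the superfluous submodule ker d. *)
Lemma presentation_factor X Z (P1 P0 : lmodType S) (d : {linear P1 -> P0})
    (p : {linear P0 -> X}) (f : {linear P1 -> Z}) :
  projective P0 -> finitely_generated P0 -> surj p -> range d = kernel p ->
  superfluous (kernel d) -> finitely_generated Z ->
  (forall Z' (q : {linear Z -> Z'}), surj q -> Ext1_zero X Z') ->
  exists v : {linear P0 -> Z}, forall x, f x = v (d x).
Proof.
move=> prP0 fgP0 sp dp supd fgZ ext.
have [Z' [q [sq qE]]] := quotient_type (submodule_image f (submodule_kernel d)).
(* The cokernel E of r is the pushout of d along q f. Since q kills f(ker d), Z' embeds into E, so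
   that E is an extension of X by Z'. *)
pose r := lpair (lcomp q f) (lopp d).
have [E [c [sc cE]]] := quotient_type (submodule_range r).
have rc x : c (q (f x), 0) = c (0, d x).
  apply/kernelB; rewrite cE; exists x => //=.
  by congr pair; rewrite ?subr0 ?sub0r.
pose i := lcomp c (linl Z' P0).
have [|p' p'E] := factor_surj (g := lcomp p (lsnd Z' P0)) sc.
  rewrite cE => _ [x _ <-]; rewrite /kernel /= linearN.
  have : kernel p (d x) by rewrite -dp; exists x.
  by rewrite /kernel /= => ->; rewrite oppr0.
have fgE : finitely_generated E.
  by apply: (fg_surj sc); apply: fg_pair => //; apply: fg_surj sq fgZ.
have [phi [bphi phii phip]] : exists phi : {linear (Z' * X)%type -> E},
    [/\ bijective phi, (forall z, phi (z, 0) = i z) & forall u, p' (phi u) = u.2].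
  apply: (ext _ q sq E i p' fgE); split.
  - apply: kernel0_inj => z /= cz; have : kernel c (z, 0) by [].
    rewrite cE => -[x _ [<- dx]]; have : kernel q (f x).
      by rewrite qE; exists x => //; rewrite /kernel /= -[d x]opprK dx oppr0.
    by [].
  - apply/seteqP; split=> [_ [z _ <-]|y]; rewrite /kernel /=.
      by rewrite p'E /= linear0.
    have [[z w] <-] := sc y; rewrite p'E /= => pw.
    have : range d w by rewrite dp.
    case=> x _ <-; exists (z + q (f x)) => //=.
    have -> : (z, d x) = (z, 0) + (0, d x) by congr pair; rewrite /= ?addr0 ?add0r.
    have -> : (z + q (f x), 0) = (z, 0) + (q (f x), 0) :> (Z' * P0)%type.
      by congr pair; rewrite /= addr0.
    by rewrite !linearD rc.
  - by move=> x; have [w <-] := sp x; exists (c (0, w)); rewrite p'E.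
have [psi psiK phiK] := bphi.
have psil : linear psi.
  by move=> a x y; apply: (can_inj psiK); rewrite linearP !phiK.
pose v' := lcomp (lfst Z' X)
  (lcomp (mklinear psil) (lcomp c (linr Z' P0))).
have v'E x : v' (d x) = q (f x).
  by rewrite /= -rc -[c _]/(i _) -phii psiK.
have [v vE] := prP0 _ _ q v' sq.
exists v => x; apply/eqP; rewrite -subr_eq0; apply/eqP.
pose g := lsub f (lcomp v d).
apply: (supd (kernel g) (submodule_kernel g)) => y.
have : kernel q (g y) by rewrite /kernel /= linearB vE v'E subrr.
rewrite qE => -[k dk fk]; exists k, (y - k); split=> //;
  last by rewrite addrC subrK.
by apply/kernelB; rewrite -fk /= dk linear0 subr0.
Qed.

(* By the Ext hypothesis g factors through d on the preimage of range d; the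
   difference with an extension of this factorization has a range meeting the
   essential submodule range d trivially. *)
Lemma copresentation_factor Y Z (Q0 Q1 : lmodType S) (d : {linear Q0 -> Q1})
    (q : {linear Y -> Q0}) (g : {linear Z -> Q1}) :
  injective_module Q0 -> injective q -> kernel d = range q ->
  essential (range d) ->
  (forall (E : lmodType S) (i : {linear E -> (Q0 * Z)%type}), injective i ->
    finitely_generated E) ->
  (forall Z' (i : {linear Z' -> Z}), injective i -> Ext1_zero Z' Y) ->
  exists v : {linear Z -> Q0}, forall x, g x = d (v x).
Proof.
move=> injQ0 iq dq ess fgsub ext.
have [Z' [i [ii iE]]] := submodule_type (submodule_preimage g (submodule_range d)).
(* The kernel E of r is the pullback of d and g, an extension of Z' = g^-1(range d) by ker d = Y. *)
pose r := lcopair d (lopp g).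
have [E [c [ic cE]]] := submodule_type (submodule_kernel r).
have rE y : d (c y).1 = g (c y).2.
  by have : kernel r (c y) by [rewrite -cE; exists y];
    rewrite /kernel /= => /subr0_eq.
have [|j jE] := factor_inj (g := lcomp (linl Q0 Z) q) ic.
  rewrite cE => _ [y _ <-]; rewrite /kernel /= linear0 subr0.
  by have : kernel d (q y) by rewrite dq; exists y.
have [|p pE] := factor_inj (g := lcomp (lsnd Q0 Z) c) ii.
  by rewrite iE => _ [y _ <-] /=; rewrite -rE; exists (c y).1.
have [phi [bphi phij phip]] : exists phi : {linear (Y * Z')%type -> E},
    [/\ bijective phi, (forall y, phi (y, 0) = j y) & forall u, p (phi u) = u.2].
  apply: (ext _ i ii E j p (fgsub _ c ic)); split.
  - by move=> y y' yy'; have := jE y; rewrite yy' jE /= => -[] /iq.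
  - apply/seteqP; split=> [_ [y _ <-]|y].
      by rewrite /kernel /=; apply: ii; rewrite pE /= jE /= linear0.
    rewrite /kernel /= => py; have cy2 : (c y).2 = 0 by have := pE y;
      rewrite py linear0.
    have : kernel d (c y).1 by rewrite /kernel /= rE cy2 linear0.
    rewrite dq => -[z _ zE]; exists z => //; apply: ic; rewrite jE /= zE.
    by case: (c y) cy2 => u w /= ->.
  - move=> z; have : range i (i z) by exists z.
    rewrite iE => -[n _ nE].
    have : kernel r (n, i z) by rewrite /kernel /= nE subrr.
    rewrite -cE => -[y _ yE]; exists y; apply: ii; rewrite pE /=.
    by rewrite yE.
pose s := lcomp (lfst Q0 Z) (lcomp c
  (lcomp phi (linr Y Z'))).
have sE z : d (s z) = g (i z).
  by rewrite /= rE; congr (g _); have := pE (phi (0, z)); rewrite phip.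
have [|v vE] := injective_extend (i := i) (f := s) injQ0.
  by move=> z; rewrite /kernel -(linear0 i) => /ii ->; rewrite /= !linear0.
exists v => x; apply/eqP; rewrite -subr_eq0; apply/eqP.
pose h := lsub g (lcomp d v).
apply: (ess (range h) (submodule_range h)); last by exists x.
move=> _ [n _ <-] [y _ hy]; have : range i y.
  rewrite iE /=; exists (n + v y) => //; rewrite linearD -hy /=.
  by rewrite subrK.
by case=> z _ zE; rewrite -hy /= -zE vE sE subrr.
Qed.

End Presentations.

(** * Torsion theories *)

Section Generation.
Variable S : pzRingType.
Implicit Types X Y Z T : lmodType S.

(** The composite of the coproduct with Z -> Z/K vanishes on each summand, hence is 0 by the
    uniqueness clause of the universal property. *)
Lemma generates_span X (XX : lmodType S -> Prop) Z (K : set Z) :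
  generates X XX -> XX Z -> submodule K ->
  (forall (f : {linear X -> Z}) x, K (f x)) -> forall z, K z.
Proof.
move=> gen /gen[J [T [inc [p [cop sp]]]]] sK fK z.
have [W [w [sw wE]]] := quotient_type sK.
have [g [_ gu]] := cop W (fun j => lzero X W).
have [t <-] := sp z.
suff : kernel w (p t) by rewrite wE.
rewrite /kernel /=.
have -> : w (p t) = g t.
  apply: (gu (lcomp w p)) => j x /=.
  have : kernel w (p (inc j x)); last by [].
  by rewrite wE; apply: (fK (lcomp p (inc j))).
by rewrite -(gu (lzero T W)).
Qed.

Lemma cogenerates_eq0 Y (YY : lmodType S -> Prop) Z (z : Z) :
  cogenerates Y YY -> YY Z -> (forall f : {linear Z -> Y}, f z = 0) -> z = 0.
Proof.
move=> cogen /cogen[J [T [pr [i [prod ii]]]]] fz; apply: ii; rewrite linear0.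
have [g [_ gu]] := prod (S^o : lmodType S) (fun j => lzero (S^o : lmodType S) Y).
(* Elements of the product are seen by the universal property as maps from the regular module, here
   the one sending 1 to i z. *)
pose h := mklinear (scale_regular_linear (i z)).
have -> : i z = h 1 by rewrite /= scale1r.
rewrite gu => [|j x]; first by rewrite -(gu (lzero (S^o : lmodType S) T)) // => j
  x /=; rewrite linear0.
by rewrite /= linearZ /= -[pr j (i z)]/(lcomp (pr j) i z) fz scaler0.
Qed.

Variables (XX YY : lmodType S -> Prop).
Hypothesis hXY : torsion_theory XX YY.

Lemma torsion_quotient Z Z' (p : {linear Z -> Z'}) : surj p -> XX Z -> XX Z'.
Proof. by have [_ _ h _ _] := hXY; apply: h. Qed.

Lemma torsion_sub Z Z' (i : {linear Z' -> Z}) :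
  finitely_generated Z' -> injective i -> YY Z -> YY Z'.
Proof. by have [_ _ _ h _] := hXY; apply: h. Qed.

Lemma torsion_fg Z : XX Z -> finitely_generated Z.
Proof. by have [[h _] _ _ _ _] := hXY; apply: h. Qed.

Lemma torsion_free_fg Z : YY Z -> finitely_generated Z.
Proof. by have [[_ h] _ _ _ _] := hXY; apply: h. Qed.

Lemma torsion_hom0 Z (W : lmodType S) (f : {linear Z -> W}) : XX Z -> YY W ->
  forall z, f z = 0.
Proof.
move=> XZ YW z; have [V [i [ii iE]]] := submodule_type (submodule_range f).
have [|h hE] := factor_inj (g := f) ii; first by rewrite iE.
have sh : surj h.
  move=> v; have : range f (i v) by rewrite -iE; exists v.
  by case=> x _ xE; exists x; apply: ii; rewrite hE.
have XV := torsion_quotient sh XZ.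
have YV : YY V by apply: (torsion_sub _ ii) => //; apply: torsion_fg.
have [_ h0 _ _ _] := hXY.
by rewrite -hE (proj1 (h0 V) (conj XV YV) (h z)) linear0.
Qed.

Lemma torsion_of_hom0 Z : finitely_generated Z ->
  (forall (W : lmodType S) (f : {linear Z -> W}), YY W -> forall z, f z = 0) ->
    XX Z.
Proof.
move=> fgZ h0; have [_ _ _ _ /(_ Z fgZ)[Z' [Z'' [i [p [[ii ip sp] XZ' YZ'']]]]]]
  := hXY.
apply: (torsion_quotient (p := i)) => // z.
by have : kernel p z by [apply: h0]; rewrite -ip => -[y _ yE]; exists y.
Qed.

Lemma torsion_free_of_hom0 X Z : generates X XX -> finitely_generated Z ->
  (forall (f : {linear X -> Z}) x, f x = 0) -> YY Z.
Proof.
move=> gen fgZ h0; have [_ _ _ _ /(_ Z fgZ)[Z'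
  [Z'' [i [p [[ii ip sp] XZ' YZ'']]]]]] := hXY.
apply: (torsion_sub (i := p)) => //; apply: kernel0_inj => z pz.
have : kernel p z by [].
rewrite -ip => -[y _ <-].
have : kernel i y; last by [].
apply: (generates_span gen XZ' (submodule_kernel i)) => f x.
exact: (h0 (lcomp i f)).
Qed.

Lemma torsion_of_hom0_cogenerator Y Z : cogenerates Y YY -> finitely_generated Z ->
  (forall (f : {linear Z -> Y}) z, f z = 0) -> XX Z.
Proof.
move=> cogen fgZ h0; apply: torsion_of_hom0 => // W f YW z.
apply: (cogenerates_eq0 cogen YW) => g.
exact: (h0 (lcomp g f)).
Qed.

End Generation.

(** * The two-term complex of a torsion theory *)

Section TorsionTheory.
Variables (R : comPzRingType) (A : algType R).
Hypothesis hR : artinian R^o.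
Hypothesis hA : @finitely_generated R A.
Variables (I : lmodType R) (e : {linear R^o -> I}).
Hypothesis hI : injective_envelope e (@jacobson_radical R).
Implicit Types U V Z : lmodType A.
Local Notation DA := (dual_bimodule A I).
Local Notation Nak N := (hom_mod DA N : lmodType A).

(* Contracting f : P1 -> DA (x) Z against h : Z -> P1 along the dual basis of
   P1 gives an element of I which vanishes for maps f factoring through d; it
   recovers h when f ranges over the maps of rank one. *)
Lemma tensor_factor_eq0 Z (P1 P0 T : lmodType A) (t : DA -> Z -> T)
    (d : {linear P1 -> P0}) (h : {linear Z -> P1}) :
  finitely_generated P1 -> projective P1 ->
  finitely_generated P0 -> projective P0 ->
  tensor_product t ->
  (forall f : {linear P1 -> T}, exists g : {linear P0 -> T},
     forall x, f x = g (d x)) ->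
  (forall z, d (h z) = 0) -> forall z, h z = 0.
Proof.
move=> fg1 pr1 fg0 pr0 tT fac dh z.
have [n [p [a pa]]] := projective_dual_basis fg1 pr1.
have [n' [p' [a' pa']]] := projective_dual_basis fg0 pr0.
have /choice[c cE] (k : 'I_n) : exists c : {linear T -> DA},
    forall b y, c (t b y) = ract b (a k (h y) : A).
  apply: (tensor_lift tT) => [|s b y]; last exact: ractZl.
  split=> [b b' y|b y y'|b s y]; first exact: ractDl.
    by rewrite !linearD ractDr.
  by rewrite -ractM !linearZ.
have contract0 (f : {linear P1 -> T}) : \sum_k dual_ev (c k (f (p k))) 1 = 0.
  have [g gE] := fac f.
  transitivity (\sum_k \sum_l dual_ev (c k (g (p' l))) (a' l (d (p k)))).
    apply: eq_bigr => k _; rewrite gE {1}[d _]pa' linear_sum [c k _]linear_sum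
      dual_ev_sum.
    by apply: eq_bigr => l _; rewrite !linearZ dual_evZ mul1r.
  rewrite exchange_big big1 // => l _; move: (g (p' l)).
  apply: (tensor_eq0 tT) => [x y|b y].
    rewrite -sumrB; apply: eq_bigr => k _.
    rewrite linearB; exact: (linearB (mklinear (dual_ev_linear (I := I) _))
      (c k x) (c k y)).
  transitivity (dual_ev b (a' l (d (h y)))); last first.
    by rewrite dh linear0; exact: (linear0 (mklinear (dual_ev_linearr b))).
  rewrite [h y in RHS]pa !linear_sum dual_ev_sumr; apply: eq_bigr => k _ /=.
  by rewrite cE dual_ev_ract !linearZ.
rewrite [LHS]pa big1 // => k _; suff -> : a k (h z) = 0 by rewrite scale0r.
apply: (dual_separates hR hI) => b.
have rl : linear (fun x => (a k x : A) *: t b z).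
  by move=> s x y; rewrite linearP scalerDl -scalerA.
rewrite -[RHS](contract0 (mklinear rl)) [h z in LHS]pa linear_sum dual_ev_sumr.
apply: eq_bigr => j _ /=.
by rewrite !linearZ cE dual_evZ mul1r dual_ev_ract.
Qed.

Variables (XX YY : lmodType A -> Prop).
Hypothesis hXY : torsion_theory XX YY.
Variables (X Y : lmodType A).
Hypotheses (hX : XX X) (projX : Ext_projective X XX) (genX : generates X XX).
Hypotheses (hY : YY Y) (injY : Ext_injective Y YY) (cogenY : cogenerates Y YY).
Hypothesis stabX : stable_under_tensor DA XX.
Variables (M N : complex A).
Hypothesis hM : minimal_projective_presentation M X.
Hypothesis hN : minimal_injective_presentation N Y.

Local Notation P := (direct_sum M (shift (hom_complex DA N) 1)).
Local Notation dM := (diff M (-1) 0).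
Local Notation dN := (diff N 0 1).
Local Notation dQ := (mklinear (@hom_post_linear A A DA (N 0) (N 1) dN)).

Lemma presentation_torsion Z (f : {linear M (-1) -> Z}) :
  XX Z -> exists v : {linear M 0 -> Z}, forall x, f x = v (dM x).
Proof.
move=> XZ; have [_ fgM [p [[pr0 rp _] [_ rd sd]]]] := hM.
apply: (presentation_factor (X := X) (p := p)) => //.
- by move=> y; have : range p y by [rewrite rp]; case=> x _ <-; exists x.
- exact: torsion_fg hXY _ XZ.
by move=> Z' q sq; apply: projX; apply: torsion_quotient hXY _ _ q sq XZ.
Qed.

Lemma copresentation_torsion_free Z (g : {linear Z -> N 1}) :
  YY Z -> exists v : {linear Z -> N 0}, forall x, g x = dN (v x).
Proof.
move=> YZ; have [_ fgN [q [[inj0 kq _] [_ kd ed]]]] := hN.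
have fgZ := torsion_free_fg hXY YZ.
apply: (copresentation_factor (Y := Y) (q := q)) => //.
- apply: kernel0_inj => y qy; have : kernel q y by [].
  by rewrite kq.
- by move=> E i ii; apply: (fg_sub hR hA hI ii); apply: fg_pair.
move=> Z' i ii; apply: injY; apply: (torsion_sub hXY _ ii) => //.
exact: (fg_sub hR hA hI ii).
Qed.

(** By duality the factorization says that maps Z -> N^0 killed by [dN] vanish. The kernel of [dN]
    is Y, so this means Hom(Z, Y) = 0, which detects XX because Y cogenerates YY. *)
Lemma nak_torsion Z : finitely_generated Z ->
  XX Z <-> forall f : {linear Nak (N 0) -> Z},
    exists g : {linear Nak (N 1) -> Z}, forall x, f x = g (dQ x).
Proof.
move=> fgZ; have [_ fgN [q [[inj0 kq _] [inj1 kd ed]]]] := hN.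
rewrite (nak_factor_injective hR hA hI) //.
have iq : injective q.
  by apply: kernel0_inj => y qy; have : kernel q y by []; rewrite kq.
split=> [XZ h dh z|h0].
  have [|g gE] := factor_inj (g := h) iq.
    by rewrite -kd => _ [y _ <-]; apply: dh.
  by rewrite -gE (torsion_hom0 hXY g XZ hY) linear0.
apply: (torsion_of_hom0_cogenerator hXY cogenY fgZ) => f z.
apply: iq; rewrite linear0; apply: (h0 (lcomp q f)) => y /=.
by have : kernel dN (q (f y)) by rewrite kd; exists (f y).
Qed.

Lemma nak_torsion_free Z : YY Z -> forall f : {linear Nak (N 1) -> Z},
  (forall x, f (dQ x) = 0) -> forall x, f x = 0.
Proof.
move=> YZ; have [_ fgN [q [[inj0 _ _] [inj1 _ _]]]] := hN.
by apply: (nak_factor_surjective hR hA hI) => // g;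
  apply: copresentation_torsion_free.
Qed.

Lemma two_term_diff (x : M (-1)) (y : Nak (N 0)) :
  diff P (-1) 0 (x, y) = (dM x, - dQ y) :> P 0.
Proof. by []. Qed.

Lemma two_term_torsion Z : finitely_generated Z ->
  XX Z <-> forall f : {linear P (-1) -> Z},
    exists g : {linear P 0 -> Z}, forall x, f x = g (diff P (-1) 0 x).
Proof.
move=> fgZ; split=> [XZ f|fac].
  have [g1 g1E] := presentation_torsion (lcomp f
    (linl (M (-1)) (Nak (N 0)))) XZ.
  have [g2 g2E] := (nak_torsion fgZ).1 XZ (lcomp f
    (linr (M (-1)) (Nak (N 0)))).
  exists (lcopair g1 (lopp g2)) => -[x y].
  rewrite [LHS](@pair_split _ (M (-1)) (Nak (N 0)) Z f x y).
  have /= -> := g1E x; have /= -> := g2E y; congr (_ + _).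
  by rewrite linearN opprK.
apply/(nak_torsion fgZ) => f.
have [g gE] := fac (lcomp f (lsnd (M (-1)) (Nak (N 0)))).
exists (lopp (lcomp g (linr (M 0) (Nak (N 1))))).
move=> x /=; have /= -> := gE (0, x); rewrite -linearN; congr (g _).
by congr pair; rewrite /= ?linear0 ?oppr0.
Qed.

Lemma two_term_torsion_free Z : finitely_generated Z ->
  YY Z <-> forall g : {linear P 0 -> Z},
    (forall x, g (diff P (-1) 0 x) = 0) -> forall x, g x = 0.
Proof.
have [_ _ [p [[_ rp _] [_ rd _]]]] := hM.
move=> fgZ; split=> [YZ g gd [x y]|h0].
  rewrite [LHS](@pair_split _ (M 0) (Nak (N 1)) Z g x y).
  have [||k kE] := factor_surj (p := p) (g := lcomp g
    (linl (M 0) (Nak (N 1)))).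
  - by move=> z; have : range p z by [rewrite rp]; case=> u _ <-; exists u.
  - rewrite -rd => _ [u _ <-]; rewrite /kernel /=.
    by have := gd (u, 0); rewrite two_term_diff linear0 oppr0.
  have /= <- := kE x; rewrite (torsion_hom0 hXY k hX YZ) add0r.
  apply: (nak_torsion_free YZ (f := lcomp g
    (linr (M 0) (Nak (N 1))))) => u /=.
  by have := gd (0, - u); rewrite two_term_diff linear0 linearN opprK.
apply: (torsion_free_of_hom0 hXY genX fgZ) => f x.
have : range p x by rewrite rp.
case=> u _ <-.
apply: (h0 (lcomp f (lcomp p
  (lfst (M 0) (Nak (N 1))))) _ (u, 0)) => -[v w] /=.
by have : kernel p (dM v) by [rewrite -rd; exists v]; rewrite /kernel /= => ->;
  rewrite linear0.
Qed.

(** Here T = DA (x) Z lies in XX. The M-component of h vanishes because maps M^-1 -> T factor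
    through M^0. The other component corresponds to a map T -> ker [dN] = Y, which is 0 by
    torsion. *)
Lemma two_term_cycles Z (h : {linear Z -> P (-1)}) :
  XX Z -> (forall z, diff P (-1) 0 (h z) = 0) -> forall z, h z = 0.
Proof.
move=> XZ dh z.
have [T [t tT]] := tensor_product_exists DA (torsion_fg hXY XZ).
have XT := stabX tT XZ.
have [_ fgM [p [[pr0 _ _] [pr1 _ _]]]] := hM.
have [_ fgN [q [[inj0 kq _] [inj1 kd ed]]]] := hN.
rewrite [h z]surjective_pairing; congr pair.
  apply: (tensor_factor_eq0 (d := dM) (h := lcomp (lfst (M (-1)) (Nak (N 0))) h)
    _ _ _ _ tT) => //.
    by move=> f; apply: presentation_torsion.
  by move=> y /=; have := congr1 fst (dh y).
apply: linear_ext => b.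
have dh2 y c : dN (((h y).2 : hom_mod DA (N 0)) c) = 0.
  have /(congr1 (fun g : hom_mod DA (N 1) => - g c)) := congr1 snd (dh y).
  by rewrite /= opprK oppr0.
have [|s b' y|g gE] := tensor_lift tT
  (u := fun b y => ((h y).2 : hom_mod DA (N 0)) b).
- split=> [c c' y|c y y'|c a y] /=; first exact: linearD.
    by rewrite linearD.
  by rewrite linearZ.
- exact: linearZ_LR.
have dg x : dN (g x) = 0.
  apply: (tensor_eq0 tT (g := fun x => dN (g x))) => [u v|c y].
    by rewrite !linearB.
  by rewrite gE dh2.
have iq : injective q.
  by apply: kernel0_inj => y qy; have : kernel q y by []; rewrite kq.
have [|k kE] := factor_inj (g := g) iq.
  by rewrite -kd => _ [y _ <-]; apply: dg.
by rewrite -gE -kE (torsion_hom0 hXY k XT hY) linear0.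
Qed.

(** H^0(P) generates XX because X is a quotient of it: M^0 -> X, extended by 0 on the second
    summand, kills the boundaries. *)
Lemma two_term_span Z (K : set Z) : XX Z -> submodule K ->
  (forall g : {linear P 0 -> Z}, (forall x, g (diff P (-1) 0 x) = 0) ->
     forall x, K (g x)) -> forall z, K z.
Proof.
move=> XZ sK gK; have [_ _ [p [[_ rp _] [_ rd _]]]] := hM.
apply: (generates_span genX XZ sK) => f x.
have : range p x by rewrite rp.
case=> u _ <-.
apply: (gK (lcomp f (lcomp p
  (lfst (M 0) (Nak (N 1))))) _ (u, 0)) => -[v w] /=.
by have : kernel p (dM v) by [rewrite -rd; exists v]; rewrite /kernel /= => ->;
  rewrite linear0.
Qed.

Lemma two_term_zero (i : int) : i != -1 -> i != 0 -> is_zero (P i).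
Proof.
have [M0 _ _] := hM; have [N0 _ _] := hN => i1 i0 [x y].
congr pair; first exact: M0.
apply: linear_ext => b; apply: N0; first by rewrite addr_eq0.
by rewrite -subr_eq0 addrK.
Qed.

Lemma two_term_fg_projective i : finitely_generated (P i) /\ projective (P i).
Proof.
have [_ fgM [p [[pr0 rp _] [pr1 rd _]]]] := hM.
have [_ fgN [q [[inj0 kq _] [inj1 kd ed]]]] := hN.
have [->|i1] := eqVneq i (-1).
  have [fgQ prQ] := nak_fg_projective hR hA hI (fgN 0) inj0.
  by split; [apply: fg_pair|apply: projective_pair].
have [->|i0] := eqVneq i 0.
  have [fgQ prQ] := nak_fg_projective hR hA hI (fgN 1) inj1.
  by split; [apply: fg_pair|apply: projective_pair].
by have Pi := two_term_zero i1 i0; split; [apply: fg_zero|apply: projective_zero].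
Qed.

End TorsionTheory.

(** * Homotopies and morphisms of the derived category *)

Section Homotopy.
Variable A : pzRingType.
Implicit Types C D E T : complex A.

Lemma homotopic_eq C E (f g : chain_map C E) :
  (forall i x, f i x = g i x) -> homotopic f g.
Proof.
move=> fg; exists (fun i j => lzero _ _) => i x /=.
by rewrite fg subrr linear0 addr0.
Qed.

Lemma homotopic_sym C E (f g : chain_map C E) : homotopic f g -> homotopic g f.
Proof.
move=> [h hE]; exists (fun i j => lopp (h i j)) => i x /=.
by rewrite -[LHS]opprB hE opprD linearN.
Qed.

Lemma homotopic_trans C E (f g k : chain_map C E) :
  homotopic f g -> homotopic g k -> homotopic f k.
Proof.
move=> [h hE] [h' h'E].
exists (fun i j => ladd (h i j) (h' i j)) => i x /=.
have -> : f i x - k i x = (f i x - g i x) + (g i x - k i x) by rewrite addrA subrK.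
by rewrite hE h'E linearD addrACA.
Qed.

Lemma homotopic_compl C D E (k : chain_map D E) (f g : chain_map C D) :
  homotopic f g -> homotopic (comp_map k f) (comp_map k g).
Proof.
move=> [h hE]; exists (fun i j => lcomp (k j) (h i j)) => i x /=.
by rewrite -linearB hE linearD cmap_diff.
Qed.

Lemma homotopic_compr C D E (k : chain_map C D) (f g : chain_map D E) :
  homotopic f g -> homotopic (comp_map f k) (comp_map g k).
Proof.
move=> [h hE]; exists (fun i j => lcomp (h i j) (k i)) => i x /=.
by rewrite hE -cmap_diff.
Qed.

Lemma homotopic_id_quasi_iso C (f : chain_map C C) :
  homotopic f (id_map C) -> quasi_iso f.
Proof.
move=> [h hE] i; split=> [x dx [z _ zE]|y dy].
  exists (z - h i (i - 1) x) => //; rewrite linearB zE.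
  have := hE i x; rewrite /= dx linear0 addr0 => <-.
  by rewrite opprB addrC subrK.
exists y => //; exists (- h i (i - 1) y) => //; rewrite linearN.
by have := hE i y; rewrite /= dy linear0 addr0 => <-; rewrite opprB.
Qed.

Section TwoTerm.
Variable P : complex A.
Hypothesis P0 : forall i : int, i != -1 -> i != 0 -> is_zero (P i).

Lemma diff_last (x : P 0) : diff P 0 1 x = 0.
Proof. exact: (P0 (i := 1)). Qed.

Lemma chain_map_build T (t1 : {linear P (-1) -> T (-1)})
  (t0 : {linear P 0 -> T 0}) :
  (forall x, t0 (diff P (-1) 0 x) = diff T (-1) 0 (t1 x)) ->
  (forall x, diff T 0 1 (t0 x) = 0) ->
  exists f : chain_map P T, (forall x, f (-1) x = t1 x) /\ (forall x, f 0 x = t0 x).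
Proof.
move=> t10 dt0.
(* Matching on the constructors of [int], where [Negz 0] is -1 and [Negz 1] is -2, gives each
   component its type without casts. *)
pose f i : {linear P i -> T i} :=
  match i as k return {linear P k -> T k} with
  | Posz 0 => t0 | Negz 0 => t1 | _ => lzero _ _ end.
have fd i j x : f j (diff P i j x) = diff T i j (f i x).
  have [->|ji] := eqVneq j (i + 1); last by rewrite !diff_shape ?linear0.
  have [i1|i1] := eqVneq i (-1); first by subst i; exact: t10.
  have [i0|i0] := eqVneq i 0.
    subst i; have -> : diff P 0 (0 + 1) x = 0 by exact: diff_last.
    by rewrite linear0; exact: esym (dt0 x).
  by rewrite (P0 i1 i0 x) !linear0.
by exists (ChainMap fd).
Qed.

Lemma homotopic_build T (f g : chain_map P T)
    (h1 : {linear P (-1) -> T (-2)}) (h0 : {linear P 0 -> T (-1)}) :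
  (forall x, f (-1) x - g (-1) x =
     diff T (-2) (-1) (h1 x) + h0 (diff P (-1) 0 x)) ->
  (forall x, f 0 x - g 0 x = diff T (-1) 0 (h0 x)) -> homotopic f g.
Proof.
move=> E1 E0.
pose h i j : {linear P i -> T j} :=
  match i as k, j as l return {linear P k -> T l} with
  | Negz 0, Negz 1 => h1 | Posz 0, Negz 0 => h0
  | _, _ => lzero _ _ end.
exists h => i x.
have [i1|i1] := eqVneq i (-1); first by subst i; exact: E1.
have [i0|i0] := eqVneq i 0.
  subst i; have -> : diff P 0 (0 + 1) x = 0 by exact: diff_last.
  rewrite linear0 addr0.
  exact: E0.
by rewrite (P0 i1 i0 x) !linear0.
Qed.

Lemma homotopic_components T (f g : chain_map P T) : homotopic f g ->
  exists (h1 : {linear P (-1) -> T (-2)}) (h0 : {linear P 0 -> T (-1)}),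
    (forall x, f (-1) x - g (-1) x =
       diff T (-2) (-1) (h1 x) + h0 (diff P (-1) 0 x)) /\
    (forall x, f 0 x - g 0 x = diff T (-1) 0 (h0 x)).
Proof.
move=> [h hE]; exists (h (-1) (-2)), (h 0 (-1)); split=> x; first exact: hE.
rewrite [LHS]hE (P0 _ _ (diff P 0 (0 + 1) x)) // linear0 addr0.
by [].
Qed.

Hypothesis prP : forall i, projective (P i).

(** The section is built downwards from degree 0 with the projectivity of P. In degree 0 it exists
    up to a homotopy h0; in degree -1 no further homotopy is required, since P^-2 = 0. *)
Lemma quasi_iso_section T (s : chain_map T P) : quasi_iso s ->
  exists t : chain_map P T, homotopic (comp_map s t) (id_map P).
Proof.
move=> qs; set d := diff P (-1) 0.
have cocycle0 (x : P 0) : cocycle x by exact: diff_last.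
have [Z0 [z0 [iz0 z0E]]] := submodule_type (submodule_kernel (diff T 0 1)).
have [Z1 [z1 [iz1 z1E]]] := submodule_type (submodule_kernel (diff T (-1) 0)).
have dz0 y : diff T 0 1 (z0 y) = 0.
  by have : kernel (diff T 0 1) (z0 y) by rewrite -z0E; exists y.
have dz1 y : diff T (-1) 0 (z1 y) = 0.
  by have : kernel (diff T (-1) 0) (z1 y) by rewrite -z1E; exists y.
pose r := lcopair d (lcomp (s 0) z0).
have [|u uE] := @prP 0 _ _ r (lid (P 0)).
  move=> x; have [_ /(_ x (cocycle0 x))[y dy [w _ wE]]] := qs 0.
  have : range z0 y by rewrite z0E.
  case=> y' _ y'E; exists (w, y'); rewrite /= y'E.
  by have -> : d w = x - s 0 y by []; rewrite subrK.
have {}uE x : d (u x).1 + s 0 (z0 (u x).2) = x := uE x.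
pose t0 := lcomp z0 (lcomp (lsnd (P (-1)) Z0) u).
pose h0 := lcomp (lfst (P (-1)) Z0) u.
have t0E x : s 0 (t0 x) = x - d (h0 x).
  by apply/eqP; rewrite eq_sym subr_eq addrC; apply/eqP/esym/uE.
(* Injectivity on H^0: s sends [t0 (d x)] to the boundary of x - h0 (d x), so [t0 (d x)] is itself a
   boundary. *)
have [|t1' t1'E] := projective_lift (g := diff T (-1) 0)
    (f := lcomp t0 d) (@prP (-1)).
  move=> _ [x _ <-] /=; have [/(_ (t0 (d x)) (dz0 _))] := qs 0.
  move=> /(_ _)[|w _ wE _]; last by exists w.
  exists (x - h0 (d x)) => //; rewrite t0E.
  exact: (linearB d).
(* The defect of [t1'] in degree -1. Its values are cycles, and surjectivity on H^-1 lifts them to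
   cycles of T, by which [t1'] is corrected. *)
pose c := lsub (lsub (lid (P (-1)))
  (lcomp h0 d)) (lcomp (s (-1)) t1').
have cE x : c x = x - h0 (d x) - s (-1) (t1' x) by [].
have [|c' c'E] := projective_lift (g := lcomp (s (-1)) z1) (f := c) (@prP (-1)).
  move=> _ [x _ <-].
  have dc : cocycle (c x).
    have : d (c x) = 0; last by [].
    by rewrite cE !linearB /d -(cmap_diff s) t1'E /= t0E subrr.
  have [_ /(_ (c x) dc)[y dy [w _ wE]]] := qs (-1).
  have : range z1 y by rewrite z1E.
  case=> y' _ y'E; exists y' => //=; rewrite y'E; apply/esym/eqP.
  rewrite -subr_eq0 -wE; apply/eqP; rewrite (P0 _ _ w) ?linear0 //.
have [||t [tE1 tE0]] := @chain_map_build T (ladd t1'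
    (lcomp z1 c')) t0.
- by move=> x /=; rewrite linearD dz1 addr0 t1'E.
- by move=> x /=.
exists t; apply: (@homotopic_build _ _ _ (lzero _ _)
  (lopp h0)) => x /=.
  rewrite linear0 add0r tE1 /= linearD.
  have /= -> := c'E x; rewrite [_ + (_ - _)]addrC subrK.
  by rewrite addrAC subrr sub0r.
by rewrite tE0 t0E addrAC subrr sub0r linearN.
Qed.

Lemma derived_Hom_zeroP E :
  derived_Hom_zero P E <-> forall f : chain_map P E, homotopic f (zero_map P E).
Proof.
split=> [dH f|H0 r].
  have [T [t [t' [qt _ nt]]]] := dH (Roof f (@id_quasi_iso A P)).
  have [s sE] := quasi_iso_section qt.
  apply: (homotopic_trans (g := comp_map f (comp_map (comp_map (id_map P) t) s))).
    apply: (homotopic_trans (g := comp_map f (id_map P)));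
      first exact: homotopic_eq.
    exact/homotopic_compl/homotopic_sym.
  apply: (homotopic_trans (g := comp_map (comp_map (zero_map P E) t') s)).
    exact: (homotopic_trans (homotopic_eq _) (homotopic_compr s nt)).
  exact: homotopic_eq.
have [t tE] := quasi_iso_section (denom_quasi_iso r).
exists P, t, (comp_map (denom r) t); split.
- exact: homotopic_id_quasi_iso.
- exact: homotopic_eq.
- exact: homotopic_trans (H0 _) (homotopic_eq _).
Qed.

End TwoTerm.

End Homotopy.

(** * Vanishing of derived morphisms in terms of the differential of P *)

Section TwoTermHom.
Variable A : pzRingType.
Variable P : complex A.
Hypothesis P0 : forall i : int, i != -1 -> i != 0 -> is_zero (P i).
Hypothesis prP : forall i, projective (P i).
Local Notation d := (diff P (-1) 0).

Lemma zero_rV0 : is_zero ('rV[A]_0 : lmodType A).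
Proof. by move=> x; rewrite [x]thinmx0 [RHS]thinmx0. Qed.

Lemma is_zero_eq (V : lmodType A) (x y : V) : is_zero V -> x = y.
Proof. by move=> V0; rewrite (V0 x) (V0 y). Qed.

Lemma linear_from_zero (U V : lmodType A) (f : {linear U -> V}) :
  is_zero U -> forall x, f x = 0.
Proof. by move=> U0 x; rewrite (U0 x) linear0. Qed.

Lemma stalk_zero (Z : lmodType A) (i : int) : i != 0 -> is_zero (stalk Z i).
Proof. by rewrite /= => /negPf ->; exact: zero_rV0. Qed.

Lemma derived_Hom_zero_stalk (Z : lmodType A) :
  derived_Hom_zero P (stalk Z) <->
  forall g : {linear P 0 -> Z}, (forall x, g (d x) = 0) -> forall x, g x = 0.
Proof.
rewrite (derived_Hom_zeroP P0 prP); split=> [H0 g gd x|h0 f].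
  have [||f [_ fE]] := @chain_map_build A P P0 (stalk Z)
    (lzero _ _) g.
  - by move=> y; rewrite gd.
  - by [].
  have [h1 [h0 [_ /(_ x)]]] := homotopic_components P0 (H0 f).
  by rewrite fE subr0.
apply: (homotopic_build P0 (h1 := lzero _ _)
  (h0 := lzero _ _)) => x.
  exact: (is_zero_eq _ _ (@stalk_zero Z (-1) isT)).
rewrite /= subr0; apply: (h0 (f 0)) => y.
exact: (@cmap_diff _ _ _ f (-1) 0 y).
Qed.

Lemma derived_Hom_zero_stalk_shift (Z : lmodType A) :
  derived_Hom_zero P (shift (stalk Z) 1) <->
  forall f : {linear P (-1) -> Z}, exists g : {linear P 0 -> Z},
    forall x, f x = g (d x).
Proof.
rewrite (derived_Hom_zeroP P0 prP); split=> [H0 f|fac f].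
  have [||f' [fE _]] := @chain_map_build A P P0 (shift (stalk Z) 1) f
    (lzero _ _).
  - by move=> x; rewrite /= oppr0.
  - by move=> x; rewrite /= oppr0.
  have [h1 [h0 [hE _]]] := homotopic_components P0 (H0 f').
  exists h0 => x; have := hE x; rewrite fE /= subr0 => ->.
  by rewrite oppr0 add0r.
have [g gE] := fac (f (-1)).
apply: (@homotopic_build A P P0 (shift (stalk Z) 1) f (zero_map _ _)
  (lzero _ _) g) => x.
  by rewrite [f _ x]gE /= !oppr0 add0r addr0.
exact: (is_zero_eq _ _ (@stalk_zero Z 1 isT)).
Qed.

(** Only the shifts by 1 and -1 meet the support of P. A morphism P -> P[1] is one map P^-1 -> P^0,
    taken modulo s d + d w. A morphism P -> P[-1] is one map P^0 -> P^-1, and homotopies do not act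
    on it because they would end in degrees below -1. *)
Lemma derived_Hom_zero_shift :
  (forall u : {linear P (-1) -> P 0}, exists (s : {linear P 0 -> P 0})
     (w : {linear P (-1) -> P (-1)}), forall x, u x = s (d x) + d (w x)) ->
  (forall u : {linear P 0 -> P (-1)}, (forall x, u (d x) = 0) ->
     (forall x, d (u x) = 0) -> forall x, u x = 0) ->
  forall i : int, i != 0 -> derived_Hom_zero P (shift P i).
Proof.
move=> H1 Hm1 i i0; apply/(derived_Hom_zeroP P0 prP) => f.
have [i1|i1] := eqVneq i 1.
  subst i; have [s [w uE]] := H1 (f (-1)).
  apply: (@homotopic_build A P P0 (shift P 1) f (zero_map _ _)
    (lopp w) s) => x.
    by rewrite [f _ x]uE /= subr0 [diff P _ _ (- _)]linearN opprK; exact: addrC.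
  exact: (is_zero_eq _ _ (P0 (i := 1) isT isT)).
have [im1|im1] := eqVneq i (-1).
  subst i; have fz : forall x, f 0 x = 0.
    apply: (Hm1 (f 0)) => x.
      have fd := @cmap_diff _ _ _ f (-1) 0 x.
      rewrite [LHS]fd [f (-1) x](P0 (i := -2)) //.
      exact: linear0.
    have fd := @cmap_diff _ _ _ f 0 1 x.
    have : f 1 (diff P 0 1 x) = 0 by rewrite diff_last // linear0.
    by rewrite fd /= => /eqP; rewrite oppr_eq0 => /eqP.
  apply: (homotopic_build P0 (h1 := lzero _ _)
    (h0 := lzero _ _)) => x.
    exact: (is_zero_eq _ _ (P0 (i := -2) isT isT)).
  by rewrite fz /= subr0 linear0 oppr0.
have z1 : is_zero (P (-1 + i)).
  apply: P0; last by rewrite addrC subr_eq0.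
  by rewrite -subr_eq0 addrAC subrr add0r.
have z0 : is_zero (P (0 + i)) by rewrite add0r; apply: P0.
apply: (homotopic_build P0 (h1 := lzero _ _)
  (h0 := lzero _ _)) => x; exact: is_zero_eq.
Qed.

End TwoTermHom.

(** * Approximations by copies of a two-term complex *)

Section Copies.
Variable A : pzRingType.
Implicit Types (C E T : complex A) (U V W : lmodType A).

Lemma is_zero_pair U V : is_zero U -> is_zero V -> is_zero (U * V)%type.
Proof. by move=> U0 V0 [x y]; rewrite (U0 x) (V0 y). Qed.

Lemma fg_projective_zero U : is_zero U -> finitely_generated U /\ projective U.
Proof. by move=> U0; split; [exact: fg_zero|exact: projective_zero]. Qed.

Lemma projective_retract U V (i : {linear U -> V}) (r : {linear V -> U}) :
  (forall x, r (i x) = x) -> projective V -> projective U.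
Proof.
move=> ri prV X Y p f sp; have [g gE] := prV _ _ p (lcomp f r) sp.
by exists (lcomp g i) => x /=; rewrite gE /= ri.
Qed.

Lemma fg_projective_pair U V :
  finitely_generated U /\ projective U -> finitely_generated V /\ projective V ->
  finitely_generated (U * V)%type /\ projective (U * V)%type.
Proof.
by move=> [fU prU] [fV prV]; split; [exact: fg_pair|exact: projective_pair].
Qed.

Definition two_term_support C := forall i : int, i != -1 -> i != 0 -> is_zero (C i).

Lemma two_term_bounded C : two_term_support C -> bounded C.
Proof.
move=> C0; exists 1%N => i i1; apply: C0; apply: contraTneq i1 => ->; by [].
Qed.

Lemma stalk_zero_perfect : perfect (stalk ('rV[A]_0 : lmodType A)).
Proof.
have z i : is_zero (stalk ('rV[A]_0 : lmodType A) i).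
  by move=> x; move: x; rewrite /=; case: (i == 0); exact: zero_rV0.
by split=> [|i]; [exists 0%N => i _; exact: z|exact: fg_projective_zero].
Qed.

Lemma copies_zero n C i : is_zero (C i) -> is_zero (copies n C i).
Proof.
move=> Ci; elim: n => [|n IH]; last exact: is_zero_pair.
by rewrite /=; case: (i == 0); exact: zero_rV0.
Qed.

Lemma copies_fg_projective n C i : finitely_generated (C i) /\ projective (C i) ->
  finitely_generated (copies n C i) /\ projective (copies n C i).
Proof.
move=> Ci; elim: n => [|n IH]; last exact: fg_projective_pair.
by have [_] := stalk_zero_perfect; apply.
Qed.

Lemma copies_perfect n C : perfect C -> perfect (copies n C).
Proof.
move=> [[m C0] Ci]; split=> [|i]; last exact: copies_fg_projective.
by exists m => i /C0; exact: copies_zero.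
Qed.

(* With K1 -> K0 a subcomplex of V: every morphism U -> K[1] is homotopic to 0. *)
Definition hom1_zero U1 U0 (d : {linear U1 -> U0}) V1 V0 (dV : {linear V1 -> V0})
    (K1 : set V1) (K0 : set V0) :=
  forall u : {linear U1 -> V0}, (forall x, K0 (u x)) ->
    exists (s : {linear U0 -> V0}) (w : {linear U1 -> V1}),
      [/\ forall x, u x = s (d x) + dV (w x), forall x, K0 (s x) & forall x, K1
        (w x)].

Lemma hom1_zero_copies_source C V1 V0 (dV : {linear V1 -> V0}) K1 K0 n :
  submodule K1 -> submodule K0 ->
  hom1_zero (diff C (-1) 0) dV K1 K0 ->
  hom1_zero (diff (copies n C) (-1) 0) dV K1 K0.
Proof.
move=> sK1 sK0 h; have [k1 k1D _] := sK1; have [k0 k0D _] := sK0.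
elim: n => [|n IH] u uK.
  exists (lzero _ _), (lzero _ _).
  split=> // x; rewrite (linear_from_zero u) ?linear0 ?addr0 //.
  by move=> y; rewrite [y]thinmx0 [RHS]thinmx0.
have [s [w [uE sK wK]]] := h (lcomp u
  (linl (C (-1)) (copies n C (-1)))) (fun x => uK _).
have [s' [w' [u'E s'K w'K]]] := IH (lcomp u
  (linr (C (-1)) (copies n C (-1)))) (fun x => uK _).
exists (lcopair s s'), (lcopair w w').
split=> [[x y]|[x y]|[x y]] /=; [|exact: k0D|exact: k1D].
rewrite [u _](@pair_split _ (C (-1)) (copies n C (-1))).
by have /= -> := uE x; have /= -> := u'E y; rewrite linearD addrACA.
Qed.

Lemma hom1_zero_copies_target U1 U0 (d : {linear U1 -> U0}) C n :
  hom1_zero d (diff C (-1) 0) setT setT ->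
  hom1_zero d (diff (copies n C) (-1) 0) setT setT.
Proof.
move=> h; elim: n => [|n IH] u _.
  exists (lzero _ _), (lzero _ _).
  split=> // x; apply: (is_zero_eq (V := copies 0 C 0)).
  by move=> y; rewrite [y]thinmx0 [RHS]thinmx0.
have [s [w [uE _ _]]] := h (lcomp (lfst (C 0) (copies n C 0)) u) (fun=> Logic.I).
have [s' [w' [u'E _ _]]] := IH (lcomp (lsnd (C 0) (copies n C 0)) u)
  (fun=> Logic.I).
exists (lpair s s'), (lpair w w').
by split=> // x; rewrite [u x]surjective_pairing /=; have /= -> := uE x;
  have /= -> := u'E x.
Qed.

End Copies.

(** * Finiteness of Hom over R and approximations by copies of P *)

Section Approximation.
Variables (R : comPzRingType) (A : algType R).
Hypothesis hR : artinian R^o.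
Hypothesis hA : @finitely_generated R A.
Variables (I : lmodType R) (e : {linear R^o -> I}).
Hypothesis hI : injective_envelope e (@jacobson_radical R).
Implicit Types U V Z : lmodType A.
Local Notation res := restrict_scalars.

Lemma fg_ffun (S : pzRingType) (V : lmodType S) n : finitely_generated V ->
  finitely_generated ({ffun 'I_n -> V} : lmodType S).
Proof.
move=> [m [g gE]].
apply: (@fg_fin _ ({ffun 'I_n -> V} : lmodType S) ('I_n * 'I_m)%type
  (fun kj => [ffun l => if l == kj.1 then g kj.2 else 0])) => x.
have [c cE] := choice (fun k => gE (x k)).
exists (fun kj => c kj.1 kj.2).
rewrite -(pair_bigA _ (fun k j => c k j *:
  ([ffun l => if l == k then g j else 0] : {ffun 'I_n -> V}))) /=.
apply/ffunP => l; rewrite sum_ffunE (bigD1 l) //= [X in _ + X]big1 ?addr0 =>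
  [|k kl].
  by rewrite {1}cE sum_ffunE; apply: eq_bigr => j _; rewrite !ffunE eqxx.
by rewrite sum_ffunE big1 // => j _; rewrite !ffunE eq_sym (negPf kl) scaler0.
Qed.

(* Linear maps U -> V are determined by the images of generators of U, so that
   they form a submodule of a power of the noetherian R-module V. *)
Lemma fg_linear_maps U V (H : {linear U -> V} -> Prop) :
  finitely_generated U -> finitely_generated V ->
  (forall f : {linear U -> V}, (forall x, f x = 0) -> H f) ->
  (forall f g h : {linear U -> V}, (forall x, h x = f x + g x) -> H f -> H g ->
    H h) ->
  (forall (r : R) (f h : {linear U -> V}), (forall x, h x = (r%:A : A) *: f x) ->
     H f -> H h) ->
  exists m (f : 'I_m -> {linear U -> V}), (forall j, H (f j)) /\
    forall g, H g -> exists r : 'I_m -> R,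
      forall x, g x = \sum_j ((r j)%:A : A) *: f j x.
Proof.
move=> [n [u uE]] fgV H0 HD HZ.
pose F := {ffun 'I_n -> res V} : lmodType R.
pose ev (f : {linear U -> V}) : F := [ffun k => f (u k)].
have sK : submodule [set v : F | exists2 f, H f & v = ev f].
  split=> [|_ _ [f Hf ->] [g Hg ->]|r _ [f Hf ->]] /=.
  - exists (lzero U V); first exact: H0.
    by apply/ffunP => k; rewrite !ffunE.
  - exists (ladd f g); first exact: (HD f g).
    by apply/ffunP => k; rewrite !ffunE.
  - exists (lcomp (mklinear (@scale_R_ract_linear R A V r)) f).
      exact: (HZ r f).
    by apply/ffunP => k; rewrite !ffunE.
have [K [i [ii iE]]] := submodule_type sK.
have [m [v vE]] : finitely_generated K.
  apply: (finite_length_noetherian _ ii); apply: (finite_length_fg hR hI).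
  exact/fg_ffun/fg_restrict.
have /choice[f fE] (j : 'I_m) : exists f, H f /\ i (v j) = ev f.
  have : range i (i (v j)) by exists (v j).
  by rewrite iE => -[f Hf fE]; exists f.
exists m, f; split=> [j|g Hg]; first by have [] := fE j.
have : range i (ev g) by rewrite iE; exists g.
case=> k _ kE; have [r rE] := vE k; exists r => x; have [c ->] := uE x.
rewrite linear_sum (eq_bigr (fun l => \sum_j c l *: (((r j)%:A : A) *: f j (u l)))).
  rewrite exchange_big; apply: eq_bigr => j _.
  rewrite linear_sum scaler_sumr; apply: eq_bigr => l _.
  by rewrite linearZ /= !scalerA mulr_algl mulr_algr.
move=> l _; rewrite linearZ -scaler_sumr; congr (_ *: _).
have -> : g (u l) = ev g l by rewrite ffunE.
rewrite -kE rE linear_sum sum_ffunE; apply: eq_bigr => j _.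
by rewrite linearZ ffunE (proj2 (fE j)) ffunE.
Qed.

(** The combined map of the f_j receives every R-linear combination of them: R acts centrally, so
    the scalars r_j define a chain map P -> P^m. *)
Lemma copies_map (P T : complex A) m (f : 'I_m -> chain_map P T) :
  exists pi : chain_map (copies m P) T, forall r : 'I_m -> R,
    exists g : chain_map P (copies m P), forall i x,
      pi i (g i x) = \sum_j ((r j)%:A : A) *: f j i x.
Proof.
elim: m f => [|m IH] f.
  exists (zero_map _ _) => r; exists (zero_map _ _) => i x /=.
  by rewrite big_ord0.
have [pi piE] := IH (fun j => f (lift ord0 j)).
have pd i j x : lcopair (f ord0 j) (pi j) (diff (copies m.+1 P) i j x) =
    diff T i j (lcopair (f ord0 i) (pi i) x).
  by rewrite /= !cmap_diff linearD.
exists (ChainMap pd) => r; have [g gE] := piE (fun j => r (lift ord0 j)).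
have gd i j x : lpair (mklinear (@scale_R_ract_linear R A (P j) (r ord0))) (g j)
    (diff P i j x) = diff (copies m.+1 P) i j
      (lpair (mklinear (@scale_R_ract_linear R A (P i) (r ord0))) (g i) x).
  by rewrite /= cmap_diff linearZ.
exists (@ChainMap _ P (copies m.+1 P) _ gd) => i x /=.
by rewrite big_ord_recl gE linearZ.
Qed.

Lemma copies_approximation (P T : complex A) :
  two_term_support P ->
  finitely_generated (P (-1)) -> finitely_generated (P 0) ->
  finitely_generated (T (-1)) -> finitely_generated (T 0) ->
  exists m (pi : chain_map (copies m P) T), forall f : chain_map P T,
    exists g : chain_map P (copies m P), forall i x, f i x = pi i (g i x).
Proof.
move=> P0 fgP1 fgP0 fgT1 fgT0.
(* A chain map is encoded as one block-diagonal linear map, so that chain maps form an R-submodule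
   of a Hom module between finitely generated modules. *)
pose H (f : {linear (P (-1) * P 0)%type -> (T (-1) * T 0)%type}) :=
  exists c : chain_map P T, forall x, f x = (c (-1) x.1, c 0 x.2).
have [|||||m [f [fH fE]]] := @fg_linear_maps (P (-1) * P 0)%type
  (T (-1) * T 0)%type H.
- exact: fg_pair.
- exact: fg_pair.
- by move=> f f0; exists (zero_map P T) => x; rewrite f0.
- move=> f g h hE [c cE] [c' c'E].
  have dd i j x : ladd (c j) (c' j) (diff P i j x) =
      diff T i j (ladd (c i) (c' i) x).
    by rewrite /= !cmap_diff linearD.
  by exists (ChainMap dd) => x; rewrite hE cE c'E.
- move=> r f h hE [c cE].
  have dd i j x : lcomp (mklinear (@scale_R_ract_linear R A (T j) r)) (c j)
      (diff P i j x) =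
      diff T i j (lcomp (mklinear (@scale_R_ract_linear R A (T i) r)) (c i) x).
    by rewrite /= !cmap_diff linearZ.
  by exists (ChainMap dd) => x; rewrite hE cE.
have [c cE] := choice fH.
have [pi piE] := copies_map c.
exists m, pi => g.
have gl : linear (fun x : (P (-1) * P 0)%type => (g (-1) x.1, g 0 x.2) :
  (T (-1) * T 0)%type).
  by move=> a x y; rewrite !linearP.
have [|r rE] := fE (mklinear gl); first by exists g.
have [h hE] := piE r; exists h => i x; rewrite hE.
have sum1 (u : 'I_m -> T (-1)) (v : 'I_m -> T 0) :
    \sum_j ((u j, v j) : (T (-1) * T 0)%type) = (\sum_j u j, \sum_j v j).
  by elim/big_rec3: _ => // j y1 y2 y3 _ ->.
have rE' y z : (g (-1) y, g 0 z) = (\sum_j ((r j)%:A : A) *: c j (-1) y,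
    \sum_j ((r j)%:A : A) *: c j 0 z).
  rewrite -sum1; have /= -> := rE (y, z).
  by apply: eq_bigr => j _; rewrite cE.
have [i1|i1] := eqVneq i (-1); first by subst i; case: (rE' x 0).
have [i0|i0] := eqVneq i 0; first by subst i; case: (rE' 0 x).
rewrite (P0 i i1 i0 x) linear0 big1 // => j _.
by rewrite linear0 scaler0.
Qed.

End Approximation.

(** * Two-term complexes and direct summands of copies of P *)

Section TwoTermComplex.
Variable A : pzRingType.
Implicit Types (C E T : complex A) (U V W : lmodType A).

Section Build.
Variables (U V : lmodType A) (d : {linear U -> V}).

Definition two_term_obj (i : int) : lmodType A :=
  match i with Posz 0 => V | Negz 0 => U | _ => 'rV[A]_0 end.

Definition two_term_map (i j : int) : {linear two_term_obj i -> two_term_obj j} :=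
  match i as k, j as l return {linear two_term_obj k -> two_term_obj l} with
  | Negz 0, Posz 0 => d | _, _ => lzero _ _ end.

Lemma two_term_obj_zero (i : int) : i != -1 -> i != 0 -> is_zero (two_term_obj i).
Proof. by case: i => [[|i]|[|i]] // _ _; exact: zero_rV0. Qed.

Fact two_term_shape i j : j != i + 1 -> forall x, two_term_map i j x = 0.
Proof. by case: i j => [[|i]|[|i]] [[|j]|[|j]]. Qed.

Fact two_term_dd i j k x : two_term_map j k (two_term_map i j x) = 0.
Proof.
case: i j k x => [[|i]|[|i]] [[|j]|[|j]] [[|k]|[|k]] x //=; exact: linear0.
Qed.

Definition two_term : complex A := Complex two_term_shape two_term_dd.

Lemma two_term_perfect :
  finitely_generated U /\ projective U -> finitely_generated V /\ projective V ->
  perfect two_term.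
Proof.
move=> hU hV; split; first exact: (two_term_bounded (C := two_term)
  two_term_obj_zero).
by case=> [[|i]|[|i]] //; apply: fg_projective_zero; exact: zero_rV0.
Qed.

End Build.

Lemma homotopy_equivalent_iso C E (f : chain_map C E) (g : chain_map E C) :
  (forall i x, g i (f i x) = x) -> (forall i x, f i (g i x) = x) ->
  homotopy_equivalent C E.
Proof. by move=> gf fg; exists f, g; split; exact: homotopic_eq. Qed.

Lemma in_add_copies (P : complex A) n : perfect P -> in_add P (copies n P).
Proof.
move=> prP; split; first exact: copies_perfect.
pose O := stalk ('rV[A]_0 : lmodType A).
exists n, O; split; first exact: stalk_zero_perfect.
have fd i j x : lfst (copies n P j) (O j) (diff (direct_sum (copies n P) O) i j x)
  = diff (copies n P) i j (lfst (copies n P i) (O i) x) by [].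
have gd i j x : linl (copies n P j) (O j) (diff (copies n P) i j x)
  = diff (direct_sum (copies n P) O) i j (linl (copies n P i) (O i) x) by [].
apply: (@homotopy_equivalent_iso _ _
  (@ChainMap _ (direct_sum (copies n P) O) _ _ fd)
  (@ChainMap _ _ (direct_sum (copies n P) O) _ gd)) => //= i [x y].
congr pair; apply/esym; move: y; rewrite /=; case: (i == 0); exact: zero_rV0.
Qed.

(* The approximation pi becomes an epimorphism of complexes V -> C after adding
   to copies m P the contractible complex C^-1 -> C^-1.  The obstruction to
   splitting it lies in Hom(C, L[1]) = 0 for its kernel L, so that C is a direct
   summand of V, which is homotopy equivalent to copies m P. *)
Lemma approximation_in_add (P C : complex A) m (pi : chain_map (copies m P) C) :
  perfect P -> two_term_support P -> perfect C -> two_term_support C ->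
  (forall f : chain_map P C, exists g : chain_map P (copies m P),
     forall i x, f i x = pi i (g i x)) ->
  (forall c : C 0, exists w c', c = pi 0 w + diff C (-1) 0 c') ->
  hom1_zero (diff P (-1) 0) (diff (copies m P) (-1) 0) setT setT ->
  (forall (V1 V0 : lmodType A) (dV : {linear V1 -> V0}) K1 K0, submodule K1 ->
    submodule K0 ->
     hom1_zero (diff P (-1) 0) dV K1 K0 -> hom1_zero (diff C (-1) 0) dV K1 K0) ->
  in_add P C.
Proof.
move=> pP P0 pC C0 approx surjC homW lift.
set W := copies m P in pi approx surjC homW *.
have pW : perfect W by exact: copies_perfect.
have W0 : two_term_support W by move=> i i1 i0; apply/copies_zero/P0.
set dP := diff P (-1) 0; set dW := diff W (-1) 0; set dC := diff C (-1) 0.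
pose V1 : lmodType A := (W (-1) * C (-1))%type.
pose V0 : lmodType A := (W 0 * C (-1))%type.
pose dV : {linear V1 -> V0} := lpair (lcomp dW (lfst (W (-1)) (C (-1))))
  (lsnd (W (-1)) (C (-1))).
pose p1 : {linear V1 -> C (-1)} := lcopair (pi (-1)) (lid (C (-1))).
pose p0 : {linear V0 -> C 0} := lcopair (pi 0) dC.
have pd v : p0 (dV v) = dC (p1 v).
  by rewrite /= linearD /dW (cmap_diff pi).
(* Since V is W plus a contractible complex, u is null-homotopic in V by (s2, w2). The images of s2
   and -w2 under p form a chain map P -> C; it factors through the approximation, and subtracting
   the factorization moves the homotopy into the kernel of p. *)
have homL : hom1_zero dP dV (kernel p1) (kernel p0).
  move=> u uK.
  have [s [w [uE _ _]]] := homW (lcomp (lfst (W 0) (C (-1))) u) (fun=> Logic.I).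
  pose s2 : {linear P 0 -> V0} := lcomp (linl (W 0) (C (-1))) s.
  pose w2 : {linear P (-1) -> V1} := lpair w (lcomp (lsnd (W 0) (C (-1))) u).
  have u2E x : u x = s2 (dP x) + dV (w2 x).
    rewrite [LHS]surjective_pairing; have /= -> := uE x.
    by congr pair; rewrite /= add0r.
  have [||f [f1E f0E]] := @chain_map_build _ _ P0 C
    (lopp (lcomp p1 w2)) (lcomp p0 s2).
  - move=> x; have uK' : p0 (u x) = 0 := uK x.
    rewrite u2E linearD pd in uK'.
    by rewrite [RHS]linearN; apply/eqP; rewrite -addr_eq0; apply/eqP.
  - by move=> x; apply: (C0 1).
  have [g gE] := approx f.
  pose l0 := lcomp (linl (W 0) (C (-1))) (g 0).
  pose l1 := lcomp (linl (W (-1)) (C (-1))) (g (-1)).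
  have l10 x : dV (l1 x) = l0 (dP x) by rewrite /= /dP (cmap_diff g); congr pair.
  have p0l x : p0 (l0 x) = p0 (s2 x) by have := f0E x; rewrite gE /= => <-;
    rewrite linear0 addr0.
  have p1l x : p1 (l1 x) = - p1 (w2 x) by have := f1E x; rewrite gE /= => <-;
    rewrite addr0.
  exists (lsub s2 l0), (ladd w2 l1).
  split=> x.
  - rewrite -[lsub _ _ _]/(s2 (dP x) - l0 (dP x)).
    by rewrite -[ladd _ _ _]/(w2 x + l1 x) linearD l10 addrACA addNr addr0.
  - have : p0 (s2 x - l0 x) = 0 by rewrite linearB p0l subrr.
    by [].
  - have : p1 (w2 x + l1 x) = 0 by rewrite linearD p1l subrr.
    by [].
have prC0 : projective (C 0) by have [_ /(_ 0)[]] := pC.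
have [|sig0 sig0E] := prC0 _ _ p0 (lid (C 0)).
  by move=> c; have [w [c' ->]] := surjC c; exists (w, c').
have {}sig0E c : p0 (sig0 c) = c := sig0E c.
pose sig1 := linr (W (-1)) (C (-1)).
have sig1E c : p1 (sig1 c) = c by rewrite /= linear0 add0r.
(* [sig1] and [sig0] split p degreewise but need not commute with the differentials. The defect u is
   a morphism C -> L[1], and its null-homotopy (s, w) corrects them to the chain map (t1, t0). *)
pose u := lsub (lcomp dV sig1) (lcomp sig0 dC).
have uE x : u x = dV (sig1 x) - sig0 (dC x) by [].
have [|s [w [ueq sK wK]]] := lift _ _ _ _ _ (submodule_kernel p1)
  (submodule_kernel p0) homL u.
  move=> x; have : p0 (u x) = 0 by rewrite uE linearB sig0E pd sig1E subrr.
  by [].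
have {}sK c : p0 (s c) = 0 := sK c.
have {}wK c : p1 (w c) = 0 := wK c.
pose t0 := ladd sig0 s; pose t1 := lsub sig1 w.
have t0E c : p0 (t0 c) = c.
  by rewrite -[t0 c]/(sig0 c + s c) linearD sig0E sK addr0.
have t1E c : p1 (t1 c) = c.
  by rewrite -[t1 c]/(sig1 c - w c) linearB sig1E wK subr0.
have td c : dV (t1 c) = t0 (dC c).
  rewrite -[t0 _]/(sig0 (dC c) + s (dC c)) -[t1 c]/(sig1 c - w c) linearB.
  have /eqP := ueq c; rewrite uE subr_eq => /eqP ->.
  by rewrite addrAC addrK addrC.
have [L1 [j1 [ij1 j1E]]] := submodule_type (submodule_kernel p1).
have [L0 [j0 [ij0 j0E]]] := submodule_type (submodule_kernel p0).
have pj1 l : p1 (j1 l) = 0.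
  by have : kernel p1 (j1 l) by rewrite -j1E; exists l.
have pj0 l : p0 (j0 l) = 0.
  by have : kernel p0 (j0 l) by rewrite -j0E; exists l.
have [|dL dLE] := factor_inj (g := lcomp dV j1) ij0.
  rewrite j0E => _ [l _ <-]; have : p0 (dV (j1 l)) = 0 by rewrite pd pj1 linear0.
  by [].
have {}dLE l : j0 (dL l) = dV (j1 l) := dLE l.
have [|r1 r1E] := factor_inj (g := lsub (lid V1)
    (lcomp t1 p1)) ij1.
  rewrite j1E => _ [v _ <-].
  have : p1 (v - t1 (p1 v)) = 0 by rewrite linearB t1E subrr.
  by [].
have {}r1E v : j1 (r1 v) = v - t1 (p1 v) := r1E v.
have [|r0 r0E] := factor_inj (g := lsub (lid V0)
    (lcomp t0 p0)) ij0.
  rewrite j0E => _ [v _ <-].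
  have : p0 (v - t0 (p0 v)) = 0 by rewrite linearB t0E subrr.
  by [].
have {}r0E v : j0 (r0 v) = v - t0 (p0 v) := r0E v.
have rj1 l : r1 (j1 l) = l by apply: ij1; rewrite r1E pj1 linear0 subr0.
have rj0 l : r0 (j0 l) = l by apply: ij0; rewrite r0E pj0 linear0 subr0.
have rt1 c : r1 (t1 c) = 0 by apply: ij1; rewrite r1E t1E subrr linear0.
have rt0 c : r0 (t0 c) = 0 by apply: ij0; rewrite r0E t0E subrr linear0.
have rd v : r0 (dV v) = dL (r1 v).
  by apply: ij0; rewrite r0E dLE r1E linearB td pd.
pose L := two_term dL.
have [_ prW] := pW; have [_ prC] := pC.
have pL : perfect L.
  apply: two_term_perfect.
    have [fV1 prV1] := fg_projective_pair (prW (-1)) (prC (-1)).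
    split; last exact: projective_retract rj1 prV1.
    by apply: (fg_surj (p := r1)) => // l; exists (j1 l).
  have [fV0 prV0] := fg_projective_pair (prW 0) (prC (-1)).
  split; last exact: projective_retract rj0 prV0.
  by apply: (fg_surj (p := r0)) => // l; exists (j0 l).
have L_0 : two_term_support L by exact: two_term_obj_zero.
split=> //; exists m, L; split=> //.
have CL0 : two_term_support (direct_sum C L).
  by move=> i i1 i0; apply: is_zero_pair; [apply: C0|apply: L_0].
pose th1 := lcopair t1 j1; pose th0 := lcopair t0 j0.
pose ph1 := lpair p1 r1; pose ph0 := lpair p0 r0.
have thd (x : (C (-1) * L1)%type) : dV (th1 x) = th0 (dC x.1, dL x.2).
  by rewrite -[th1 x]/(t1 x.1 + j1 x.2) linearD td -dLE.
have ph1E v : ph1 v = (p1 v, r1 v) by [].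
have ph0E v : ph0 v = (p0 v, r0 v) by [].
have phth1 (x : (C (-1) * L1)%type) : ph1 (th1 x) = x.
  rewrite -[th1 x]/(t1 x.1 + j1 x.2) ph1E (linearD p1) (linearD r1).
  by rewrite t1E pj1 rt1 rj1 addr0 add0r -surjective_pairing.
have phth0 (x : (C 0 * L0)%type) : ph0 (th0 x) = x.
  rewrite -[th0 x]/(t0 x.1 + j0 x.2) ph0E (linearD p0) (linearD r0).
  by rewrite t0E pj0 rt0 rj0 addr0 add0r -surjective_pairing.
have thph1 v : th1 (ph1 v) = v.
  by rewrite -[th1 _]/(t1 (p1 v) + j1 (r1 v)) r1E addrC subrK.
have thph0 v : th0 (ph0 v) = v.
  by rewrite -[th0 _]/(t0 (p0 v) + j0 (r0 v)) r0E addrC subrK.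
have phd v : ph0 (dV v) = (dC (p1 v), dL (r1 v)).
  by rewrite ph0E pd rd.
have [||f [f1E f0E]] := @chain_map_build _ _ CL0 W
  (lcomp (lfst (W (-1)) (C (-1))) th1)
  (lcomp (lfst (W 0) (C (-1))) th0).
- by move=> x; exact: esym (congr1 fst (thd x)).
- by move=> x; apply: (W0 1).
have [||g [g1E g0E]] := @chain_map_build _ _ W0 (direct_sum C L)
  (lcomp ph1 (linl (W (-1)) (C (-1))))
  (lcomp ph0 (linl (W 0) (C (-1)))).
- move=> x; apply: etrans (phd (x, 0)).
  by congr (ph0 _); rewrite /=.
- by move=> x; apply: (@is_zero_pair _ (C 1) (L 1)); [apply: C0|apply: L_0].
exists f, g; split.
  (* The contraction of the added complex C^-1 -> C^-1; passing through W loses exactly this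
     summand. *)
  pose k0 : {linear V0 -> V1} := lcomp (linr (W (-1)) (C (-1)))
    (lsnd (W 0) (C (-1))).
  have dk v : dV (0, v) = (0, v) by rewrite /= linear0.
  have dph k : diff (direct_sum C L) (-1) 0 (ph1 (0, k)) = ph0 (0, k).
    by have := phd (0, k); rewrite dk => ->.
  have sp1 v : ph1 (v.1, 0) - ph1 v = - ph1 (0, v.2).
    rewrite -(linearB ph1) -(linearN ph1); congr (ph1 _); case: v => a b.
    by congr pair; rewrite /= ?subrr ?oppr0 ?sub0r.
  have sp0 v : ph0 (v.1, 0) - ph0 v = - ph0 (0, v.2).
    rewrite -(linearB ph0) -(linearN ph0); congr (ph0 _); case: v => a b.
    by congr pair; rewrite /= ?subrr ?oppr0 ?sub0r.
  apply: (@homotopic_build _ _ CL0 (direct_sum C L) _ _ (lzero _ _)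
    (lopp (lcomp ph1 (lcomp k0 th0)))) => x.
    have -> : comp_map g f (-1) x = ph1 ((th1 x).1, 0).
      exact: etrans (g1E _) (congr1 (fun y => ph1 (y, 0)) (f1E x)).
    have := sp1 (th1 x); rewrite phth1 => spE.
    rewrite linear0 add0r; apply: etrans spE _.
    have th2 : (th1 x).2 = (th0 (dC x.1, dL x.2)).2 := congr1 snd (thd x).
    by rewrite th2.
  have -> : comp_map g f 0 x = ph0 ((th0 x).1, 0).
    exact: etrans (g0E _) (congr1 (fun y => ph0 (y, 0)) (f0E x)).
  have := sp0 (th0 x); rewrite phth0 => spE; apply: etrans spE _.
  by rewrite -dph -linearN.
apply: homotopic_eq => i x.
have [i1|i1] := eqVneq i (-1).
  subst i; apply: etrans (f1E _) _; rewrite g1E.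
  have thE : (th1 (ph1 (x, 0))).1 = x by rewrite thph1.
  exact: thE.
have [i0|i0] := eqVneq i 0.
  subst i; apply: etrans (f0E _) _; rewrite g0E.
  have thE : (th0 (ph0 (x, 0))).1 = x by rewrite thph0.
  exact: thE.
by apply: is_zero_eq; apply: W0.
Qed.

End TwoTermComplex.

(** * Generation of the perfect complexes *)

Section Cone.
Variable A : pzRingType.
Implicit Types (C E T : complex A).

Lemma chain_map_to_degree C T (t1 : {linear C (-1) -> T (-1)}) :
  (forall x, diff T (-1) 0 (t1 x) = 0) -> (forall x, t1 (diff C (-2) (-1) x) = 0) ->
  exists f : chain_map C T, (forall x, f (-1) x = t1 x) /\
    forall i : int, i != -1 -> forall x, f i x = 0.
Proof.
move=> dt td.
pose f i : {linear C i -> T i} :=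
  match i as k return {linear C k -> T k} with
  | Negz 0 => t1 | _ => lzero _ _ end.
have fz i x : i != -1 -> f i x = 0 by case: i x => [i|[|i]].
have fd i j x : f j (diff C i j x) = diff T i j (f i x).
  have [->|ji] := eqVneq j (i + 1); last by rewrite !diff_shape ?linear0.
  have [i1|i1] := eqVneq i (-1).
    by subst i; rewrite [LHS]fz //; exact: esym (dt x).
  rewrite [f i x]fz // linear0.
  have [i2|i2] := eqVneq i (-2); first by subst i; exact: td.
  by apply: fz; rewrite -subr_eq0 opprK -addrA addr_eq0.
by exists (ChainMap fd); split=> // i i1 x; exact: fz.
Qed.

Lemma homotopic_build3 C E (f g : chain_map C E)
    (h1 : {linear C (-1) -> E (-2)}) (h0 : {linear C 0 -> E (-1)}) :
  (forall i : int, i != -2 -> i != -1 -> i != 0 -> is_zero (C i)) ->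
  (forall x, f (-2) x - g (-2) x = h1 (diff C (-2) (-1) x)) ->
  (forall x, f (-1) x - g (-1) x =
     diff E (-2) (-1) (h1 x) + h0 (diff C (-1) 0 x)) ->
  (forall x, f 0 x - g 0 x = diff E (-1) 0 (h0 x)) -> homotopic f g.
Proof.
move=> C0 E2 E1 E0.
pose h i j : {linear C i -> E j} :=
  match i as k, j as l return {linear C k -> E l} with
  | Negz 0, Negz 1 => h1 | Posz 0, Negz 0 => h0
  | _, _ => lzero _ _ end.
exists h => i x.
have [i2|i2] := eqVneq i (-2).
  by subst i; rewrite [diff E _ _ _]linear0 add0r; exact: E2.
have [i1|i1] := eqVneq i (-1); first by subst i; exact: E1.
have [i0|i0] := eqVneq i 0.
  subst i; have -> : diff C 0 (0 + 1) x = 0 by exact: (C0 1).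
  by rewrite linear0 addr0; exact: E0.
by rewrite (C0 i i2 i1 i0 x) !linear0.
Qed.

Section ExtensionByShift.
Variables (E : lmodType A) (W : complex A).
Hypothesis W0 : two_term_support W.
Variable ep : {linear W (-1) -> E}.

Definition extension_diff : {linear W (-1) -> (E * W 0)%type} :=
  lpair ep (diff W (-1) 0).

(* The triangle W[-1] -> E -> C -> W, rotated. *)
Lemma extension_cone : exists k : chain_map (two_term extension_diff) W,
  homotopy_equivalent (cone k) (shift (stalk E) 1).
Proof.
set C := two_term extension_diff; set T := shift (stalk E) 1.
have C0 : two_term_support C by exact: two_term_obj_zero.
have [||k [k1 k0]] := @chain_map_build _ _ C0 W (lid (W (-1)))
  (lsnd E (W 0)).
- by [].
- by move=> x; apply: (W0 (i := 1)).
exists k.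
have T0 : two_term_support T.
  by move=> i i1 _; apply: stalk_zero; rewrite addr_eq0.
have dE2 c w : diff (cone k) (-2) (-1) (c, w) = ((- ep c, - diff W (-1) 0 c), c).
  have -> : w = 0 by exact: (W0 (i := -2)).
  congr pair; rewrite [X in _ + X]linear0 addr0.
  exact: etrans (@degree_mapE A C W k (-1) c) (k1 c).
have dE1 x p0 p1 : diff (cone k) (-1) 0 ((x, p0), p1) = (0, p0 + diff W (-1) 0 p1).
  congr pair; first by apply: (is_zero_eq (V := C 1)); exact: C0.
  by congr (_ + _); exact: etrans (@degree_mapE A C W k 0 (x, p0)) (k0 _).
(* The term [ep] on W^-1 cancels the E-component -ep(c) of the incoming differential computed in
   [dE2]. *)
have [||f [fE _]] := @chain_map_to_degree (cone k) T (lcopair (lfst E (W 0)) ep).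
- by move=> x; apply: (is_zero_eq (V := T 0)); exact: stalk_zero.
- by move=> [c w]; rewrite dE2 /= addNr.
have [||g [gE g0]] := @chain_map_to_degree T (cone k)
  (lcomp (linl (E * W 0)%type (W (-1)))
    (linl E (W 0))).
- by move=> x; rewrite [LHS]dE1 linear0 addr0.
- by move=> x; rewrite (_ : diff T _ _ x = 0) ?linear0 //= oppr0.
exists f, g; split; last first.
  apply: homotopic_eq => i x; have [i1|i1] := eqVneq i (-1).
    by subst i; apply: etrans (fE _) _; rewrite gE /= linear0 addr0.
  have [i0|i0] := eqVneq i 0; apply: is_zero_eq; last exact: T0.
  by subst i; exact: stalk_zero.
(* Modulo E, [cone k] is the cone of the identity of W; [h1] and [h0] are, up to sign, its standard
   contraction. *)
have [h1 h1E] : exists h1 : {linear cone k (-1) -> cone k (-2)},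
    forall x p0 p1, h1 ((x, p0), p1) = (- p1, 0).
  exists (lcomp (linl (W (-1)) (W (-2)))
    (lopp (lsnd (E * W 0)%type (W (-1))))).
  by [].
have [h0 h0E] : exists h0 : {linear cone k 0 -> cone k (-1)},
    forall x p, h0 (x, p) = ((0, - p), 0).
  exists (lcomp (linl (E * W 0)%type (W (-1)))
   (lcomp (linr E (W 0))
    (lopp (lsnd (C 1) (W 0))))).
  by [].
apply: (@homotopic_build3 (cone k) (cone k) _ _ h1 h0).
- move=> i i2 i1 i0; apply: is_zero_pair; last exact: W0.
  by apply: C0; [rewrite -subr_eq0 opprK -addrA addr_eq0|rewrite addr_eq0].
- move=> [c w]; have -> : comp_map g f (-2) (c, w) = 0 by apply: g0.
  rewrite sub0r dE2 h1E; congr pair.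
  by apply: (is_zero_eq (V := W (-2))); exact: W0.
- move=> [[x p0] p1].
  have -> : comp_map g f (-1) ((x, p0), p1) = ((x + ep p1, 0), 0).
    by apply: etrans (gE _) _; rewrite fE.
  rewrite h1E dE2 dE1 h0E; congr pair; last by rewrite /= addr0 sub0r.
  congr pair; rewrite /= !linearN ?opprK ?addr0;
    first by rewrite addrAC subrr add0r.
  by rewrite opprD addrCA subrr addr0 sub0r.
move=> [x p]; have -> : comp_map g f 0 (x, p) = 0 by apply: g0.
rewrite sub0r h0E dE1 linear0 addr0; congr pair.
by apply: (is_zero_eq (V := C 1)); exact: C0.
Qed.

End ExtensionByShift.
End Cone.

(** * Generation of the shifted finitely generated projective modules *)

Section StalkGeneration.
Variables (R : comPzRingType) (A : algType R).
Hypothesis hR : artinian R^o.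
Hypothesis hA : @finitely_generated R A.
Variables (I : lmodType R) (e : {linear R^o -> I}).
Hypothesis hI : injective_envelope e (@jacobson_radical R).
Variable P : complex A.
Hypothesis P0 : two_term_support P.
Hypothesis fprP : forall i, finitely_generated (P i) /\ projective (P i).
Local Notation d := (diff P (-1) 0).
Hypothesis homP : hom1_zero d d setT setT.
Hypothesis spanP : forall (Z : lmodType A) (K : set Z), finitely_generated Z ->
  (forall f : {linear P (-1) -> Z}, exists g : {linear P 0 -> Z},
    forall x, f x = g (d x)) -> submodule K ->
  (forall g : {linear P 0 -> Z}, (forall x, g (d x) = 0) -> forall x, K (g x)) ->
  forall z, K z.

Lemma stalk_generated (E : lmodType A) (TT : complex A -> Prop) :
  finitely_generated E -> projective E -> triangulated TT ->
  (forall C, in_add P C -> TT C) -> TT (shift (stalk E) 1).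
Proof.
move=> fgE prE [TTp TTh TTs TTc] addTT.
have pP : perfect P by split=> //; exact: two_term_bounded.
set T := shift (stalk E) 1.
have [||||n [ep epE]] := copies_approximation hR hA hI (P := P) (T := T) P0.
- by have [] := fprP (-1).
- by have [] := fprP 0.
- exact: fgE.
- by apply: fg_zero; exact: stalk_zero.
set W := copies n P in ep epE.
have pW : perfect W by exact: copies_perfect.
have W0 : two_term_support W by move=> i i1 i0; apply/copies_zero/P0.
have [_ prW] := pW.
(* The cocone of the approximation W -> E[1]. *)
pose C := two_term (@extension_diff A E W (ep (-1))).
have pC : perfect C by apply: two_term_perfect => //; apply: fg_projective_pair.
have C0 : two_term_support C by exact: two_term_obj_zero.
have pT : perfect T.
  split=> [|i].
    exists 1%N => i i1; apply: stalk_zero; rewrite addr_eq0.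
    by apply: contraTneq i1 => ->.
  have [i1|i1] := eqVneq i (-1); first by subst i.
  by apply: fg_projective_zero; apply: stalk_zero; rewrite addr_eq0.
have dC x : diff C (-1) 0 x = (ep (-1) x, diff W (-1) 0 x) by [].
have homW := hom1_zero_copies_target (n := n) homP.
have homC : forall u : {linear P (-1) -> C 0}, exists (s : {linear P 0 -> C 0})
    (w : {linear P (-1) -> C (-1)}), forall x, u x = s (d x) + diff C (-1) 0 (w x).
  move=> u.
  have [s [w [uE _ _]]] := homW (lcomp (lsnd E (W 0)) u) (fun=> Logic.I).
  (* With the W^0-component solved by s and w, the error in the E-component is a morphism P -> E[1].
     It factors through [ep], and the factorization g absorbs it without changing the
     W^0-component. *)
  pose u1 : {linear P (-1) -> E} := lcomp (lfst E (W 0)) u.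
  have [||f [f1E _]] := @chain_map_build _ _ P0 T
    (lsub u1 (lcomp (ep (-1)) w)) (lzero _ _).
  - by move=> x; rewrite /= oppr0.
  - by move=> x; rewrite /= oppr0.
  have [g gE] := epE f.
  exists (lcomp (linr E (W 0)) (lsub s (g 0))).
  exists (ladd w (g (-1))) => x.
  rewrite dC [u x]surjective_pairing; congr pair => /=.
    by rewrite add0r linearD -gE f1E /= addrC subrK.
  have /= -> := uE x; rewrite linearD -(cmap_diff g) addrACA.
  by rewrite addNr addr0.
have [_ prC] := pC.
have [||||m [pi piE]] := copies_approximation hR hA hI (P := P) (T := C) P0.
- by have [] := fprP (-1).
- by have [] := fprP 0.
- by have [] := prC (-1).
- by have [] := prC 0.
have surjC (c : C 0) : exists w c', c = pi 0 w + diff C (-1) 0 c'.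
  have [Z [z [sz zE]]] := quotient_type (submodule_range (diff C (-1) 0)).
  have zd c' : z (diff C (-1) 0 c') = 0.
    by have : kernel z (diff C (-1) 0 c') by rewrite zE; exists c'.
  pose q := lcopair (pi 0) (diff C (-1) 0).
  (* [spanP] is applied to H^0(C). A map P^0 -> H^0(C) killing boundaries lifts to a chain map P ->
     C, which factors through [pi], so its values come from the range of q. *)
  have : (z @` range q) (z c).
    apply: spanP.
    - by apply: (fg_surj sz); have [] := prC 0.
    - move=> f; have [_ pr1] := fprP (-1); have [f' f'E] := pr1 _ _ z f sz.
      have [s [w swE]] := homC f'; exists (lcomp z s) => x.
      by rewrite -f'E swE linearD zd addr0.
    - exact/submodule_image/submodule_range.
    move=> g gd x; have [_ pr0] := fprP 0; have [g' g'E] := pr0 _ _ z g sz.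
    have [|g1 g1E] := projective_lift (f := lcomp g' d)
      (g := diff C (-1) 0) (proj2 (fprP (-1))).
      by rewrite -zE => _ [y _ <-]; rewrite /kernel /= g'E gd.
    have [||f [_ fE]] := @chain_map_build _ _ P0 C g1 g'.
    - by move=> y; rewrite g1E.
    - by move=> y; apply: (is_zero_eq (V := C 1)); exact: C0.
    have [h hE] := piE f; exists (q (h 0 x, 0)); first by exists (h 0 x, 0).
    rewrite -g'E -[q _]/(pi 0 (h 0 x) + diff C (-1) 0 0) [diff C _ _ 0]linear0.
    by rewrite addr0 -hE fE.
  case=> _ [[w c0] _ <-] /kernelB; rewrite zE => -[c' _ c'E].
  exists w, (c0 - c'); rewrite (linearB (diff C (-1) 0)) c'E.
  rewrite -[q _]/(pi 0 w + diff C (-1) 0 c0) opprB.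
  by rewrite addrA [RHS]addrC subrK.
have TTC : TT C.
  apply: addTT; apply: (approximation_in_add (pi := pi)) => //.
    exact: (hom1_zero_copies_target (n := m) homP).
  (* C and W share their term in degree -1, so a factorization for W becomes one for C through the
     projection of C^0 onto W^0. *)
  move=> V1 V0 dV K1 K0 sK1 sK0 hP u uK.
  have [s [w [uE sK wK]]] := hom1_zero_copies_source (n := n) sK1 sK0 hP (u := u)
    uK.
  exists (lcomp s (lsnd E (W 0))), w.
  by split=> x; [exact: uE|exact: sK|exact: wK].
have [k kE] := @extension_cone A E W W0 (ep (-1)).
apply: TTh pT kE _; apply: TTc => //; apply: addTT.
exact: in_add_copies.
Qed.

End StalkGeneration.

(** * Reduction of perfect complexes to single modules by truncation *)

Section PerfectGeneration.
Variable A : pzRingType.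
Implicit Types (C E F T : complex A).

Definition concentrated C (n : int) := forall i, i != n -> is_zero (C i).

Lemma chain_map_concentrated C E n (a : {linear C n -> E n}) :
  concentrated C n -> concentrated E n ->
  exists f : chain_map C E, forall x, f n x = a x.
Proof.
move=> Cn En.
pose f i : {linear C i -> E i} := match @eqP _ n i with
  | ReflectT ni => ecast k {linear C k -> E k} ni a
  | ReflectF _ => lzero _ _ end.
have fd i j x : f j (diff C i j x) = diff E i j (f i x).
  have [ij|ij] := eqVneq j (i + 1); last by rewrite !diff_shape ?linear0.
  have [ni|ni] := eqVneq i n; last by rewrite (Cn i ni x) !linear0.
  by apply/is_zero_eq/En; rewrite ij ni -subr_eq0 addrAC subrr add0r.
exists (ChainMap fd) => x; rewrite /= /f; case: eqP => // nn.
by rewrite eq_axiomK.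
Qed.

Lemma homotopy_equivalent_concentrated C E n
    (a : {linear C n -> E n}) (b : {linear E n -> C n}) :
  concentrated C n -> concentrated E n -> cancel a b -> cancel b a ->
  homotopy_equivalent C E.
Proof.
move=> Cn En ab ba.
have [f fE] := chain_map_concentrated a Cn En.
have [g gE] := chain_map_concentrated b En Cn.
apply: (@homotopy_equivalent_iso _ _ _ f g) => i x.
  have [ni|ni] := eqVneq i n; last by apply/is_zero_eq/Cn.
  by subst i; rewrite fE gE.
have [ni|ni] := eqVneq i n; last by apply/is_zero_eq/En.
by subst i; rewrite gE fE.
Qed.

Lemma stalk_iso (Z : lmodType A) (k : int) : k = 0 ->
  exists (a : {linear Z -> stalk Z k}) (b : {linear stalk Z k -> Z}),
    cancel a b /\ cancel b a.
Proof. by move=> ->; exists (lid Z), (lid Z). Qed.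

(** With [if_out], these maps confine the dependent case distinction on truncated terms to [if_inK]
    and [if_outK]. *)
Definition if_in (b : bool) (Z : lmodType A) :
    {linear Z -> (if b then Z else 'rV[A]_0 : lmodType A)} :=
  if b as c return {linear Z -> (if c then Z else 'rV[A]_0 : lmodType A)}
  then lid Z else lzero _ _.

Definition if_out (b : bool) (Z : lmodType A) :
    {linear (if b then Z else 'rV[A]_0 : lmodType A) -> Z} :=
  if b as c return {linear (if c then Z else 'rV[A]_0 : lmodType A) -> Z}
  then lid Z else lzero _ _.

Lemma if_inK (b : bool) Z z : if_out b Z (if_in b Z z) = if b then z else 0.
Proof. by case: b. Qed.

Lemma if_outK (b : bool) Z : cancel (if_out b Z) (if_in b Z).
Proof. by case: b => //= z; apply/is_zero_eq/zero_rV0. Qed.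

Lemma if_zero (b : bool) (Z : lmodType A) :
  (b -> is_zero Z) -> is_zero (if b then Z else 'rV[A]_0 : lmodType A).
Proof. by case: b => [h|_]; [exact: h|exact: zero_rV0]. Qed.

Lemma if_fg_projective (b : bool) (Z : lmodType A) :
  finitely_generated Z /\ projective Z ->
  finitely_generated (if b then Z else 'rV[A]_0 : lmodType A) /\
  projective (if b then Z else 'rV[A]_0 : lmodType A).
Proof. by case: b => // _; apply/fg_projective_zero/zero_rV0. Qed.

Section Truncation.
Variables (F : complex A) (n : int).

(** F^n sits in degree n + 1, where the differential of F maps it into the truncation; the cone
    moves it back to degree n. *)
Definition bottom : complex A.
Proof.
exists (fun i => if i == n + 1 then F n else 'rV[A]_0 : lmodType A)
  (fun i j => lzero _ _).
- by [].
- by [].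
Defined.

Definition truncation : complex A.
Proof.
exists (fun i => if (n < i) then F i else 'rV[A]_0 : lmodType A)
  (fun i j => lcomp (if_in (n < j) (F j))
    (lcomp (diff F i j) (if_out (n < i) (F i)))).
- by move=> i j ij x /=; rewrite diff_shape // linear0.
- move=> i j k x /=; rewrite if_inK (fun_if (diff F j k)) diff_diff.
  by rewrite linear0 if_same linear0.
Defined.

Lemma bottom_concentrated : concentrated bottom (n + 1).
Proof. by move=> i ni; apply: if_zero => /eqP in_; rewrite in_ eqxx in ni. Qed.

Definition connecting_map : chain_map bottom truncation.
Proof.
exists (fun i => lcomp (if_in (n < i) (F i))
  (lcomp (diff F n i) (if_out (i == n + 1) (F n)))).
move=> i j x /=; rewrite !linear0 if_inK (fun_if (diff F i j)) diff_diff.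
by rewrite linear0 if_same linear0.
Defined.

Definition transport_degree (i j : int) : {linear F i -> F j} :=
  mklinear (@degree_map_linear A F F (id_map F) i j).

Lemma transport_degreeE i x : transport_degree i i x = x.
Proof. exact: degree_mapE. Qed.

Lemma transport_degree0 i j x : i != j -> transport_degree i j x = 0.
Proof. exact: degree_map0. Qed.

Hypothesis Fn : forall i, (i < n) -> is_zero (F i).

Lemma truncation_cone : homotopy_equivalent (cone connecting_map) F.
Proof.
pose f i : {linear cone connecting_map i -> F i} :=
  lcopair (lcomp (transport_degree n i) (if_out (i + 1 == n + 1) (F n)))
  (if_out (n < i) (F i)).
pose g i : {linear F i -> cone connecting_map i} :=
  lpair (lcomp (if_in (i + 1 == n + 1) (F n)) (transport_degree i n))
  (if_in (n < i) (F i)).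
have fE i (x : bottom (i + 1)) (y : truncation i) : f i (x, y) =
  transport_degree n i (if_out (i + 1 == n + 1) (F n) x) + if_out (n < i) (F i) y
    by [].
have gE i z : g i z = (if_in (i + 1 == n + 1) (F n) (transport_degree i n z),
  if_in (n < i) (F i) z) by [].
have coneE i (x : bottom (i + 1)) (y : truncation i) :
    diff (cone connecting_map) i (i + 1) (x, y) =
    (0, connecting_map (i + 1) x + diff truncation i (i + 1) y).
  congr pair; first exact: oppr0.
  by congr (_ + _); exact: degree_mapE.
have connE i x : connecting_map i x =
  if_in (n < i) (F i) (diff F n i (if_out (i == n + 1) (F n) x)) by [].
have truncE i j y : diff truncation i j y =
  if_in (n < j) (F j) (diff F i j (if_out (n < i) (F i) y)) by [].
have b0 i (x : bottom (i + 1)) : i != n -> x = 0.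
  by move=> ni; apply: bottom_concentrated; rewrite (inj_eq (addIr 1)).
have fd i j x : f j (diff (cone connecting_map) i j x) = diff F i j (f i x).
  have [->|ij] := eqVneq j (i + 1); last by rewrite !diff_shape ?linear0.
  case: x => x y; rewrite coneE !fE !linear0 add0r connE truncE [RHS]linearD
    [LHS]linearD.
  rewrite !if_inK; congr (_ + _).
    have [ni|ni] := eqVneq i n; last first.
      rewrite (b0 i x ni) !linear0.
      by rewrite if_same.
    subst i; rewrite transport_degreeE ltrDl ltr01.
    by [].
  case: ifP => // /negbT; rewrite -leNgt => ni.
  have -> : y = 0 by apply: if_zero => ?; lia.
  by rewrite !linear0.
have gd i j z : g j (diff F i j z) = diff (cone connecting_map) i j (g i z).
  have [->|ij] := eqVneq j (i + 1); last by rewrite !diff_shape ?linear0.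
  rewrite (gE i) coneE gE; congr pair.
    have [ni|ni] := eqVneq (i + 1) n; last by rewrite transport_degree0 // linear0.
    by rewrite (Fn (i := i) _ z) ?linear0 //; lia.
  rewrite connE truncE !if_inK.
  have [ni|ni|ni] := ltgtP i n.
  - by rewrite (Fn ni z) !linear0 !if_same !linear0 addr0.
  - have nin : i != n by rewrite gt_eqF.
    by rewrite transport_degree0 // if_same !linear0 add0r.
  by subst i; rewrite eqxx transport_degreeE !linear0 addr0.
apply: (@homotopy_equivalent_iso _ _ _ (ChainMap fd) (ChainMap gd)) => i x.
  case: x => x y; rewrite -[LHS]/(g i (f i (x, y))) fE gE.
  have [ni|ni] := eqVneq i n; last first.
    rewrite (b0 i x ni) linear0 linear0 add0r transport_degree0 // linear0.
    by rewrite if_outK.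
  subst i; rewrite !transport_degreeE.
  have y0 : y = 0 by apply: if_zero; rewrite ltxx.
  rewrite y0 linear0 addr0 if_outK; congr pair.
  by apply: is_zero_eq; apply: if_zero; rewrite ltxx.
rewrite -[LHS]/(f i (g i x)) gE fE !if_inK.
have [ni|ni|ni] := ltgtP i n.
- by rewrite (Fn ni x) !linear0 if_same linear0 addr0.
- by rewrite transport_degree0 ?add0r // lt_eqF.
by subst i; rewrite eqxx !transport_degreeE addr0.
Qed.

End Truncation.

Lemma perfect_generated (TT : complex A -> Prop) : triangulated TT ->
  (forall E : lmodType A, finitely_generated E -> projective E ->
     TT (shift (stalk E) 1)) ->
  forall F, perfect F -> TT F.
Proof.
move=> [TTp TTh TTs TTc] TTstalk.
have single F n : perfect F -> concentrated F n -> TT F.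
  move=> pF Fn; have [_ prF] := pF; have [fgn prn] := prF n.
  (* The second shift undoes the first and moves the module from degree 0 to degree n. *)
  pose G := shift (shift (stalk (F n)) 1) (- n - 1).
  have [|a [b [ab ba]]] := @stalk_iso (F n) (n + (- n - 1) + 1); first by lia.
  apply: (TTh G F pF); last by apply/TTs/TTstalk.
  apply: (@homotopy_equivalent_concentrated G F n b a) => // i ni.
  by apply: stalk_zero; apply: contra ni; lia.
(* Induction on the width w of an interval [n, n + w) containing the support; for w = 0 all terms
   vanish. *)
have step w : forall F n, perfect F ->
    (forall i, ~~ ((n <= i) && (i < n + w%:Z)) -> is_zero (F i)) -> TT F.
  elim: w => [|w IH] F n pF Fw.
    by apply: (single F n pF) => i _; apply: Fw; lia.
  have [[N bN] prF] := pF.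
  apply: (TTh _ F pF) (@truncation_cone F n _) _ => [i ni|]; first by apply: Fw;
    lia.
  apply: TTc.
    apply: (single _ (n + 1)); last exact: bottom_concentrated.
    split=> [|i]; last exact: if_fg_projective.
    by exists `|(n + 1)%R|%N => i ni; apply: bottom_concentrated; lia.
  apply: (IH _ (n + 1)) => [|i ni].
    split=> [|i]; last exact: if_fg_projective.
    by exists N => i ni; apply: if_zero => _; apply: bN.
  by apply: if_zero => ni'; apply: Fw; lia.
move=> F pF; have [[N bN] _] := pF.
(* The degrees from -N to N, both included. *)
apply: (step (2 * N + 1)%N F (- N%:Z) pF) => i Ni; apply: bN; lia.
Qed.

End PerfectGeneration.

Theorem theorem5p8 (R : comPzRingType) (A : algType R)
  (hR : artinian R^o) (hA : @finitely_generated R A)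
  (I : lmodType R) (e : {linear R^o -> I})
  (hI : injective_envelope e (@jacobson_radical R))
  (XX YY : lmodType A -> Prop) (hXY : torsion_theory XX YY)
  (X : lmodType A) (hX : XX X) (projX : Ext_projective X XX)
  (genX : generates X XX)
  (Y : lmodType A) (hY : YY Y) (injY : Ext_injective Y YY)
  (cogenY : cogenerates Y YY)
  (stabX : stable_under_tensor (dual_bimodule A I) XX)
  (M : complex A) (hM : minimal_projective_presentation M X)
  (N : complex A) (hN : minimal_injective_presentation N Y) :
  let P := direct_sum M (shift (hom_complex (dual_bimodule A I) N) 1) in
  [/\ tilting_complex P,
      (forall Z : lmodType A, XX Z <-> Xc P Z) &
      (forall Z : lmodType A, YY Z <-> Yc P Z)].
Proof.
set P := direct_sum _ _; pose d := diff P (-1) 0.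
have P0 : two_term_support P := two_term_zero hM hN.
have fprP := two_term_fg_projective hR hA hI hM hN : forall i,
  finitely_generated (P i) /\ projective (P i).
have prP i : projective (P i) := proj2 (fprP i).
have XP Z (fgZ : finitely_generated Z) :=
  two_term_torsion hR hA hI hXY projX hY cogenY hM hN fgZ.
have YP Z (fgZ : finitely_generated Z) :=
  two_term_torsion_free hR hA hI hXY hX genX injY hM hN fgZ.
(* H = H^0(P) *)
have [H [q [sq qd]]] := quotient_type (submodule_range d).
have qd0 x : q (d x) = 0 by have : kernel q (d x) by rewrite qd; exists x.
have fgH : finitely_generated H by apply: (fg_surj sq); have [] := fprP 0.
have XH : XX H.
  apply: (torsion_of_hom0 hXY fgH) => W f YW h; have [x <-] := sq h.
  have := (YP W (torsion_free_fg hXY YW)).1 YW (lcomp f q).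
  by apply=> y /=; rewrite [q _]qd0 linear0.
(* As H is in XX, q u factors through d as g d. A lift s of g to P^0 leaves a difference u - s d
   with values in range d, which lifts to w. *)
have homP (u : {linear P (-1) -> P 0}) : exists (s : {linear P 0 -> P 0})
    (w : {linear P (-1) -> P (-1)}), forall x, u x = s (d x) + d (w x).
  have [g gE] := (XP H fgH).1 XH (lcomp q u).
  have [s sE] := prP 0 _ _ q g sq.
  have [|w wE] := projective_lift (g := d)
    (f := lsub u (lcomp s d)) (prP (-1)).
    rewrite -qd => _ [x _ <-]; rewrite /kernel /= linearB sE.
    by rewrite -[g _](gE x) subrr.
  exists s, w => x; rewrite wE; apply/esym.
  exact: etrans (addrC (s (d x)) _) (subrK _ _).
split.
- split; first by split=> //; exact: two_term_bounded.
    apply: (derived_Hom_zero_shift P0 prP homP) => u ud du x.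
    have [|h hE] := factor_surj (g := u) sq.
      by rewrite qd => _ [y _ <-]; apply: ud.
    rewrite -hE; apply: (two_term_cycles hR hI hXY projX hY stabX hM hN XH).
    by move=> y; have [z <-] := sq y; rewrite hE.
  move=> TT triTT addTT; apply: perfect_generated => // E fgE prE.
  apply: (stalk_generated hR hA hI P0 fprP) => //.
    by move=> u _; have [s [w swE]] := homP u; exists s, w.
  move=> Z K fgZ fac sK gK.
  exact: (two_term_span genX hM ((XP Z fgZ).2 fac) sK gK).
- move=> Z; split=> [XZ|[fgZ /(derived_Hom_zero_stalk_shift P0 prP) fac]].
    have fgZ := torsion_fg hXY XZ; split=> //.
    by apply/(derived_Hom_zero_stalk_shift P0 prP)/(XP Z fgZ).
  exact/(XP Z fgZ).
- move=> Z; split=> [YZ|[fgZ /(derived_Hom_zero_stalk P0 prP) h0]].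
    have fgZ := torsion_free_fg hXY YZ; split=> //.
    by apply/(derived_Hom_zero_stalk P0 prP)/(YP Z fgZ).
  exact/(YP Z fgZ).
Qed.
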